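(* Let $a$ be a proper impedance on the bounded interval $I$, $x_0\in\overline I$, and $1\le p<\infty$. (i) If $a,\frac1a\in L^\infty(I)$, then the formal powers $\{\varphi_a^{(k)}\}_{k=0}^\infty$ are a complete system in $W^{1,p}(I)$. (ii) For $m\in\mathbb{N}$, $m\ge2$, if $a\in W^{m-1,p}(I)$, then the formal powers $\{\varphi_a^{(k)}\}_{k=0}^\infty$ are a complete system in $W^{m,p}(I)$.
   Context: Let $I\subset\mathbb{R}$ be a bounded interval with closure $\overline I$, and fix $x_0\in\overline I$. A proper impedance on $I$ is a positive measurable function $a\in L^2(I)$ with $\frac1a\in L^2(I)$. The formal powers associated with $a$ (centered at $x_0$) are $\varphi_a^{(0)}:=1$, $\varphi_a^{(1)}(x):=\int_{x_0}^x\frac{dt}{a^2(t)}$, and for $k\ge2$, $\varphi_a^{(k)}(x):=k(k-1)\int_{x_0}^x\frac{1}{a^2(t)}\int_{x_0}^t a^2(s)\varphi_a^{(k-2)}(s)\,ds\,dt$. A sequence is a complete system in a Banach space $X$ if its linear span is dense in $X$.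
   Formalization: In (ii), for m=2 and 1≤p<2 only, the hypothesis 1/a∈L^∞(I) is added: without it the claim fails (I=(0,1), x_0=0, a=x^{1/4}, p=1 gives φ^{(1)}=2√x, not in W^{2,1}), and it is necessary for φ^{(1)}∈W^{2,p}(I). *)

(* Defs.v *)
From HB Require Import structures.
From mathcomp Require Import all_boot all_order all_algebra.
From mathcomp Require Import all_classical all_reals all_analysis.

Set Implicit Arguments.
Unset Strict Implicit.
Unset Printing Implicit Defensive.

Import Order.TTheory GRing.Theory Num.Theory.
Import numFieldNormedType.Exports.

Local Open Scope classical_set_scope.
Local Open Scope ring_scope.

Section LebesgueSobolev.
Context {R : realType}.
Implicit Types (I : set R) (f g : R -> R).

Local Notation mu := (@lebesgue_measure R).

(* Functions on I are represented by total functions whose values outside I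
   are irrelevant: f \_ I extends f|_I by zero. *)
Definition Lp_on I (p : \bar R) f : Prop := (f \_ I : R -> R) \in Lfun mu p.

Definition Lp_norm I (p : \bar R) f : \bar R := 'N[mu]_p[EFin \o (f \_ I)]%E.

(* C_c^infty(I°), as functions on the whole line. *)
Definition test_function I (psi : R -> R) : Prop :=
  (forall n x, derivable (derive1n n psi) x 1) /\
  exists K : set R,
    [/\ compact K, K `<=` I° & forall x, ~ K x -> psi x = 0].

(* g is a k-th weak derivative of f on I. *)
Definition is_weak_deriv I (k : nat) f g : Prop :=
  [/\ locally_integrable I° f, locally_integrable I° g &
      forall psi, test_function I psi ->
        \int[mu]_(x in I) (f x * derive1n k psi x) =
        (-1) ^+ k * \int[mu]_(x in I) (g x * psi x)].

(* W^{m,p}(I), as a set of representatives modulo a.e. equality on I. *)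
Definition Sobolev I (m : nat) (p : R) : set (R -> R) :=
  [set f | Lp_on I p%:E f /\
    forall k, (k <= m)%N ->
      exists g, Lp_on I p%:E g /\ is_weak_deriv I k f g].

(* A choice of k-th weak derivative, unique up to a.e. equality on I; it is
   the zero function when there is none. *)
Definition weak_deriv I (k : nat) f : R -> R :=
  xget (cst 0) [set g | is_weak_deriv I k f g].

Definition Sobolev_norm I (m : nat) (p : R) f : \bar R :=
  (\sum_(k < m.+1) Lp_norm I p%:E (weak_deriv I k f))%E.

(* The space X with norm N is given by representatives, so that N is only a
   seminorm on functions; N-density of the span is density in the quotient. *)
Definition complete_system (X : set (R -> R)) (N : (R -> R) -> \bar R)
    (u : nat -> R -> R) : Prop :=
  (forall k, X (u k)) /\
  forall f, X f -> forall e : R, 0 < e ->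
    exists n (c : 'I_n -> R),
      (N (fun x => f x - \sum_(k < n) c k * u k x)%R < e%:E)%E.

End LebesgueSobolev.

Section FormalPowers.
Context {R : realType}.
Implicit Types (I : set R) (a f : R -> R).

Local Notation mu := (@lebesgue_measure R).

Definition proper_impedance I a : Prop :=
  [/\ {ae mu, forall x, I x -> 0 < a x},
      Lp_on I 2%:E a & Lp_on I 2%:E (fun x => (a x)^-1)].

(* Signed integral: it changes sign when the bounds are exchanged. *)
Definition int_from_to (x0 x : R) f : R :=
  if x0 <= x then \int[mu]_(t in `[x0, x]) f t
  else - \int[mu]_(t in `[x, x0]) f t.

Fixpoint formal_power a (x0 : R) (k : nat) (x : R) : R :=
  match k with
  | 0 => 1
  | 1 => int_from_to x0 x (fun t => (a t ^+ 2)^-1)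
  | j.+2 => (j.+2 * j.+1)%:R *
      int_from_to x0 x (fun t => (a t ^+ 2)^-1 *
        int_from_to x0 t (fun s => a s ^+ 2 * formal_power a x0 j s))
  end.

End FormalPowers.

(* Main.v *)
(* On J = [al, be], the closure of I, write w1 = a^-2 and w2 = a^2, both bounded and
   bounded away from 0, and T f = int_al w1 (int_al w2 f).  Moving the center from
   x0 to al changes formal powers only by affine combinations, so that their span V
   contains 1 and int_al w1 and is stable under T.

   Density in L^p (m = 0).  Let L = w2^-1 d/dx w1^-1 d/dx with Neumann conditions.
   For u in its domain, N steps of the implicit Euler scheme for u' = L u give a
   function g close to u in the sup norm, since L satisfies the maximum principle.
   The Taylor expansion of g at al involves only the T^k 1, because w1^-1 g' vanishes
   at al, and its remainder tends to 0 as N grows.  The domain of L contains tent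
   functions, which approximate indicators of half-lines in L^p.

   Density in W^{1,p}.  If f = c + int_al g, approximate w2 g in L^p by psi in the
   span of the dual system, obtained by exchanging w1 and w2, and f by
   c + int_al w1 psi.

   Density in W^{m+2,p}.  With h = w1 (w2 f')', f is the sum of T h and an affine
   combination of 1 and int_al w1; approximate h in W^{m,p} by an element of V.

   In (ii), unless m = 2 and p < 2, the product of a' and 1/a is integrable, hence a is
   bounded below on J: if a(z) = 0 then |a| = |int_z (a'/a) a| <= (sup |a|) / 2 near z,
   so that a vanishes on an interval. *)

Require Import Defs.
From HB Require Import structures.
From mathcomp Require Import all_boot all_order all_algebra.
From mathcomp Require Import all_classical all_reals all_analysis.
From mathcomp Require Import measurable_realfun ess_sup_inf ring lra.
From mathcomp Require finmap.
Import Order.TTheory GRing.Theory Num.Theory.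
Import numFieldNormedType.Exports.
Local Open Scope classical_set_scope.
Local Open Scope ring_scope.
Set Implicit Arguments.
Unset Strict Implicit.
Unset Printing Implicit Defensive.

(** The formal powers span no algebra and the weights are only bounded and measurable, so
    Stone-Weierstrass does not apply and a general function has no Taylor expansion in them. The
    resolvent supplies the missing smoothness: N steps with parameter N / d put the function into
    the domain of L^N, at the price of a factor (2 N / d)^N for L^N g. The kernel of T^N contributes
    1 / (2 N)!, and (2 N)! >= N! N^N leaves a term q^N / N! of an exponential series. Hence d can be
    fixed from the size of L u alone, and N sent to infinity afterwards. The Neumann condition at
    the right end makes the resolvent equation solvable by shooting and closes the maximum principle
    at that end. Membership in L^p or W^{m,p} concerns classes modulo null sets, while iterated
    primitives need identities at every point. Therefore [a] is replaced by a representative [A]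
    bounded everywhere, and Sobolev functions by iterated primitives ([Sob]); the passage to and
    from classes takes place only at the two ends of the argument. *)

Local Notation ae_filterS := (@filterS _ _ (ae_filter_ringOfSetsType (@lebesgue_measure _)) _ _ _).
Local Notation ae_filterS2 := (@filterS2 _ _ (ae_filter_ringOfSetsType (@lebesgue_measure _)) _ _ _ _).
Local Notation ae_filterS3 := (@filterS3 _ _ (ae_filter_ringOfSetsType (@lebesgue_measure _)) _ _ _ _ _).

(** * Primitives of integrable functions *)

Section Primitive.
Context {R : realType}.
Local Notation mu := (@lebesgue_measure R).
Implicit Types (f g h : R -> R) (al be x y : R).

Definition ibl al be f := mu.-integrable `[al, be] (EFin \o f).

(** For [x < al] the interval is empty and the value is 0, so this is a primitive of [f] only to the
    right of [al]. *)
Definition prim al f x : R := \int[mu]_(t in `[al, x]) f t.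

Lemma ibl_meas al be f : ibl al be f -> measurable_fun `[al, be] f.
Proof. by move=> /measurable_int /measurable_EFinP. Qed.

Lemma iblS al be f a b : al <= a -> b <= be -> ibl al be f -> ibl a b f.
Proof.
move=> aa bb; apply: integrableS => //; apply: subset_itvScc; rewrite bnd_simp//.
Qed.

Lemma iblD al be f g : ibl al be f -> ibl al be g -> ibl al be (fun x => f x + g x).
Proof.
move=> hf hg; rewrite /ibl (_ : EFin \o _ = (EFin \o f) \+ (EFin \o g))%E//.
exact: integrableD.
Qed.

Lemma iblZ al be c f : ibl al be f -> ibl al be (fun x => c * f x).
Proof.
move=> hf; rewrite /ibl (_ : EFin \o _ = (fun x => c%:E * (EFin \o f) x))%E//.
exact: integrableZl.
Qed.

Lemma iblN al be f : ibl al be f -> ibl al be (fun x => - f x).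
Proof.
move=> hf; rewrite /ibl (_ : EFin \o _ = \- (EFin \o f))%E//.
exact: integrableN.
Qed.

Lemma iblB al be f g : ibl al be f -> ibl al be g -> ibl al be (fun x => f x - g x).
Proof. by move=> hf hg; apply: iblD => //; apply: iblN. Qed.

Lemma ibl_norm al be f : ibl al be f -> ibl al be (fun x => `|f x|).
Proof. exact: integrable_abse. Qed.

Lemma ibl_eq al be f g : {in `[al, be], f =1 g} -> ibl al be f -> ibl al be g.
Proof.
move=> fg; apply: eq_integrable => //= x; rewrite inE => xJ.
by rewrite fg.
Qed.

Definition bm al be (M : R) f :=
  measurable_fun `[al, be] f /\ {in `[al, be], forall x, `|f x| <= M}.

Lemma bm_ibl al be M f : bm al be M f -> ibl al be f.
Proof.
move=> [mf fM]; apply: measurable_bounded_integrable => //.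
  by have := lebesgue_measure_itv `[al, be]; rewrite /= => ->; case: ifP; rewrite ?ltry// -?EFinD ltry.
exists M; split; rewrite ?num_real// => y My x/= xJ.
by apply: le_trans (fM _ _) (ltW My).
Qed.

Lemma ibl_le al be f g : measurable_fun `[al, be] f ->
  ibl al be g -> {in `[al, be], forall x, `|f x| <= g x} -> ibl al be f.
Proof.
move=> mf hg fg; apply: le_integrable hg => //.
  exact/measurable_EFinP.
move=> x /= xJ; rewrite lee_fin.
by apply: le_trans (fg _ _) _ => //; exact: ler_norm.
Qed.

Lemma bm_iblM al be M f g : bm al be M f -> ibl al be g ->
  ibl al be (fun x => f x * g x).
Proof.
move=> [mf fM] hg.
apply: (@ibl_le _ _ _ (fun x => M * `|g x|)).
- by apply: measurable_funM => //; exact: ibl_meas.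
- by apply: iblZ; exact: ibl_norm.
- by move=> x xJ; rewrite normrM; apply: ler_wpM2r => //; exact: fM.
Qed.

Lemma bmM al be M N f g : bm al be M f -> bm al be N g ->
  bm al be (M * N) (fun x => f x * g x).
Proof.
move=> [mf fM] [mg gN]; split; first exact: measurable_funM.
by move=> x xJ; rewrite normrM ler_pM ?fM ?gN.
Qed.

Lemma bmD al be M N f g : bm al be M f -> bm al be N g ->
  bm al be (M + N) (fun x => f x + g x).
Proof.
move=> [mf fM] [mg gN]; split; first exact: measurable_funD.
by move=> x xJ; rewrite (le_trans (ler_normD _ _))// lerD ?fM ?gN.
Qed.

Lemma bmZ al be M f c : bm al be M f -> bm al be (`|c| * M) (fun x => c * f x).
Proof.
move=> [mf fM]; split; first exact: measurable_funM.
by move=> x xJ; rewrite normrM ler_wpM2l ?fM.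
Qed.

Lemma bmN al be M f : bm al be M f -> bm al be M (fun x => - f x).
Proof.
move=> [mf fM]; split; first exact: measurableT_comp.
by move=> x xJ; rewrite normrN ?fM.
Qed.

Lemma bmB al be M N f g : bm al be M f -> bm al be N g ->
  bm al be (M + N) (fun x => f x - g x).
Proof. by move=> bf bg; apply: bmD => //; apply: bmN. Qed.

Lemma bm_cst al be c : bm al be `|c| (fun=> c).
Proof. by split => //; exact: measurable_cst. Qed.

Lemma bmW al be M N f : M <= N -> bm al be M f -> bm al be N f.
Proof. by move=> MN [mf fM]; split => // x xJ; exact: le_trans (fM _ xJ) MN. Qed.

Lemma bmS al be f a b M : al <= a -> b <= be -> bm al be M f -> bm a b M f.
Proof.
move=> aa bb [mf fM].
have sub : `[a, b] `<=` `[al, be] by apply: subset_itvScc; rewrite bnd_simp.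
split; first by apply: measurable_funS mf.
by move=> x xJ; apply: fM; exact: sub.
Qed.

Lemma bm_eq al be M f g : {in `[al, be], f =1 g} -> bm al be M f -> bm al be M g.
Proof.
move=> fg [mf fM]; split; last by move=> x xJ; rewrite -fg ?fM.
by apply: eq_measurable_fun mf => x; rewrite inE => xJ; exact: fg.
Qed.

Lemma eq_prim al f g x : {in `[al, x], f =1 g} -> prim al f x = prim al g x.
Proof. by move=> fg; apply: eq_Rintegral => y; rewrite inE => /fg. Qed.

Lemma prim_al al f : prim al f al = 0.
Proof. by rewrite /prim set_itv1 Rintegral_set1. Qed.

Lemma primD al f g x : ibl al x f -> ibl al x g ->
  prim al (fun t => f t + g t) x = prim al f x + prim al g x.
Proof. by move=> hf hg; rewrite /prim RintegralD. Qed.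

Lemma primB al f g x : ibl al x f -> ibl al x g ->
  prim al (fun t => f t - g t) x = prim al f x - prim al g x.
Proof. by move=> hf hg; rewrite /prim RintegralB. Qed.

Lemma primZ al f c x : ibl al x f ->
  prim al (fun t => c * f t) x = c * prim al f x.
Proof. by move=> hf; rewrite /prim RintegralZl. Qed.

Lemma primN al f x : ibl al x f -> prim al (fun t => - f t) x = - prim al f x.
Proof.
move=> hf; rewrite -[RHS]mulN1r -primZ//.
by apply: eq_prim => t _; rewrite mulN1r.
Qed.

Lemma prim_ge0 al f x : {in `[al, x], forall t, 0 <= f t} -> 0 <= prim al f x.
Proof. by move=> f0; apply: Rintegral_ge0 => t /= /f0. Qed.

Lemma le_prim al f g x : ibl al x f -> ibl al x g ->
  {in `[al, x], forall t, f t <= g t} -> prim al f x <= prim al g x.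
Proof. by move=> hf hg fg; apply: le_Rintegral => //= t /fg. Qed.

Lemma ler_norm_prim al f x : ibl al x f -> `|prim al f x| <= prim al (fun t => `|f t|) x.
Proof. by move=> hf; apply: le_normr_Rintegral. Qed.

Lemma prim_cst al c x : al <= x -> prim al (fun=> c) x = c * (x - al).
Proof.
move=> ax; rewrite /prim Rintegral_cst//.
have := lebesgue_measure_itv `[al, x]; rewrite /= => ->.
rewrite lte_fin; case: ltP => // xa.
by rewrite (@le_anti _ _ x al) ?ax ?xa// subrr.
Qed.

Lemma prim_split al f x y : al <= x -> x <= y -> ibl al y f ->
  prim al f y = prim al f x + prim x f y.
Proof.
move=> ax xy hf.
have := @Rintegral_itvB R f (BLeft al) (BRight y) x hf.
rewrite !bnd_simp => /(_ ax xy) /eqP; rewrite subr_eq => /eqP.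
rewrite /prim => ->; rewrite addrC; congr (_ + _).
rewrite -Rintegral_itv_obnd_cbnd//.
apply: (@integrableS _ _ _ mu `[al, y]) => //; apply: subset_itvr.
by rewrite bnd_simp.
Qed.

Lemma prim_cont al be f : al <= be -> ibl al be f ->
  {within `[al, be], continuous (prim al f)}.
Proof. exact: parameterized_integral_continuous. Qed.

Lemma cont_bm al be f : {within `[al, be], continuous f} -> exists M, bm al be M f.
Proof.
move=> cf.
have /compact_bounded[M [_ mrt]] := continuous_compact cf (@segment_compact _ al be).
exists (M + 1); split; first by apply: subspace_continuous_measurable_fun.
move=> x xJ; apply: (mrt (M + 1)); first by rewrite ltrDl.
by exists x.
Qed.

Lemma prim_bm al be f M : al <= be -> bm al be M f -> bm al be (M * (be - al)) (prim al f).
Proof.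
move=> ab bf; have hf := bm_ibl bf; split.
  by apply: subspace_continuous_measurable_fun => //; exact: prim_cont.
move=> x xJ; have [ax xb] : al <= x /\ x <= be by move: xJ; rewrite in_itv/= => /andP.
have hfx : ibl al x f by apply: iblS hf.
have M0 : 0 <= M by apply: le_trans (bf.2 x xJ).
apply: le_trans (ler_norm_prim hfx) _.
apply: (@le_trans _ _ (prim al (fun=> M) x)).
  apply: le_prim => //; first exact: ibl_norm.
    exact: bm_ibl (@bm_cst _ _ M).
  by move=> t tx; apply: bf.2; apply: subset_itvScc tx; rewrite bnd_simp.
by rewrite prim_cst// ler_wpM2l// lerD2r.
Qed.

Lemma prim_ae al be f g x : x <= be -> measurable_fun `[al, be] f -> measurable_fun `[al, be] g ->
  {ae mu, forall t, t \in `[al, be] -> f t = g t} -> prim al f x = prim al g x.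
Proof.
move=> xb mf mg fg; rewrite /prim /Rintegral; congr fine.
have sub : `[al, x] `<=` `[al, be] by apply: subset_itvScc; rewrite bnd_simp.
apply: ae_eq_integral => //.
- by apply/measurable_EFinP; apply: measurable_funS mf.
- by apply/measurable_EFinP; apply: measurable_funS mg.
- apply: (ae_filterS fg) => t /= fgt tx.
  by rewrite fgt//; exact: sub.
Qed.

End Primitive.

(** * Product rule for primitives of integrable functions *)

Section Product.
Context {R : realType}.
Local Notation mu := (@lebesgue_measure R).
Implicit Types (f g h : R -> R) (al be x y : R).

Lemma mu_itv_fin al be : (mu `[al, be] < +oo)%E.
Proof.
by have := lebesgue_measure_itv `[al, be]; rewrite /= => ->; case: ifP; rewrite ?ltry// -?EFinD ltry.
Qed.

Lemma approx_cont al be f (e : R) : ibl al be f -> 0 < e ->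
  exists2 g, continuous g & prim al (fun t => `|f t - g t|) be < e.
Proof.
move=> hf e0.
have [g_ [cg ig gl]] := approximation_continuous_integrable (measurable_itv _) (mu_itv_fin al be) hf.
have /fine_cvgP[_ /cvgrPdist_lt/(_ _ e0)] := gl.
move=> [N _ /(_ N (leqnn _))] /=; rewrite sub0r normrN => H.
by exists (g_ N) => //; apply: le_lt_trans H; exact: ler_norm.
Qed.

Lemma cont_ibl al be f : continuous f -> ibl al be f.
Proof.
move=> cf; apply: continuous_compact_integrable; first exact: segment_compact.
exact: continuous_subspaceT.
Qed.

Lemma in_itvE al be x : (x \in `[al, be]) = (al <= x <= be).
Proof. by rewrite in_itv. Qed.

Lemma prim_bmx al be f : al <= be -> ibl al be f ->
  bm al be (prim al (fun t => `|f t|) be) (prim al f).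
Proof.
move=> ab hf; split.
  by apply: subspace_continuous_measurable_fun => //; exact: prim_cont.
move=> x; rewrite in_itvE => /andP[ax xb].
have hx : ibl al x f by apply: iblS hf.
apply: le_trans (ler_norm_prim hx) _.
rewrite [leRHS](@prim_split _ _ _ x be)//; last exact: ibl_norm.
by rewrite lerDl prim_ge0.
Qed.

Lemma prim_mul_cont al be g h : al < be -> continuous g -> continuous h ->
  prim al g be * prim al h be =
  prim al (fun t => g t * prim al h t + prim al g t * h t) be.
Proof.
move=> ab cg ch.
have dlr f : continuous f -> derivable_oo_LRcontinuous (prim al f) al be /\
    {in `]al, be[, derive1 (prim al f) =1 f}.
  move=> cf.
  have D x : x \in `]al, be[ -> derivable (prim al f) x 1 /\ derive1 (prim al f) x = f x.
    rewrite in_itv/= => /andP[ax xb].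
    by apply: (@continuous_FTC1_closed _ f al x be) => //; [exact: cont_ibl|exact: cf].
  split; last by move=> x /D[].
  have /(continuous_within_itvP _ ab)[_ c1 c2] : {within `[al, be], continuous (prim al f)}.
    by apply: prim_cont; [exact: ltW|exact: cont_ibl].
  by split => // x /D[].
have [Dg Eg] := dlr _ cg; have [Dh Eh] := dlr _ ch.
have abW := ltW ab.
have ig := @cont_ibl al be _ cg; have ih := @cont_ibl al be _ ch.
rewrite primD; last 2 first.
- apply: (@ibl_eq _ _ _ (fun t => prim al h t * g t)); first by move=> t _; rewrite mulrC.
  by apply: bm_iblM ig; exact: prim_bmx.
- by apply: bm_iblM ih; exact: prim_bmx.
have := @Rintegration_by_parts _ _ _ g h al be ab (continuous_subspaceT cg) Dg Eg (continuous_subspaceT ch) Dh Eh.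
rewrite !prim_al mul0r subr0 => E.
have E' : prim al (fun t => prim al g t * h t) be =
  prim al g be * prim al h be - prim al (fun t => g t * prim al h t) be by exact: E.
by rewrite E' addrC subrK.
Qed.

(** Each of the three terms in the defect of the product rule is at most the product of the two L^1
    norms. This makes the defect continuous in L^1. *)
Lemma prim_mul_bound al be g h : al <= be -> ibl al be g -> ibl al be h ->
  `|prim al g be * prim al h be - prim al (fun t => g t * prim al h t + prim al g t * h t) be|
  <= 3 * (prim al (fun t => `|g t|) be * prim al (fun t => `|h t|) be).
Proof.
move=> ab ig ih.
have Ng := prim_bmx ab ig; have Nh := prim_bmx ab ih.
have i1 : ibl al be (fun t => g t * prim al h t).
  by apply: (@ibl_eq _ _ _ (fun t => prim al h t * g t)); [move=> t _; rewrite mulrC|exact: (bm_iblM Nh ig)].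
have i2 : ibl al be (fun t => prim al g t * h t) by exact: (bm_iblM Ng ih).
set G := prim al (fun t => `|g t|) be in Ng *; set H := prim al (fun t => `|h t|) be in Nh *.
rewrite primD//.
have b1 : `|prim al (fun t => g t * prim al h t) be| <= G * H.
  apply: le_trans (ler_norm_prim i1) _; rewrite mulrC -primZ; last exact: ibl_norm.
  apply: le_prim; [exact: ibl_norm|by apply: iblZ; exact: ibl_norm|].
  by move=> t tJ; rewrite normrM mulrC ler_wpM2r// Nh.2.
have b2 : `|prim al (fun t => prim al g t * h t) be| <= G * H.
  apply: le_trans (ler_norm_prim i2) _; rewrite -primZ; last exact: ibl_norm.
  apply: le_prim; [exact: ibl_norm|by apply: iblZ; exact: ibl_norm|].
  by move=> t tJ; rewrite normrM ler_wpM2r// Ng.2.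
have b3 : `|prim al g be * prim al h be| <= G * H.
  by rewrite normrM ler_pM// ler_norm_prim.
rewrite (le_trans (ler_normB _ _))//.
have := ler_normD (prim al (fun t => g t * prim al h t) be) (prim al (fun t => prim al g t * h t) be).
lra.
Qed.

(** The defect [D] is additive in each argument, symmetric and controlled by L^1 norms; it vanishes
    on continuous functions, which are dense in L^1. *)
Lemma prim_mul al be g h : al <= be -> ibl al be g -> ibl al be h ->
  prim al g be * prim al h be =
  prim al (fun t => g t * prim al h t + prim al g t * h t) be.
Proof.
rewrite le_eqVlt => /predU1P[<-|ab] ig ih; first by rewrite !prim_al mul0r.
have abW := ltW ab.
pose D g h := prim al g be * prim al h be - prim al (fun t => g t * prim al h t + prim al g t * h t) be.
have lem f k : ibl al be f -> ibl al be k -> ibl al be (fun t => k t * prim al f t).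
  move=> hf hk; apply: (@ibl_eq _ _ _ (fun t => prim al f t * k t)); first by move=> t _; rewrite mulrC.
  by apply: bm_iblM hk; exact: prim_bmx.
have lem' f k : ibl al be f -> ibl al be k -> ibl al be (fun t => prim al f t * k t).
  by move=> hf hk; apply: bm_iblM hk; exact: prim_bmx.
have DC g1 h1 : D g1 h1 = D h1 g1.
  by rewrite /D mulrC; congr (_ - _); apply: eq_prim => t _; rewrite addrC mulrC [in X in _ + X]mulrC.
have DB g1 g2 h1 : ibl al be g1 -> ibl al be g2 -> ibl al be h1 ->
    D g1 h1 = D (fun t => g1 t - g2 t) h1 + D g2 h1.
  move=> i1 i2 i3; rewrite /D.
  have -> : prim al (fun t => g1 t * prim al h1 t + prim al g1 t * h1 t) be =
     prim al (fun t => (g1 t - g2 t) * prim al h1 t + prim al (fun t => g1 t - g2 t) t * h1 t) be +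
     prim al (fun t => g2 t * prim al h1 t + prim al g2 t * h1 t) be.
    rewrite -primD.
    - apply: eq_prim => t; rewrite in_itvE => /andP[ta tb].
      rewrite (@primB _ _ _ _ t); [ring|exact: iblS i1|exact: iblS i2].
    - by apply: iblD; [apply: lem => //; exact: iblB|apply: lem' => //; exact: iblB].
    - by apply: iblD; [apply: lem|apply: lem'].
  rewrite (@primB _ _ g1 g2)//; ring.
suff : `|D g h| <= 0 by rewrite normr_le0 subr_eq0 => /eqP.
apply/ler_addgt0Pr => e e0; rewrite add0r.
pose K := prim al (fun t => `|h t|) be.
have K0 : 0 <= K by apply: prim_ge0.
have e1 : 0 < e / 6 / (K + 1) by rewrite !divr_gt0// ltr_wpDl.
have [g1 cg1 Hg1] := approx_cont ig e1.
pose L := prim al (fun t => `|g1 t|) be.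
have L0 : 0 <= L by apply: prim_ge0.
(* [L] depends on [g1], so [h] is approximated only once [g1] is fixed. With the factor 3 of
   [prim_mul_bound], each of the two errors costs at most 3 (e / 6). *)
have e2 : 0 < e / 6 / (L + 1) by rewrite !divr_gt0// ltr_wpDl.
have [h1 ch1 Hh1] := approx_cont ih e2.
have ig1 := @cont_ibl al be _ cg1; have ih1 := @cont_ibl al be _ ch1.
rewrite (DB g g1 h)// (DC g1 h) (DB h h1 g1)// (DC h1 g1) [X in _ + (_ + X)](_ : _ = 0); last first.
  by rewrite /D prim_mul_cont// subrr.
rewrite addr0 (le_trans (ler_normD _ _))//.
have B1 := prim_mul_bound abW (iblB ig ig1) ih.
have B2 := prim_mul_bound abW (iblB ih ih1) ig1.
rewrite /D; apply: le_trans (lerD B1 B2) _.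
rewrite -/K -/L.
have C1 : prim al (fun t => `|g t - g1 t|) be * K <= e / 6.
  apply: le_trans (ler_wpM2r K0 (ltW Hg1)) _.
  by rewrite mulrAC ler_pdivrMr ?ltr_wpDl// ler_wpM2l ?divr_ge0 ?(ltW e0)// lerDl.
have C2 : prim al (fun t => `|h t - h1 t|) be * L <= e / 6.
  apply: le_trans (ler_wpM2r L0 (ltW Hh1)) _.
  by rewrite mulrAC ler_pdivrMr ?ltr_wpDl// ler_wpM2l ?divr_ge0 ?(ltW e0)// lerDl.
lra.
Qed.

End Product.

(** * Gronwall's lemma with an integrable kernel, and the inverse of a primitive *)

Section Gronwall.
Context {R : realType}.
Implicit Types (f g h k y : R -> R) (al be x z : R).

Lemma measurable_invr (D : set R) f : measurable_fun D f ->
  measurable_fun D (fun t => (f t)^-1).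
Proof.
move=> mf; rewrite (_ : (fun _ => _) = (fun t => f t * (f t ^+ 2) `^ (-1))).
  apply: measurable_funM => //.
  by apply: (measurableT_comp (measurable_powR (-1))); apply: measurable_funX.
apply/funext => t; rewrite powR_inv1 ?sqr_ge0// expr2 invfM.
by have [->|ft0] := eqVneq (f t) 0; rewrite ?invr0 ?mul0r// mulVKf.
Qed.

Lemma wc_cst (A : set R) (c : R) : {within A, continuous (fun=> c)}.
Proof. by move=> x; exact: cvg_cst. Qed.

Lemma wcM (A : set R) f g : {within A, continuous f} -> {within A, continuous g} ->
  {within A, continuous (fun x => f x * g x)}.
Proof. by move=> cf cg x; apply: cvgM; [exact: cf|exact: cg]. Qed.

Lemma wcD (A : set R) f g : {within A, continuous f} -> {within A, continuous g} ->
  {within A, continuous (fun x => f x + g x)}.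
Proof. by move=> cf cg x; apply: cvgD; [exact: cf|exact: cg]. Qed.

Lemma wcB (A : set R) f g : {within A, continuous f} -> {within A, continuous g} ->
  {within A, continuous (fun x => f x - g x)}.
Proof. by move=> cf cg x; apply: cvgB; [exact: cf|exact: cg]. Qed.

Let quarter : 0 < 1 / 4 :> R. Proof. lra. Qed.

Lemma prim_sub_small al be k z (e : R) : al <= be -> ibl al be k -> z \in `[al, be] -> 0 < e ->
  exists2 r, 0 < r & forall x, x \in `[al, be] -> `|x - z| < r ->
    `|prim al k x - prim al k z| < e.
Proof.
move=> ab ik zJ e0.
have /subspace_continuousP/(_ z zJ)/cvgrPdist_lt/(_ e e0) := prim_cont ab ik.
rewrite near_withinE => -[r /= r0 H]; exists r => // x xJ xz.
by rewrite distrC; apply: H => //=; rewrite distrC.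
Qed.

(** The primitive of [k] moves by less than 1/4 on either side of [z]. A mass of at most 1/2 is what
    lets an estimate of a maximum absorb itself; the cases [z = al] and [z = be] stand for one-sided
    neighbourhoods. *)
Lemma small_itv al be k z : al < be -> ibl al be k -> {in `[al, be], forall t, 0 <= k t} ->
  z \in `[al, be] -> exists c d,
  [/\ al <= c, c <= z, z <= d, d <= be & [/\ c < d, (c < z \/ z = al), (z < d \/ z = be) & prim c k d <= 1 / 2]].
Proof.
move=> ab ik k0 zJ; move: (zJ); rewrite in_itvE => /andP[az zb].
have [r r0 Hr] := prim_sub_small (ltW ab) ik zJ quarter.
exists (Num.max al (z - r / 2)), (Num.min be (z + r / 2)).
have r2 : 0 < r / 2 by rewrite divr_gt0.
have c1 : al <= Num.max al (z - r / 2) by rewrite le_max lexx.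
have c2 : Num.max al (z - r / 2) <= z by rewrite ge_max az/= gerBl ltW.
have d1 : z <= Num.min be (z + r / 2) by rewrite le_min zb/= lerDl ltW.
have d2 : Num.min be (z + r / 2) <= be by rewrite ge_min lexx.
have cz : Num.max al (z - r / 2) < z \/ z = al.
  move: az; rewrite le_eqVlt => /predU1P[->|az]; [by right|left].
  by rewrite gt_max az/= ltrBlDr ltrDl.
have dz : z < Num.min be (z + r / 2) \/ z = be.
  move: zb; rewrite le_eqVlt => /predU1P[->|zb]; [by right|left].
  by rewrite lt_min zb/= ltrDl.
have c3 : z - r / 2 <= Num.max al (z - r / 2) by rewrite le_max lexx orbT.
have d3 : Num.min be (z + r / 2) <= z + r / 2 by rewrite ge_min lexx orbT.
set c := Num.max _ _ in c1 c2 c3 cz *; set d := Num.min _ _ in d1 d2 d3 dz *.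
split => //; split => //.
  case: cz => [cz|za]; first exact: lt_le_trans d1.
  by case: dz => [|zbE]; [exact: le_lt_trans|move: ab; rewrite -za -zbE ltxx].
have cJ : c \in `[al, be] by rewrite in_itvE c1/= (le_trans c2).
have dJ : d \in `[al, be] by rewrite in_itvE d2 (le_trans az).
have cr : `|c - z| < r by rewrite ler0_norm ?subr_le0//; lra.
have dr : `|d - z| < r by rewrite ger0_norm ?subr_ge0//; lra.
have := Hr c cJ cr; have := Hr d dJ dr.
have -> : prim al k d = prim al k c + prim c k d.
  by apply: prim_split => //; [exact: le_trans d1|exact: iblS ik].
rewrite !ltr_norml => /andP[_ h1] /andP[h2 _]; lra.
Qed.

(** Continuation: let [s] be the supremum of the points up to which [y] vanishes. On an interval
    around [s] where [k] has mass at most 1/2, the maximum of |y| is at most half of itself, so [y]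
    vanishes beyond [s] unless [s] is already the right end. *)
Lemma gronwall0 al be k y : al <= be -> ibl al be k -> {in `[al, be], forall t, 0 <= k t} ->
  {within `[al, be], continuous y} ->
  {in `[al, be], forall x, `|y x| <= prim al (fun t => k t * `|y t|) x} ->
  {in `[al, be], forall x, y x = 0}.
Proof.
rewrite le_eqVlt => /predU1P[<-|ab] ik k0 cy Hy.
  move=> x xJ; have := Hy x xJ; move: xJ; rewrite in_itvE => /andP[a1 a2].
  by rewrite (@le_anti _ _ x al) ?a1 ?a2// prim_al normr_le0 => /eqP.
have abW := ltW ab.
pose S := [set s | s \in `[al, be] /\ {in `[al, s], forall x, y x = 0}].
have Sal : S al.
  split; first by rewrite in_itvE lexx.
  move=> x; rewrite in_itvE => /andP[a1 a2].
  have xJ : x \in `[al, be] by rewrite in_itvE a1 (le_trans a2).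
  have := Hy x xJ; rewrite (@le_anti _ _ x al) ?a1 ?a2// prim_al normr_le0.
  by move/eqP.
have hS : has_sup S.
  split; first by exists al.
  by exists be => s [+ _]; rewrite in_itvE => /andP[].
pose s := sup S.
have sJ : s \in `[al, be].
  rewrite in_itvE; apply/andP; split; first exact: sup_upper_bound.
  by apply: ge_sup; [exists al|move=> u [+ _]; rewrite in_itvE => /andP[]].
have [r r0 Hr] := prim_sub_small abW ik sJ quarter.
have [s' [s'J Ss'] s'S] := sup_adherent r0 hS.
have s's : s - r < s' := s'S.
have s'le : s' <= s by apply: sup_upper_bound.
move: (sJ) (s'J); rewrite !in_itvE => /andP[as1 sb] /andP[as' s'b].
pose d := Num.min be (s + r / 2).
have r2 : 0 < r / 2 by rewrite divr_gt0.
have d1 : s <= d by rewrite le_min sb/= lerDl ltW.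
have d2 : d <= be by rewrite ge_min lexx.
have d3 : d <= s + r / 2 by rewrite ge_min lexx orbT.
have s'd : s' <= d by exact: le_trans d1.
have ad : al <= d by exact: le_trans s'd.
have subJ x : x \in `[s', d] -> x \in `[al, be].
  by rewrite !in_itvE => /andP[a1 a2]; rewrite (le_trans as')//= (le_trans a2).
have cy' : {within `[s', d], continuous (fun x => `|y x|)}.
  have cys : {within `[s', d], continuous y} by apply: continuous_subspaceW cy => z /=; exact: subJ.
  by move=> x; apply: cvg_norm; exact: cys.
have [M MJ maxM] := EVT_max s'd cy'.
have [My bMy] := cont_bm cy.
have bmy : bm al be My (fun t => `|y t|).
  by case: bMy => m1 m2; split; [exact: measurableT_comp|move=> x xJ; rewrite normr_id m2].
have iky : ibl al be (fun t => k t * `|y t|).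
  by apply: (@ibl_eq _ _ _ (fun t => `|y t| * k t)); [move=> t _; rewrite mulrC|exact: bm_iblM bmy ik].
have half x : x \in `[s', d] -> `|y x| <= 1 / 2 * `|y M|.
  move=> xs; have xJ := subJ _ xs; apply: le_trans (Hy x xJ) _.
  move: (xs) (xJ); rewrite !in_itvE => /andP[x1 x2] /andP[x3 x4].
  rewrite (@prim_split _ _ _ s' x)//; last exact: iblS iky.
  have -> : prim al (fun t => k t * `|y t|) s' = 0.
    rewrite (@eq_prim _ _ _ (fun=> 0)); first by rewrite prim_cst// mul0r.
    by move=> t ts; rewrite (Ss' t ts) normr0 mulr0.
  rewrite add0r.
  have ikx : ibl s' x k by apply: iblS ik.
  apply: (@le_trans _ _ (prim s' (fun t => `|y M| * k t) x)).
    apply: le_prim; [exact: iblS iky|exact: iblZ|].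
    move=> t; rewrite in_itvE => /andP[t1 t2]; rewrite mulrC ler_wpM2r//.
      by apply: k0; rewrite in_itvE (le_trans as')//= (le_trans t2).
    by apply: maxM; rewrite in_itvE t1 (le_trans t2).
  rewrite primZ// mulrC ler_wpM2r//.
  have E : prim al k x = prim al k s' + prim s' k x by apply: prim_split => //; apply: iblS ik.
  have h1 : `|x - s| < r.
    by rewrite ltr_norml; apply/andP; split; lra.
  have h2 : `|s' - s| < r by rewrite ler0_norm ?subr_le0//; lra.
  have := Hr _ xJ h1; have := Hr _ s'J h2.
  by rewrite !ltr_norml => /andP[a1 a2] /andP[a3 a4]; lra.
have yM : `|y M| = 0.
  by apply/eqP; rewrite eq_le normr_ge0 andbT; have hM := half _ MJ; have := normr_ge0 (y M); set u := `|y M| in hM *; lra.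
have Sd : S d.
  split; first by rewrite in_itvE ad.
  move=> x; rewrite in_itvE => /andP[x1 x2].
  have [xs|xs] := leP x s'; first by apply: Ss'; rewrite in_itvE x1.
  have : `|y x| <= 0 by rewrite -yM; apply: maxM; rewrite in_itvE x2 ltW.
  by rewrite normr_le0 => /eqP.
have ds : d <= s by apply: sup_upper_bound.
have db : d = be.
  have [bs|sb'] := leP be (s + r / 2); first by rewrite /d min_l.
  have dE : d = s + r / 2 by apply: min_r; exact: ltW.
  by move: ds; rewrite dE gerDl leNgt r2.
by case: Sd => _; rewrite db.
Qed.

(** If [b] is the candidate for 1/A, then [y = A b - 1] satisfies y' = (g / A) y in integrated form
    and vanishes at [al], so that [gronwall0] applies. The lower bound [de] keeps g / A
    integrable. *)
Lemma prim_inv al be A c g (de : R) : al <= be -> 0 < de -> ibl al be g ->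
  {in `[al, be], forall x, A x = c + prim al g x} ->
  {in `[al, be], forall x, de <= A x} ->
  ibl al be (fun t => g t / A t ^+ 2) /\
  {in `[al, be], forall x, (A x)^-1 = c^-1 + prim al (fun t => - (g t / A t ^+ 2)) x}.
Proof.
move=> ab de0 ig HA HdA.
have A0 x : x \in `[al, be] -> A x != 0 by move=> /HdA xA; rewrite gt_eqF// (lt_le_trans de0).
have cP : {within `[al, be], continuous (prim al g)} by exact: prim_cont.
have mA : measurable_fun `[al, be] A.
  apply: (eq_measurable_fun (fun x => c + prim al g x)).
    by move=> x; rewrite inE => /HA ->.
  by apply: measurable_funD => //; apply: subspace_continuous_measurable_fun.
have mAV : measurable_fun `[al, be] (fun t => (A t)^-1).
  exact: measurable_invr.
have bAV : bm al be de^-1 (fun t => (A t)^-1).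
  split=> // x xJ; have dA := HdA _ xJ; have Ap : 0 < A x by exact: lt_le_trans dA.
  by rewrite gtr0_norm ?invr_gt0// lef_pV2.
have igA : ibl al be (fun t => g t / A t).
  by apply: (@ibl_eq _ _ _ (fun t => (A t)^-1 * g t)); [move=> t _; rewrite mulrC|exact: bm_iblM bAV ig].
have ik : ibl al be (fun t => g t / A t ^+ 2).
  apply: (@ibl_eq _ _ _ (fun t => (A t)^-1 * (g t / A t))); last exact: bm_iblM bAV igA.
  by move=> t _; rewrite expr2 invfM; ring.
split => //.
set k := (fun t => _) in ik *.
have cA : c = A al by rewrite HA ?prim_al ?addr0// in_itvE lexx.
have c0 : c != 0 by rewrite cA A0// in_itvE lexx.
pose b x := c^-1 - prim al k x.
pose y x := A x * b x - 1.
have yc x : x \in `[al, be] -> y x = c^-1 * prim al g x - c * prim al k x - prim al g x * prim al k x.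
  by move=> xJ; rewrite /y /b HA//; field.
have cy : {within `[al, be], continuous y}.
  have ck : {within `[al, be], continuous (prim al k)} by exact: prim_cont.
  apply: (@subspace_eq_continuous _ _ _ (fun x => c^-1 * prim al g x - c * prim al k x - prim al g x * prim al k x)).
    by move=> x; rewrite inE => xJ; apply/esym; exact: yc.
  apply: wcB; first by apply: wcB; apply: wcM => //; exact: wc_cst.
  exact: wcM.
suff y0 : {in `[al, be], forall x, y x = 0}.
  move=> x xJ; have /eqP := y0 x xJ; rewrite /y subr_eq0 => /eqP Ab.
  have -> : prim al (fun t => - k t) x = - prim al k x.
    by rewrite primN//; apply: iblS ik => //; move: xJ; rewrite in_itvE => /andP[].
  by rewrite -/(b x); apply: (mulfI (A0 _ xJ)); rewrite Ab divff// A0.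
have Iprim f h : ibl al be f -> ibl al be h -> ibl al be (fun t => f t * prim al h t).
  move=> hf hh; apply: (@ibl_eq _ _ _ (fun t => prim al h t * f t)); first by move=> t _; rewrite mulrC.
  exact: bm_iblM (prim_bmx ab hh) hf.
have Iprim' f h : ibl al be f -> ibl al be h -> ibl al be (fun t => prim al h t * f t).
  by move=> hf hh; exact: bm_iblM (prim_bmx ab hh) hf.
have yE x : x \in `[al, be] -> y x = prim al (fun t => g t / A t * y t) x.
  move=> xJ; rewrite yc//; move: (xJ); rewrite in_itvE => /andP[x1 x2].
  have S f : ibl al be f -> ibl al x f by apply: iblS.
  rewrite prim_mul ?S//.
  have -> : prim al (fun t => g t / A t * y t) x =
    prim al (fun t => c^-1 * g t - c * k t - (g t * prim al k t + prim al g t * k t)) x.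
    apply: eq_prim => t; rewrite in_itvE => /andP[t1 t2].
    have tJ : t \in `[al, be] by rewrite in_itvE t1 (le_trans t2).
    have -> : k t = g t / A t ^+ 2 by [].
    have <- : A t - c = prim al g t by rewrite HA// addrC addKr.
    by rewrite /y /b; field; rewrite c0 A0.
  rewrite primB ?primB ?primZ//; do ?by apply: S.
  - by apply: iblZ; exact: S.
  - by apply: iblZ; exact: S.
  - by apply: iblB; apply: iblZ; exact: S.
  - by apply: iblD; apply: S; [exact: Iprim|exact: Iprim'].
apply: (@gronwall0 _ _ (fun t => `|g t / A t|)) => //; first exact: ibl_norm.
move=> x xJ; rewrite {1}yE//.
move: (xJ); rewrite in_itvE => /andP[x1 x2].
have [M bM] := cont_bm cy.
apply: le_trans (ler_norm_prim _) _.
  apply: (@iblS _ al be) => //.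
  by apply: (@ibl_eq _ _ _ (fun t => y t * (g t / A t))); [move=> t _; rewrite mulrC|exact: bm_iblM bM igA].
by rewrite le_eqVlt; apply/orP; left; apply/eqP; apply: eq_prim => t _; rewrite normrM.
Qed.

End Gronwall.

(** * Density of the iterates of the Volterra operator in L^p *)

Section Volterra.
Context {R : realType}.
Local Notation mu := (@lebesgue_measure R).
Implicit Types (f g h u v w : R -> R) (x y z : R).

Lemma prim_pow al n x : al <= x ->
  prim al (fun t => (t - al) ^+ n) x = (x - al) ^+ n.+1 / n.+1%:R.
Proof.
move=> ax.
have cX k : continuous (fun t : R => (t - al) ^+ k).
  move=> t; apply: (@continuous_comp _ _ _ (fun t => t - al) (fun t => t ^+ k)); last exact: exprn_continuous.
  by apply: cvgB; [exact: cvg_id|exact: cvg_cst].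
have i1 y : ibl al y (fun=> 1 : R) by apply: cont_ibl; exact: cst_continuous.
have iX k y : ibl al y (fun t => (t - al) ^+ k) by apply: cont_ibl; exact: cX.
suff H k y : al <= y -> (y - al) ^+ k.+1 = prim al (fun t => k.+1%:R * (t - al) ^+ k) y.
  by rewrite H// primZ// mulrC mulKf// pnatr_eq0.
elim: k y => [|k IH] y ay.
  rewrite expr1 (@eq_prim _ _ _ (fun=> 1)) ?prim_cst ?mul1r// => t _.
  by rewrite expr0 mulr1.
have p1 t : al <= t -> prim al (fun=> 1) t = t - al by move=> at_; rewrite prim_cst// mul1r.
rewrite exprSr IH// -[X in _ * X = _]p1// prim_mul//; last by apply: iblZ.
apply: eq_prim => t; rewrite in_itvE => /andP[t1 t2].
rewrite -IH// p1// mulr1 -mulrA -exprSr -{2}[_ ^+ _]mul1r -mulrDl; congr (_ * _).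
by rewrite -[X in _ + X]/(1%:R) -natrD addn1.
Qed.

Lemma prim_cvg al be C (f_ : nat -> R -> R) f :
  (forall n, bm al be C (f_ n)) ->
  {in `[al, be], forall x, f_ n x @[n --> \oo] --> f x} ->
  bm al be C f /\ {in `[al, be], forall x, prim al (f_ n) x @[n --> \oo] --> prim al f x}.
Proof.
move=> bf cf.
have bf0 : bm al be C f.
  split.
    apply: (@measurable_fun_cvg _ _ _ _ f_); first by move=> n; exact: (bf n).1.
    by move=> x /= xJ; exact: cf.
  move=> x xJ; have /cvg_norm/cvgr_to_le := cf x xJ; apply.
  by apply: nearW => n; exact: (bf n).2.
split => // x xJ.
have [ax xb] : al <= x /\ x <= be by move: xJ; rewrite in_itvE => /andP.
have sub t : t \in `[al, x] -> t \in `[al, be].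
  by rewrite !in_itvE => /andP[-> tx]/=; exact: le_trans xb.
have ifn n : ibl al x (f_ n) by apply: (@iblS _ al be) => //; exact: bm_ibl (bf n).
have if0 : ibl al x f by apply: (@iblS _ al be) => //; exact: bm_ibl bf0.
have [] := @dominated_convergence _ _ R mu `[al, x] (measurable_itv _) (fun n => EFin \o f_ n) (EFin \o f) (cst C%:E).
- by move=> n; apply/measurable_EFinP; exact: ibl_meas.
- by apply/measurable_EFinP; exact: ibl_meas.
- apply: aeW => t /= tJ; apply: cvg_EFin; first by apply: nearW.
  by apply: cf; exact: sub.
- apply: (bm_ibl (@bm_cst _ _ _ C)).
- by apply: aeW => t /= n tJ; rewrite lee_fin (bf n).2//; exact: sub.
- move=> _ _; have -> : (\int[mu]_(t in `[al, x]) (EFin \o f) t = (prim al f x)%:E)%E.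
    by rewrite /prim /Rintegral fineK//; apply: integrable_fin_num.
  exact: fine_cvg.
Qed.

Section Weights.
Variables (al be de M : R) (w1 w2 : R -> R).
Hypotheses (ab : al < be) (de0 : 0 < de).
Hypotheses (bw1 : bm al be M w1) (bw2 : bm al be M w2).
Hypotheses (w1de : {in `[al, be], forall x, de <= w1 x}) (w2de : {in `[al, be], forall x, de <= w2 x}).

Let J x := x \in `[al, be].
Let abW : al <= be := ltW ab.

Definition wprim (w f : R -> R) x := prim al (fun t => w t * f t) x.

Definition volterra f x := wprim w1 (wprim w2 f) x.
Local Notation T := volterra.

Let M0 : 0 <= M.
Proof. by have := bw1.2 al; rewrite in_itvE lexx abW => /(_ isT); exact: le_trans. Qed.

Lemma wprim_eq w f g : {in `[al, be], f =1 g} -> {in `[al, be], wprim w f =1 wprim w g}.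
Proof.
move=> fg x; rewrite in_itvE => /andP[ax xb]; apply: eq_prim => t.
by rewrite in_itvE => /andP[t1 t2]; rewrite fg// in_itvE t1 (le_trans t2).
Qed.

Lemma wprim_bm w f F : bm al be M w -> bm al be F f -> bm al be (M * F * (be - al)) (wprim w f).
Proof. by move=> bw bf; apply: prim_bm => //; exact: bmM. Qed.

Lemma wprim_cont w f F : bm al be M w -> bm al be F f -> {within `[al, be], continuous (wprim w f)}.
Proof. by move=> bw bf; apply: prim_cont => //; apply: bm_ibl (bmM bw bf). Qed.

Lemma wprimB w f g F G x : bm al be M w -> bm al be F f -> bm al be G g -> x \in `[al, be] ->
  wprim w (fun t => f t - g t) x = wprim w f x - wprim w g x.
Proof.
move=> bw bf bg; rewrite in_itvE => /andP[ax xb]; rewrite /wprim -primB; last 2 first.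
- by apply: (@iblS _ al be) => //; exact: bm_ibl (bmM bw bf).
- by apply: (@iblS _ al be) => //; exact: bm_ibl (bmM bw bg).
by apply: eq_prim => t _; rewrite mulrBr.
Qed.

Lemma wprimD w f g F G x : bm al be M w -> bm al be F f -> bm al be G g -> x \in `[al, be] ->
  wprim w (fun t => f t + g t) x = wprim w f x + wprim w g x.
Proof.
move=> bw bf bg; rewrite in_itvE => /andP[ax xb]; rewrite /wprim -primD; last 2 first.
- by apply: (@iblS _ al be) => //; exact: bm_ibl (bmM bw bf).
- by apply: (@iblS _ al be) => //; exact: bm_ibl (bmM bw bg).
by apply: eq_prim => t _; rewrite mulrDr.
Qed.

Lemma wprimZ w f F c x : bm al be M w -> bm al be F f -> x \in `[al, be] ->
  wprim w (fun t => c * f t) x = c * wprim w f x.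
Proof.
move=> bw bf; rewrite in_itvE => /andP[ax xb]; rewrite /wprim -primZ; last first.
  by apply: (@iblS _ al be) => //; exact: bm_ibl (bmM bw bf).
by apply: eq_prim => t _; rewrite mulrCA.
Qed.

Lemma wprim_pow w f C n : bm al be M w -> measurable_fun `[al, be] f ->
  0 <= C -> {in `[al, be], forall x, `|f x| <= C * (x - al) ^+ n} ->
  {in `[al, be], forall x, `|wprim w f x| <= M * C / n.+1%:R * (x - al) ^+ n.+1}.
Proof.
move=> bw mf C0 Hf x xJ; move: (xJ); rewrite in_itvE => /andP[ax xb].
have bf : bm al be (C * (be - al) ^+ n) f.
  split => // t tJ; apply: le_trans (Hf _ tJ) _; rewrite ler_wpM2l// lerXn2r ?nnegrE ?subr_ge0//.
  by move: tJ; rewrite in_itvE => /andP[].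
  by rewrite lerD2r; move: tJ; rewrite in_itvE => /andP[].
have iwf : ibl al x (fun t => w t * f t).
  by apply: (@iblS _ al be) => //; exact: bm_ibl (bmM bw bf).
have iX : ibl al x (fun t => (t - al) ^+ n).
  apply: cont_ibl => t; apply: (@continuous_comp _ _ _ (fun t => t - al) (fun t => t ^+ n)); last exact: exprn_continuous.
  by apply: cvgB; [exact: cvg_id|exact: cvg_cst].
apply: le_trans (ler_norm_prim iwf) _.
apply: (@le_trans _ _ (prim al (fun t => M * C * (t - al) ^+ n) x)).
  apply: le_prim; [exact: ibl_norm|exact: iblZ|].
  move=> t; rewrite in_itvE => /andP[t1 t2]; have tJ : t \in `[al, be] by rewrite in_itvE t1 (le_trans t2).
  by rewrite normrM -mulrA ler_pM// ?bw.2// Hf.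
by rewrite primZ// prim_pow// mulrA mulrAC.
Qed.

Lemma volterra_bm f F : bm al be F f -> exists F', bm al be F' (T f).
Proof. by move=> bf; exists (M * (M * F * (be - al)) * (be - al)); do 2 apply: wprim_bm => //. Qed.

Lemma volterra_eq f g : {in `[al, be], f =1 g} -> {in `[al, be], T f =1 T g}.
Proof. by move=> fg; apply: wprim_eq; exact: wprim_eq. Qed.

Lemma volterraB f g F G x : bm al be F f -> bm al be G g -> J x ->
  T (fun t => f t - g t) x = T f x - T g x.
Proof.
move=> bf bg xJ; rewrite /volterra.
rewrite (@wprim_eq w1 (wprim w2 (fun t => f t - g t)) (fun t => wprim w2 f t - wprim w2 g t))//.
  by apply: wprimB => //; apply: wprim_bm; eassumption.
by move=> t tJ; apply: wprimB; eassumption.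
Qed.

Lemma volterraZ f F c x : bm al be F f -> J x -> T (fun t => c * f t) x = c * T f x.
Proof.
move=> bf xJ; rewrite /volterra.
rewrite (@wprim_eq w1 (wprim w2 (fun t => c * f t)) (fun t => c * wprim w2 f t))//.
  by apply: wprimZ => //; apply: wprim_bm; eassumption.
by move=> t tJ; apply: wprimZ; eassumption.
Qed.

(** [T] integrates twice, and by [wprim_pow] each integration gains one power of x - al together
    with the matching factor of the factorial. *)
Lemma iter_volterra_bound f F k : bm al be F f ->
  measurable_fun `[al, be] (iter k T f) /\
  {in `[al, be], forall x, `|iter k T f x| <= F * M ^+ (k.*2) / (k.*2)`!%:R * (x - al) ^+ (k.*2)}.
Proof.
move=> bf.
have F0 : 0 <= F by apply: le_trans (bf.2 al _); rewrite ?in_itvE ?lexx.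
elim: k => [|k [IHm IH]].
  by split; [exact: bf.1|move=> x xJ; rewrite fact0 !expr0 mulr1 divr1 mulr1 bf.2].
have [G bG] : exists G, bm al be G (iter k T f).
  exists (F * M ^+ (k.*2) / (k.*2)`!%:R * (be - al) ^+ (k.*2)); split => // x xJ.
  apply: le_trans (IH x xJ) _; rewrite ler_wpM2l//.
    by rewrite !mulr_ge0 ?exprn_ge0 ?invr_ge0.
  move: xJ; rewrite in_itvE => /andP[ax xb].
  by rewrite lerXn2r ?nnegrE ?subr_ge0// lerD2r.
have C0 : 0 <= F * M ^+ (k.*2) / (k.*2)`!%:R by rewrite !mulr_ge0 ?exprn_ge0 ?invr_ge0.
have b1 := wprim_bm bw2 bG.
have p1 := wprim_pow bw2 IHm C0 IH.
have C1 : 0 <= M * (F * M ^+ (k.*2) / (k.*2)`!%:R) / (k.*2).+1%:R by rewrite !mulr_ge0 ?exprn_ge0 ?invr_ge0.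
have p2 := wprim_pow bw1 b1.1 C1 p1.
split; first by have [? []] := volterra_bm bG.
move=> x xJ; rewrite iterS; apply: le_trans (p2 x xJ) _.
rewrite doubleS le_eqVlt; apply/orP; left; apply/eqP; congr (_ * _).
have n0 : (k.*2)`!%:R != 0 :> R by rewrite pnatr_eq0 -lt0n fact_gt0.
have n1 : (k.*2).+1%:R != 0 :> R by rewrite pnatr_eq0.
have n2 : (k.*2).+2%:R != 0 :> R by rewrite pnatr_eq0.
rewrite !factS !natrM !exprS.
move: (_ `!%:R) n0 (_.+1%:R) n1 (_.+2%:R) n2 => p p0 q q0 r r0.
by field; rewrite p0 q0 r0.
Qed.

(** Each of the factors k + 1, ..., 2k is at least k. This lets the factorial coming from the
    iterates of [T] absorb the N^N produced by a resolvent parameter proportional to N. *)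
Lemma fact_double k : (k`! * k ^ k <= (k.*2)`!)%N.
Proof.
rewrite -addnn; suff H j : (k`! * k ^ j <= (k + j)`!)%N by exact: H.
elim: j => [|j IH]; first by rewrite addn0 muln1.
rewrite expnSr mulnA addnS factS mulnC leq_mul// ltnW// ltnS.
exact: leq_addr.
Qed.

Let B := M * (be - al).

Lemma iter_volterra_le f F k x : bm al be F f -> J x ->
  `|iter k T f x| <= F * ((B ^+ 2) ^+ k / (k.*2)`!%:R).
Proof.
move=> bf xJ; apply: le_trans ((iter_volterra_bound k bf).2 x xJ) _.
have F0 : 0 <= F by apply: le_trans (bf.2 x xJ).
move: (xJ); rewrite /J in_itvE => /andP[ax xb].
rewrite -exprM mul2n /B exprMn -!mulrA ler_wpM2l// ler_wpM2l ?exprn_ge0//.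
rewrite mulrC ler_wpM2r ?invr_ge0//.
by rewrite lerXn2r ?nnegrE ?subr_ge0// lerD2r.
Qed.

End Weights.
End Volterra.

(** * Resolvent of the Neumann problem *)

Section Resolvent.
Context {R : realType}.
Implicit Types (f g h u v w : R -> R) (x y z : R).
Variables (al be de M : R) (w1 w2 : R -> R).
Hypotheses (ab : al < be) (de0 : 0 < de).
Hypotheses (bw1 : bm al be M w1) (bw2 : bm al be M w2).
Hypotheses (w1de : {in `[al, be], forall x, de <= w1 x}) (w2de : {in `[al, be], forall x, de <= w2 x}).

Let abW : al <= be := ltW ab.
Let M0 : 0 <= M.
Proof. by have := bw1.2 al; rewrite in_itvE lexx abW => /(_ isT); exact: le_trans. Qed.
Local Notation T := (volterra al w1 w2).
Let B := M * (be - al).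
Let B0 : 0 <= B.
Proof. by rewrite mulr_ge0// subr_ge0. Qed.

Lemma volterra_ge0 f : {in `[al, be], forall x, 0 <= f x} ->
  {in `[al, be], forall x, 0 <= T f x}.
Proof.
move=> f0.
have H w g : {in `[al, be], forall x, de <= w x} -> {in `[al, be], forall x, 0 <= g x} ->
    {in `[al, be], forall x, 0 <= wprim al w g x}.
  move=> wd g0 x; rewrite in_itvE => /andP[ax xb]; apply: prim_ge0 => t.
  rewrite in_itvE => /andP[t1 t2]; have tJ : t \in `[al, be] by rewrite in_itvE t1 (le_trans t2).
  by rewrite mulr_ge0 ?g0// (le_trans (ltW de0))// wd.
exact: (H _ _ w1de (H _ _ w2de f0)).
Qed.

(** Picard iteration. Consecutive iterates differ by [ka ^+ n * iter n T h], which the exponential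
    series at [ka * B ^+ 2] dominates, so there is convergence for every [ka]. Positivity passes
    from the iterates to the limit because [T] preserves it. *)
Lemma volterra_solve (ka : R) h H : 0 <= ka -> bm al be H h ->
  exists u C, [/\ bm al be C u, {in `[al, be], forall x, u x = h x + ka * T u x} &
    {in `[al, be], forall x, 0 <= h x} -> {in `[al, be], forall x, 0 <= u x}].
Proof.
move=> ka0 bh.
pose S := fix S n : R -> R := if n is n'.+1 then (fun x => h x + ka * T (S n') x) else cst 0.
have bS n : exists C, bm al be C (S n).
  elim: n => [|n [C bC]] /=; first by exists `|0 : R|; exact: bm_cst.
  have [C' bC'] := volterra_bm ab bw1 bw2 bC.
  by exists (H + `|ka| * C'); apply: bmD => //; exact: bmZ.
have DS n x : x \in `[al, be] -> S n.+1 x - S n x = ka ^+ n * iter n T h x.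
  elim: n x => [|n IH] x xJ.
    rewrite /= expr0 mul1r subr0 (_ : T _ x = 0) ?mulr0 ?addr0//.
    have := @volterraZ _ _ _ _ _ _ ab bw1 bw2 h H 0 x bh xJ; rewrite mul0r; apply: etrans.
    by apply: (volterra_eq w1 w2 _ xJ) => t _; rewrite mul0r.
  have [C bC] := bS n; have [C' bC'] := bS n.+1.
  have -> : S n.+2 x - S n.+1 x = ka * (T (S n.+1) x - T (S n) x).
    by rewrite mulrBr /= opprD addrACA subrr add0r.
  rewrite -(volterraB ab bw1 bw2 bC' bC xJ).
  have [D bD] : exists D, bm al be D (iter n T h).
    elim: n {IH C bC C' bC'} => [|n [D bD]]; first by exists H.
    exact: (volterra_bm ab bw1 bw2 bD).
  rewrite (volterra_eq w1 w2 (g := fun t => ka ^+ n * iter n T h t) IH xJ).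
  by rewrite (volterraZ ab bw1 bw2 _ bD xJ) exprS mulrA.
have H0 : 0 <= H by apply: le_trans (bh.2 al _); rewrite ?in_itvE ?lexx.
pose q := ka * B ^+ 2.
have q0 : 0 <= q by rewrite mulr_ge0// sqr_ge0.
have leD n x : x \in `[al, be] -> `|S n.+1 x - S n x| <= H * exp_coeff q n.
  move=> xJ; rewrite DS// normrM normrX (ger0_norm ka0).
  apply: le_trans (ler_wpM2l (exprn_ge0 _ ka0) (iter_volterra_le ab bw1 bw2 n bh xJ)) _.
  have -> : ka ^+ n * (H * ((B ^+ 2) ^+ n / (n.*2)`!%:R)) = H * (q ^+ n / (n.*2)`!%:R).
    by rewrite /q [in RHS]exprMn; ring.
  (* The denominator (2n)! is weakened to n! in order to compare with the exponential series at
     [q]. *)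
  rewrite ler_wpM2l// /exp_coeff/= ler_wpM2l ?exprn_ge0//.
  rewrite lef_pV2 ?posrE ?ltr0n ?fact_gt0// ler_nat.
  by apply: leq_fact; rewrite -addnn leq_addr.
have SE n x : S n x = series (fun k => S k.+1 x - S k x) n.
  by rewrite /series/= telescope_sumr// subr0.
pose E := limn (series (exp_coeff q)).
have leE n : series (exp_coeff q) n <= E.
  apply: nondecreasing_cvgn_le; last exact: is_cvg_series_exp_coeff.
  by apply: nondecreasing_series => k _ _; exact: exp_coeff_ge0.
have bSE n : bm al be (H * E) (S n).
  split; first by have [C []] := bS n.
  move=> x xJ; rewrite SE; apply: le_trans (ler_norm_sum _ _ _) _.
  apply: le_trans (ler_sum _ (fun i _ => leD i x xJ)) _.
  by rewrite -mulr_sumr ler_wpM2l//; exact: leE.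
pose u x := limn (fun n => S n x).
have cS x : x \in `[al, be] -> S n x @[n --> \oo] --> u x.
  move=> xJ; suff : cvgn (fun n => S n x) by [].
  rewrite (_ : (fun n => _) = series (fun k => S k.+1 x - S k x)); last by apply/funext => n.
  apply: normed_cvg; apply: (@series_le_cvg _ _ (fun n => H * exp_coeff q n)) => //.
  - by move=> n; exact: normr_ge0.
  - by move=> n; rewrite mulr_ge0 ?exp_coeff_ge0.
  - by move=> n; exact: leD.
  - by apply: is_cvg_seriesZ; exact: is_cvg_series_exp_coeff.
have [bu _] := prim_cvg bSE cS.
have c2 x : x \in `[al, be] -> wprim al w2 (S n) x @[n --> \oo] --> wprim al w2 u x.
  have [_ ] := @prim_cvg _ al be (M * (H * E)) (fun n t => w2 t * S n t) (fun t => w2 t * u t)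
    (fun n => bmM bw2 (bSE n)) (fun t tJ => cvgM (cvg_cst _) (cS t tJ)).
  exact.
have c1 x : x \in `[al, be] -> T (S n) x @[n --> \oo] --> T u x.
  have [_ ] := @prim_cvg _ al be _ (fun n t => w1 t * wprim al w2 (S n) t) (fun t => w1 t * wprim al w2 u t)
    (fun n => bmM bw1 (wprim_bm ab bw2 (bSE n))) (fun t tJ => cvgM (cvg_cst _) (c2 t tJ)).
  exact.
exists u, (H * E); split => //.
  move=> x xJ.
  have l1 : S n.+1 x @[n --> \oo] --> u x.
    by have := cS x xJ; rewrite -(cvg_shiftS (fun n => S n x)).
  have l2 : S n.+1 x @[n --> \oo] --> h x + ka * T u x.
    by apply: cvgD; [exact: cvg_cst|apply: cvgM; [exact: cvg_cst|exact: c1]].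
  exact: (cvg_unique _ l1 l2).
move=> h0 x xJ.
have S0 n : {in `[al, be], forall x, 0 <= S n x}.
  elim: n => [|n IH] t tJ //=; rewrite addr_ge0 ?h0// mulr_ge0//.
  exact: volterra_ge0.
have /cvgr_to_ge := cS x xJ; apply; apply: nearW => n; exact: S0.
Qed.

(* [u] lies in the domain of the Neumann realization of [L = w2^-1 d/dx w1^-1 d/dx],
   and [h = L u] *)
Definition ndom u h :=
  [/\ exists c, {in `[al, be], forall x, u x = c + T h x}, wprim al w2 h be = 0 &
      exists H, bm al be H h].

Lemma ndom_eq u u' h h' : {in `[al, be], u =1 u'} -> {in `[al, be], h =1 h'} ->
  ndom u h -> ndom u' h'.
Proof.
move=> uu hh [[c Hc] h0 [H bH]]; split.
- by exists c => x xJ; rewrite -(uu x xJ) (Hc x xJ) (volterra_eq w1 w2 hh xJ).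
- by rewrite -h0; apply/esym/(wprim_eq w2 hh); rewrite in_itvE lexx abW.
- by exists H; exact: bm_eq bH.
Qed.

Lemma ndomB u u' h h' : ndom u h -> ndom u' h' ->
  ndom (fun x => u x - u' x) (fun x => h x - h' x).
Proof.
move=> [[c Hc] h0 [H bH]] [[c' Hc'] h0' [H' bH']]; split.
- exists (c - c') => x xJ; rewrite (Hc x xJ) (Hc' x xJ) (volterraB ab bw1 bw2 bH bH' xJ).
  by rewrite opprD addrACA.
- by rewrite (wprimB bw2 bH bH') ?h0 ?h0' ?subr0// in_itvE lexx abW.
- by exists (H + H'); exact: bmB.
Qed.

Lemma ndomZ u h k : ndom u h -> ndom (fun x => k * u x) (fun x => k * h x).
Proof.
move=> [[c Hc] h0 [H bH]]; split.
- by exists (k * c) => x xJ; rewrite Hc// (volterraZ ab bw1 bw2 _ bH xJ) mulrDr.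
- by rewrite (wprimZ _ bw2 bH) ?h0 ?mulr0// in_itvE lexx abW.
- by exists (`|k| * H); exact: bmZ.
Qed.

Lemma ndom_bm u h : ndom u h -> exists G, bm al be G u.
Proof.
move=> [[c Hc] h0 [H bH]]; have [H' bH'] := volterra_bm ab bw1 bw2 bH.
exists (`|c| + H'); apply: (bm_eq (f := fun x => c + T h x)); first by move=> x /Hc.
by apply: bmD bH'; exact: bm_cst.
Qed.

(** Shooting: [u = c v + w], where [v] solves the homogeneous equation with value 1 at [al] and [w]
    the inhomogeneous one with value 0 there. The constant [c] is adjusted to the Neumann condition
    at [be], which is possible because [v >= 1] makes [wprim al w2 v be] positive. *)
Lemma resolvent_exists (ka : R) f : 0 < ka -> (exists F, bm al be F f) ->
  exists u, ndom u (fun x => ka * (u x - f x)).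
Proof.
move=> ka0 [F bF].
have [v [V [bv Hv v0]]] := volterra_solve (ltW ka0) (bm_cst al be 1).
have [F' bF'] := volterra_bm ab bw1 bw2 bF.
have [w [W [bw Hw _]]] := volterra_solve (ltW ka0) (bmZ (- ka) bF').
have beJ : be \in `[al, be] by rewrite in_itvE lexx abW.
have v1 : {in `[al, be], forall x, 1 <= v x}.
  move=> x xJ; rewrite Hv// lerDl mulr_ge0 ?(ltW ka0)//.
  by apply: volterra_ge0 => //; exact: v0.
have qv : 0 < wprim al w2 v be.
  apply: (@lt_le_trans _ _ (prim al (fun=> de) be)).
    by rewrite prim_cst// mulr_gt0// subr_gt0.
  apply: le_prim; [exact: bm_ibl (bm_cst _ _ _)|exact: bm_ibl (bmM bw2 bv)|].
  by move=> t tJ; rewrite -[leLHS]mulr1 ler_pM ?ler01 ?(ltW de0) ?w2de ?v1.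
have bwf := bmB bw bF.
pose c := - wprim al w2 (fun t => w t - f t) be / wprim al w2 v be.
pose u x := c * v x + w x.
have bu := bmD (bmZ c bv) bw.
exists u; split.
- exists c => x xJ; rewrite /u.
  rewrite (volterraZ ab bw1 bw2 _ (bmB bu bF))//.
  rewrite (volterra_eq w1 w2 (g := fun t => c * v t - (f t - w t)) _ xJ); last by move=> t _; ring.
  rewrite (volterraB ab bw1 bw2 (bmZ c bv) (bmB bF bw))// (volterraZ ab bw1 bw2 _ bv)//.
  rewrite (volterraB ab bw1 bw2 bF bw xJ) {1}(Hv x xJ) {1}(Hw x xJ).
  by move: (T v x) (T f x) (T w x) => p q r; ring.
- rewrite (wprimZ _ bw2 (bmB bu bF))//.
  rewrite (wprim_eq w2 (g := fun t => c * v t + (w t - f t)) _ beJ); last by move=> t _; rewrite /u; ring.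
  rewrite (wprimD bw2 (bmZ c bv) bwf)// (wprimZ _ bw2 bv)// /c divfK ?gt_eqF//.
  by rewrite addNr mulr0.
- by exists (`|ka| * (`|c| * V + W + F)); apply: bmZ; exact: bmB.
Qed.

End Resolvent.

(** * Maximum principle *)

Section MaxPrinciple.
Context {R : realType}.
Implicit Types (f g h u v w : R -> R) (x y z : R).
Variables (al be de M : R) (w1 w2 : R -> R).
Hypotheses (ab : al < be) (de0 : 0 < de).
Hypotheses (bw1 : bm al be M w1) (bw2 : bm al be M w2).
Hypotheses (w1de : {in `[al, be], forall x, de <= w1 x}) (w2de : {in `[al, be], forall x, de <= w2 x}).

Let abW : al <= be := ltW ab.
Local Notation T := (volterra al w1 w2).

Lemma wprim_split w f F x y : bm al be M w -> bm al be F f ->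
  al <= x -> x <= y -> y <= be ->
  wprim al w f y = wprim al w f x + wprim x w f y.
Proof.
move=> bw bf ax xy yb; apply: prim_split => //.
by apply: (@iblS _ al be) => //; exact: bm_ibl (bmM bw bf).
Qed.

(** Used with [k = 0] for [w2] and then with [k = 1] for [w1], it turns a positive lower bound on
    the source term into strict growth of the solution. *)
Lemma wprim_ge w f F x y (et : R) k : bm al be M w -> {in `[al, be], forall x, de <= w x} ->
  bm al be F f -> 0 <= et -> al <= x -> x <= y -> y <= be ->
  {in `[x, y], forall t, et * (t - x) ^+ k <= f t} ->
  de * et * ((y - x) ^+ k.+1 / k.+1%:R) <= wprim x w f y.
Proof.
move=> bw wde bf et0 ax xy yb Hf.
have iX : ibl x y (fun t => (t - x) ^+ k).
  apply: cont_ibl => t; apply: (@continuous_comp _ _ _ (fun t => t - x) (fun t => t ^+ k)); last exact: exprn_continuous.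
  by apply: cvgB; [exact: cvg_id|exact: cvg_cst].
rewrite -prim_pow// -primZ//; apply: le_prim; first exact: iblZ.
  by apply: (@iblS _ al be) => //; exact: bm_ibl (bmM bw bf).
move=> t txy; move: (txy); rewrite in_itvE => /andP[t1 t2].
rewrite -mulrA ler_pM ?(ltW de0)//.
- by rewrite mulr_ge0 ?exprn_ge0 ?subr_ge0.
- by apply: wde; rewrite in_itvE (le_trans ax)//= (le_trans t2).
- exact: Hf.
Qed.

Lemma max_principle (ka c F G : R) u f : 0 < ka -> bm al be G f ->
  {within `[al, be], continuous u} ->
  {in `[al, be], forall x, u x = c + ka * T (fun t => u t - f t) x} ->
  wprim al w2 (fun t => u t - f t) be = 0 ->
  {in `[al, be], forall x, f x <= F} -> {in `[al, be], forall x, u x <= F}.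
Proof.
move=> ka0 bf cu Hu q0 fF.
have [y yJ maxu] := EVT_max abW cu.
suff yF : u y <= F by move=> x xJ; exact: le_trans (maxu x xJ) yF.
rewrite leNgt; apply/negP => Fy.
have [U bu] := cont_bm cu.
have buf := bmB bu bf.
pose v := wprim al w2 (fun t => u t - f t).
have bv : bm al be _ v := wprim_bm ab bw2 buf.
(* Half of the excess: by continuity [u] stays above [F + et] near [y], hence above [f + et]. *)
pose et := (u y - F) / 2.
have et0 : 0 < et by rewrite divr_gt0// subr_gt0.
have /subspace_continuousP/(_ y yJ)/cvgrPdist_lt/(_ et et0) := cu.
rewrite near_withinE => -[r /= r0 Hr].
have near_y x : x \in `[al, be] -> `|y - x| < r -> et <= u x - f x.
  move=> xJ xr; have fx := fF x xJ.
  have : `|u y - u x| < et := Hr x xr xJ.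
  by rewrite ltr_norml => /andP[h2 h3]; rewrite /et in h2 h3 *; lra.
have r2 : 0 < r / 2 by rewrite divr_gt0.
move: (yJ); rewrite in_itvE => /andP[ay yb].
have al_v : v al = 0 by rewrite /v /wprim prim_al.
have right : y < be -> v y < 0.
  move=> yb'; rewrite ltNge; apply/negP => vy.
  pose z := Num.min be (y + r / 2).
  have yz : y < z by rewrite lt_min yb'/= ltrDl.
  have zb : z <= be by rewrite ge_min lexx.
  have zr : z <= y + r / 2 by rewrite ge_min lexx orbT.
  have sub t : t \in `[y, z] -> t \in `[al, be].
    by rewrite !in_itvE => /andP[t1 t2]; rewrite (le_trans ay)//= (le_trans t2).
  have big t : t \in `[y, z] -> et <= u t - f t.
    move=> tz; apply: near_y; first exact: sub.
    move: tz; rewrite in_itvE => /andP[t1 t2].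
    by rewrite ler0_norm ?subr_le0//; lra.
  have vt t : t \in `[y, z] -> de * et * (t - y) ^+ 1 <= v t.
    move=> tz; move: (tz); rewrite in_itvE => /andP[t1 t2].
    rewrite /v (wprim_split bw2 buf ay t1) ?(le_trans t2)// -/v.
    have := @wprim_ge w2 (fun t => u t - f t) _ y t et 0 bw2 w2de buf (ltW et0) ay t1 (le_trans t2 zb).
    rewrite divr1 expr1 => Hw; apply: le_trans (Hw _) _; last by rewrite lerDr.
    by move=> s; rewrite in_itvE expr0 mulr1 => /andP[s1 s2]; apply: big; rewrite in_itvE s1 (le_trans s2).
  have := @wprim_ge w1 v _ y z (de * et) 1 bw1 w1de bv _ ay (ltW yz) zb vt.
  rewrite mulr_ge0 ?(ltW de0) ?(ltW et0)// => /(_ isT) Hw.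
  have zJ : z \in `[al, be] by apply: sub; rewrite in_itvE lexx ltW.
  have := maxu z zJ; rewrite (Hu z zJ) (Hu y yJ) lerD2l ler_pM2l//.
  rewrite /volterra -/v (wprim_split bw1 bv ay (ltW yz) zb) gerDl leNgt.
  by rewrite (lt_le_trans _ Hw)// !mulr_gt0// ?invr_gt0// ?exprn_gt0// subr_gt0.
have left : al < y -> 0 < v y.
  move=> ay'; rewrite ltNge; apply/negP => vy.
  pose z := Num.max al (y - r / 2).
  have yz : z < y by rewrite gt_max ay'/= ltrBlDr ltrDl.
  have zb : al <= z by rewrite le_max lexx.
  have zr : y - r / 2 <= z by rewrite le_max lexx orbT.
  have sub t : t \in `[z, y] -> t \in `[al, be].
    by rewrite !in_itvE => /andP[t1 t2]; rewrite (le_trans zb)//= (le_trans t2).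
  have big t : t \in `[z, y] -> et <= u t - f t.
    move=> tz; apply: near_y; first exact: sub.
    move: tz; rewrite in_itvE => /andP[t1 t2].
    by rewrite ger0_norm ?subr_ge0//; lra.
  have vt t : t \in `[z, y] -> de * et * (y - t) <= - v t.
    move=> tz; move: (tz); rewrite in_itvE => /andP[t1 t2].
    move: vy; rewrite /v (wprim_split bw2 buf (le_trans zb t1) t2 yb) -/v => vy.
    have := @wprim_ge w2 (fun t => u t - f t) _ t y et 0 bw2 w2de buf (ltW et0) (le_trans zb t1) t2 yb.
    rewrite divr1 expr1 => Hw; apply: le_trans (Hw _) _; last first.
      by rewrite -subr_ge0 -opprD oppr_ge0.
    by move=> s; rewrite in_itvE expr0 mulr1 => /andP[s1 s2]; apply: big; rewrite in_itvE s2 andbT (le_trans t1).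
  have zJ : z \in `[al, be] by apply: sub; rewrite in_itvE lexx ltW.
  have := maxu z zJ; rewrite (Hu z zJ) (Hu y yJ) lerD2l ler_pM2l//.
  rewrite /volterra -/v (wprim_split bw1 bv zb (ltW yz) yb) lerDl leNgt.
  have bw1v := bmM bw1 bv; have iw1v : ibl z y (fun t => w1 t * v t).
    by apply: (@iblS _ al be) => //; exact: bm_ibl bw1v.
  rewrite -oppr_gt0 -[X in 0 < X]primN//.
  have iL : ibl z y (fun t : R => y - t).
    by apply: cont_ibl => t; apply: cvgB; [exact: cvg_cst|exact: cvg_id].
  suff : 0 < prim z (fun t => de * (de * et) * (y - t)) y.
    move=> /lt_le_trans ->//; apply: le_prim; [exact: iblZ|exact: iblN|].
    move=> t tz; have /andP[_ ty] : z <= t <= y by rewrite -in_itvE.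
    have g0 : 0 <= de * et * (y - t) by apply: mulr_ge0; [apply: mulr_ge0; exact: ltW|rewrite subr_ge0].
    by rewrite -mulrN -mulrA; apply: ler_pM => //; [exact: ltW|apply: w1de; exact: sub|exact: vt].
  rewrite primZ//; apply: mulr_gt0; first exact: (mulr_gt0 de0 (mulr_gt0 de0 et0)).
  have -> : prim z (fun t => y - t) y = prim z (fun t => (y - z) - (t - z) ^+ 1) y.
    by apply: eq_prim => t _; rewrite expr1; ring.
  have yz0 : 0 < y - z by rewrite subr_gt0.
  rewrite primB; last 2 first.
  - by apply: cont_ibl; exact: cst_continuous.
  - apply: cont_ibl => t; apply: (@continuous_comp _ _ _ (fun t => t - z) (fun t => t ^+ 1)); last exact: exprn_continuous.
    by apply: cvgB; [exact: cvg_id|exact: cvg_cst].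
  rewrite prim_cst ?(ltW yz)// prim_pow ?(ltW yz)// -expr2.
  have : 0 < (y - z) ^+ 2 by rewrite exprn_gt0.
  by lra.
have [yal|ay'] := eqVneq y al.
  by have := right; rewrite yal al_v ltxx => /(_ ab).
have [ybe|yb'] := eqVneq y be.
  by have := left; rewrite ybe /v q0 ltxx => /(_ ab).
have := right; have := left; rewrite !lt_neqAle ay yb yb' eq_sym ay' !andbT.
by move=> /(_ isT)/andP[_ h1] /(_ isT)/andP[/negP h2 h3]; apply: h2; rewrite eq_le h1 h3.
Qed.

End MaxPrinciple.

(** * Uniform approximation on the domain of L *)

Section Approximation.
Context {R : realType}.
Implicit Types (f g h u v w : R -> R) (x y z : R).
Variables (al be de M : R) (w1 w2 : R -> R).
Hypotheses (ab : al < be) (de0 : 0 < de).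
Hypotheses (bw1 : bm al be M w1) (bw2 : bm al be M w2).
Hypotheses (w1de : {in `[al, be], forall x, de <= w1 x}) (w2de : {in `[al, be], forall x, de <= w2 x}).

Let abW : al <= be := ltW ab.
Let M0 : 0 <= M.
Proof. by have := bw1.2 al; rewrite in_itvE lexx abW => /(_ isT); exact: le_trans. Qed.
Local Notation T := (volterra al w1 w2).
Local Notation ndom := (ndom al be w1 w2).
Let B := M * (be - al).

Let ndomB' u u' h h' := @ndomB R al be M w1 w2 ab bw1 bw2 u u' h h'.
Let ndomZ' u h k := @ndomZ R al be M w1 w2 ab bw1 bw2 u h k.

(** The maximum principle is applied to [u] and to [- u], after [ka] has been taken out of the
    integrals. *)
Lemma resolvent_contraction (ka F : R) u f : 0 < ka -> bm al be F f ->
  ndom u (fun x => ka * (u x - f x)) -> {in `[al, be], forall x, `|u x| <= F}.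
Proof.
move=> ka0 bf du; have [U bu] := ndom_bm ab bw1 bw2 du.
case: du => [[c Hc] q0 _].
have buf := bmB bu bf.
have beJ : be \in `[al, be] by rewrite in_itvE lexx abW.
have Hu : {in `[al, be], forall x, u x = c + ka * T (fun t => u t - f t) x}.
  by move=> x xJ; rewrite (Hc x xJ) (volterraZ ab bw1 bw2 _ buf xJ).
have {}q0 : wprim al w2 (fun t => u t - f t) be = 0.
  move: q0; rewrite (wprimZ _ bw2 buf beJ) => /eqP.
  by rewrite mulf_eq0 gt_eqF//= => /eqP.
have cu : {within `[al, be], continuous u}.
  apply: (@subspace_eq_continuous _ _ _ (fun x => c + ka * T (fun t => u t - f t) x)).
    by move=> x; rewrite inE => xJ; apply/esym; exact: Hu.
  apply: wcD; first exact: wc_cst.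
  apply: wcM; first exact: wc_cst.
  exact: wprim_cont bw1 (wprim_bm ab bw2 buf).
have fF : {in `[al, be], forall x, f x <= F}.
  by move=> x xJ; apply: le_trans (ler_norm _) (bf.2 x xJ).
have up := max_principle ab de0 bw1 bw2 w1de w2de ka0 bf cu Hu q0 fF.
have Tneg x : x \in `[al, be] -> T (fun t => - u t - - f t) x = - T (fun t => u t - f t) x.
  move=> xJ; rewrite -mulN1r -(volterraZ ab bw1 bw2 _ buf xJ).
  by apply: (volterra_eq w1 w2 _ xJ) => t _; rewrite mulN1r opprB opprK addrC.
have qneg : wprim al w2 (fun t => - u t - - f t) be = 0.
  rewrite -[RHS](mulr0 (-1)) -q0 -(wprimZ _ bw2 buf beJ).
  by apply: (wprim_eq w2 _ beJ) => t _; rewrite mulN1r opprB opprK addrC.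
have dn := @max_principle R al be de M w1 w2 ab de0 bw1 bw2 w1de w2de ka (- c) F F (fun t => - u t) (fun t => - f t) ka0 (bmN bf).
move=> x xJ; rewrite ler_norml; apply/andP; split; last exact: up.
rewrite lerNl; apply: (dn _ _ qneg _ x xJ).
- rewrite (_ : (fun t => _) = (fun t => -1 * u t)); last by apply/funext => t; rewrite mulN1r.
  by apply: wcM => //; exact: wc_cst.
- by move=> t tJ; rewrite Tneg// mulrN -opprD -Hu.
- by move=> t tJ; apply: le_trans (bf.2 t tJ); rewrite -normrN ler_norm.
Qed.

(* Taylor expansion at [al]; only the even formal powers [T^k 1] occur since
   [a^2 u'] vanishes at [al]. *)
Lemma ndom_taylor (E : nat -> R -> R) N :
  (exists G, bm al be G (E N)) ->
  (forall k, (k < N)%N -> ndom (E k) (E k.+1)) ->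
  exists c : nat -> R, {in `[al, be], forall x,
    E 0 x = \sum_(k < N) c k * iter k T (cst 1) x + iter N T (E N) x}.
Proof.
elim: N E => [|N IH] E bE dE.
  by exists (fun=> 0) => x _; rewrite big_ord0 add0r.
have [c Hc] := IH (fun k => E k.+1) bE (fun k kN => dE k.+1 kN).
have [[c0 Hc0] _ _] := dE 0 isT.
have bT k : exists C, bm al be C (iter k T (cst 1)).
  elim: k => [|k [C bC]]; first by exists `|1 : R|; exact: bm_cst.
  exact: (volterra_bm ab bw1 bw2 bC).
have [G bG] := bE.
have bTE k : exists C, bm al be C (iter k T (E N.+1)).
  elim: k => [|k [C bC]]; first by exists G.
  exact: (volterra_bm ab bw1 bw2 bC).
(* Applying [T] to the expansion of [E 1] shifts its coefficients by one, and the constant of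
   integration of [E 0] becomes the coefficient of [T^0 1]. *)
exists (fun k => if k is k'.+1 then c k' else c0) => x xJ.
rewrite (Hc0 x xJ) (volterra_eq w1 w2 Hc xJ) big_ord_recl /= mulr1 -addrA; congr (_ + _).
have TD f g F G' : bm al be F f -> bm al be G' g -> T (fun t => f t + g t) x = T f x + T g x.
  move=> bf bg; have := volterraB ab bw1 bw2 bf (bmZ (-1) bg) xJ.
  rewrite (volterraZ ab bw1 bw2 _ bg xJ) mulN1r opprK => <-.
  by apply: (volterra_eq w1 w2 _ xJ) => t _; rewrite mulN1r opprK.
have bS n : exists C, bm al be C (fun x => \sum_(k < n) c k * iter k T (cst 1) x) /\
   T (fun x => \sum_(k < n) c k * iter k T (cst 1) x) x = \sum_(k < n) c k * iter k.+1 T (cst 1) x.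
  elim: n => [|n [C [bC HC]]].
    exists `|0 : R|; split.
      by apply: bm_eq (bm_cst al be 0) => t _; rewrite big_ord0.
    rewrite big_ord0; have [C bC] := bT 0.
    have := volterraZ ab bw1 bw2 0 bC xJ; rewrite mul0r; apply: etrans.
    by apply: (volterra_eq w1 w2 _ xJ) => t _; rewrite mul0r big_ord0.
  have [C' bC'] := bT n.
  exists (C + `|c n| * C'); split.
    by apply: bm_eq (bmD bC (bmZ (c n) bC')) => t _; rewrite big_ord_recr.
  rewrite [RHS]big_ord_recr -HC.
  have := TD _ _ _ _ bC (bmZ (c n) bC'); rewrite (volterraZ ab bw1 bw2 _ bC' xJ); apply: etrans.
  by apply: (volterra_eq w1 w2 _ xJ) => t _; rewrite big_ord_recr.
have [C [bC HC]] := bS N; have [D bD] := bTE N.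
by rewrite (TD _ _ _ _ bC bD) HC.
Qed.

(* With [g] the [N]-th iterate of the resolvent [(1 - (d / N) L)^-1] applied to
   [f], [g - f = O(d)], while the remainder of order [N] of the Taylor expansion
   of [g] is at most [C^N d^-N N^N / (2 N)!]. *)
Lemma ndom_approx f h (e : R) : ndom f h -> 0 < e ->
  exists N (c : nat -> R), {in `[al, be], forall x,
    `|f x - \sum_(k < N) c k * iter k T (cst 1) x| <= e}.
Proof.
move=> df e0.
have [G bG] := ndom_bm ab bw1 bw2 df; have [_ _ [H bH]] := df.
have alJ : al \in `[al, be] by rewrite in_itvE lexx abW.
have G0 : 0 <= G by apply: le_trans (bG.2 al alJ).
have H0 : 0 <= H by apply: le_trans (bH.2 al alJ).
(* The total time of the scheme. The drift away from [f] is at most [H * d <= e / 2], whatever the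
   number of steps. *)
pose d := e / 2 / (H + 1).
have d0 : 0 < d by rewrite !divr_gt0// ltr_wpDl.
(* With [ka = N / d] the remainder is at most G (2 ka)^N B^(2N) / (2N)!, and [fact_double] bounds
   this by G q^N / N!. *)
pose q := 2 * B ^+ 2 / d.
have [N N0 HN] : exists2 N, (0 < N)%N & G * exp_coeff q N <= e / 2.
  have e1 : 0 < e / 2 / (G + 1) by rewrite !divr_gt0// ltr_wpDl.
  have /cvgrPdist_lt/(_ _ e1)[N _ HN] := cvg_exp_coeff q.
  exists N.+1 => //; have := HN N.+1 (leqnSn N); rewrite /= sub0r normrN => /ltW HN'.
  apply: le_trans (ler_wpM2l G0 (ler_norm _)) _.
  apply: le_trans (ler_wpM2l G0 HN') _.
  rewrite mulrC mulrAC ler_pdivrMr ?ltr_wpDl// ler_wpM2l ?divr_ge0 ?(ltW e0)// lerDl.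
  exact: ler01.
pose ka := N%:R / d.
have ka0 : 0 < ka by rewrite divr_gt0// ltr0n.
(* A resolvent defined on all functions by choice; its values on unbounded functions are arbitrary
   and never met. *)
have /choice[Rk HRk] : forall f : R -> R, exists u, (exists F, bm al be F f) -> ndom u (fun x => ka * (u x - f x)).
  move=> k; have [bk|nk] := pselect (exists F, bm al be F k); last by exists k.
  by have [u du] := resolvent_exists ab de0 bw1 bw2 w1de w2de ka0 bk; exists u.
pose g n := iter n Rk f.
have bg n : bm al be G (g n).
  elim: n => [|n IH]; first exact: bG.
  have du := HRk (g n) (ex_intro _ G IH).
  split; last exact: resolvent_contraction ka0 IH du.
  by have [U []] := ndom_bm ab bw1 bw2 du.
have dg n : ndom (g n.+1) (fun x => ka * (g n.+1 x - g n x)).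
  exact: HRk (ex_intro _ G (bg n)).
(* [g 1 - f] is the resolvent of [ka^-1 * h], and each later difference is the resolvent of the
   preceding one, so the contraction property propagates the first bound. *)
have dist n : {in `[al, be], forall x, `|g n.+1 x - g n x| <= H / ka}.
  elim: n => [|n IH].
    apply: (@resolvent_contraction ka _ _ (fun x => ka^-1 * h x)) => //.
      by have := bmZ ka^-1 bH; rewrite ger0_norm ?invr_ge0 ?(ltW ka0)// mulrC.
    apply: ndom_eq (ndomB' (dg 0) df) => // x _.
    by rewrite [RHS]mulrBr mulVKf// gt_eqF.
  apply: (@resolvent_contraction ka _ _ (fun x => g n.+1 x - g n x)) => //.
    by split => //; apply: measurable_funB; [exact: (bg n.+1).1|exact: (bg n).1].
  by apply: ndom_eq (ndomB' (dg n.+1) (dg n)) => // x _; rewrite -mulrBr.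
have dist_n n : {in `[al, be], forall x, `|g n x - f x| <= n%:R * (H / ka)}.
  elim: n => [|n IH] x xJ; first by rewrite subrr normr0 mul0r.
  rewrite -natr1 mulrDl mul1r.
  rewrite (_ : g n.+1 x - f x = (g n x - f x) + (g n.+1 x - g n x)); last by ring.
  by apply: le_trans (ler_normD _ _) _; rewrite lerD ?IH ?dist.
(* [E k n] is L^k applied to [g n], since L (g n) = ka (g n - g n.-1). The truncated predecessor at
   0 does no harm because [dE] concerns only [k < n]. *)
pose E := fix E k n x : R := if k is k'.+1 then ka * (E k' n x - E k' n.-1 x) else g n x.
have dE k n : (k < n)%N -> ndom (E k n) (E k.+1 n).
  elim: k n => [|k IH] [//|n] kn.
    exact: dg.
  apply: ndomZ'; apply: ndomB'; first by apply: IH; exact: ltnW.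
  by apply: IH; exact: kn.
have bE k n : bm al be ((2 * ka) ^+ k * G) (E k n).
  elim: k n => [|k IH] n; first by rewrite expr0 mul1r; exact: bg.
  have := bmZ ka (bmB (IH n) (IH n.-1)); rewrite (ger0_norm (ltW ka0)).
  by apply: bmW; rewrite exprS le_eqVlt; apply/orP; left; apply/eqP; ring.
have bEN : exists G', bm al be G' (E N N) by exists ((2 * ka) ^+ N * G).
have dEN k : (k < N)%N -> ndom (E k N) (E k.+1 N) by exact: dE.
have [c Hc] := @ndom_taylor (fun k => E k N) N bEN dEN.
exists N, c => x xJ.
have gE : E 0 N x = g N x by [].
have := Hc x xJ; rewrite gE => /eqP; rewrite addrC -subr_eq => /eqP cE.
rewrite (_ : f x - _ = iter N T (E N N) x - (g N x - f x)); last by rewrite -cE; ring.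
apply: le_trans (ler_normB _ _) _.
rewrite [e]splitr lerD//; last first.
  apply: le_trans (dist_n N x xJ) _.
  have -> : N%:R * (H / ka) = H * d.
    by rewrite /ka; field; rewrite (gt_eqF d0) pnatr_eq0 -lt0n N0.
  rewrite /d mulrA ler_pdivrMr ?ltr_wpDl// mulrC ler_wpM2l ?divr_ge0 ?(ltW e0)// lerDl.
  exact: ler01.
apply: le_trans (iter_volterra_le ab bw1 bw2 N (bE N N) xJ) _; rewrite -/B.
apply: le_trans HN; rewrite /exp_coeff/=.
have -> : (2 * ka) ^+ N * G * ((B ^+ 2) ^+ N / (N.*2)`!%:R) =
   G * (q ^+ N * (N%:R ^+ N / (N.*2)`!%:R)).
  have -> : 2 * ka = (2 / d) * N%:R by rewrite /ka; ring.
  have -> : q = 2 / d * B ^+ 2 by rewrite /q; ring.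
  move: (2 / d) (B ^+ 2) => s b.
  by rewrite [(s * _%:R) ^+ N]exprMn [(s * b) ^+ N]exprMn; ring.
rewrite ler_wpM2l// ler_wpM2l ?exprn_ge0//.
  by rewrite divr_ge0 ?(ltW d0)// mulr_ge0 ?sqr_ge0.
have f0 n : 0 < n`!%:R :> R by rewrite ltr0n fact_gt0.
rewrite ler_pdivrMr// mulrC ler_pdivlMr//.
by rewrite -natrX -natrM ler_nat mulnC fact_double.
Qed.

End Approximation.

(** * L^p norms on a compact interval *)

Section LpNorm.
Context {R : realType}.
Local Notation mu := (@lebesgue_measure R).
Implicit Types (f g h : R -> R) (al be p e : R).

Lemma Lp_normE (I : set R) p f : measurable I -> 1 <= p ->
  Lp_norm I p%:E f = (poweR (\int[mu]_(x in I) ((`|f x| `^ p)%:E)) p^-1)%E.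
Proof.
move=> mI p1.
rewrite /Lp_norm.
rewrite unlock /=.
apply: (f_equal (fun z => poweR z p^-1)).
rewrite [RHS]integral_mkcond; apply: eq_integral => x _.
rewrite /= /patch; case: ifPn => _; first by [].
by rewrite normr0 powR0 ?gt_eqF// (lt_le_trans ltr01).
Qed.

(** Here [e] is a real upper bound of the norm and not the norm itself, so that errors are added and
    scaled inside [R]. *)
Definition Lpn al be p f e := [/\ measurable_fun `[al, be] f, 0 <= e &
  (\int[mu]_(x in `[al, be]) ((`|f x| `^ p)%:E) <= (e `^ p)%:E)%E].

Lemma powR_meas (D : set R) p f : measurable_fun D f -> measurable_fun D (fun x => `|f x| `^ p).
Proof.
move=> mf; apply: (measurableT_comp (measurable_powR p)).
exact: measurableT_comp.
Qed.

Lemma LpnP al be p f e : 1 <= p -> 0 <= e ->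
  Lpn al be p f e <-> Lp_on `[al, be] p%:E f /\ (Lp_norm `[al, be] p%:E f <= e%:E)%E.
Proof.
move=> p1 e0; have p0 : 0 < p := lt_le_trans ltr01 p1.
have I0 : (0 <= \int[mu]_(x in `[al, be]) ((`|f x| `^ p)%:E))%E.
  by apply: integral_ge0 => x _; rewrite lee_fin powR_ge0.
have eqv : (Lp_norm `[al, be] p%:E f <= e%:E)%E <->
    (\int[mu]_(x in `[al, be]) ((`|f x| `^ p)%:E) <= (e `^ p)%:E)%E.
  rewrite Lp_normE//; split => H.
    have := @gt0_ler_poweR R p (ltW p0) _ _ _ _ H.
    rewrite -poweRrM mulVf ?gt_eqF// poweRe1// poweR_EFin; apply.
      by rewrite in_itv/= poweR_ge0 leey.
    by rewrite in_itv/= lee_fin e0 leey.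
  have pV0 : 0 <= p^-1 by rewrite invr_ge0 ltW.
  have := @gt0_ler_poweR R p^-1 pV0 _ _ _ _ H.
  rewrite poweR_EFin -powRrM mulfV ?gt_eqF// powRr1//; apply.
    by rewrite in_itv/= I0 leey.
  by rewrite in_itv/= lee_fin powR_ge0 leey.
split => [[mf _ /eqv H]|[H1 /eqv H2]].
  split => //; rewrite /Lp_on inE; apply/andP; split; rewrite inE/=.
    by apply/(measurable_restrictT _ _).1.
  by rewrite /finite_norm; apply: le_lt_trans H _; rewrite ltry.
split => //; move: H1; rewrite /Lp_on inE => /andP[]; rewrite inE/= => mf _.
by apply/(measurable_restrictT _ _).2.
Qed.

Lemma Lpn_ge0 al be p f e : Lpn al be p f e -> 0 <= e. Proof. by case. Qed.

Lemma Lpn_meas al be p f e : Lpn al be p f e -> measurable_fun `[al, be] f. Proof. by case. Qed.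

Lemma LpnW al be p f e e' : 0 <= p -> Lpn al be p f e -> e <= e' -> Lpn al be p f e'.
Proof.
move=> p0 [mf e0 H] ee'; split => //; first exact: le_trans ee'.
apply: le_trans H _; rewrite lee_fin ge0_ler_powR ?nnegrE//.
exact: le_trans ee'.
Qed.

Lemma Lpn_eq al be p f g e : {in `[al, be], f =1 g} -> Lpn al be p f e -> Lpn al be p g e.
Proof.
move=> fg [mf e0 H]; split; last 1 first.
- apply: le_trans H; rewrite le_eqVlt; apply/orP; left; apply/eqP; apply: eq_integral => x.
  by rewrite inE => xJ; rewrite (fg x xJ).
- by apply: eq_measurable_fun mf => x; rewrite inE => xJ; exact: fg.
- exact: e0.
Qed.

Lemma Lpn_ae al be p f g e : measurable_fun `[al, be] g ->
  {ae mu, forall t, t \in `[al, be] -> f t = g t} -> Lpn al be p f e -> Lpn al be p g e.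
Proof.
move=> mg fg [mf e0 H]; split; [exact: mg|exact: e0|].
apply: le_trans H; rewrite le_eqVlt; apply/orP; left; apply/eqP; apply: ae_eq_integral.
- exact: measurable_itv.
- by apply/measurable_EFinP; exact: powR_meas.
- by apply/measurable_EFinP; exact: powR_meas.
- apply: (ae_filterS fg) => t /= fgt tx.
  by rewrite (fgt tx).
Qed.

Lemma LpnD al be p f g e e' : 1 <= p -> Lpn al be p f e -> Lpn al be p g e' ->
  Lpn al be p (fun x => f x + g x) (e + e').
Proof.
move=> p1 hf hg; have e0 := Lpn_ge0 hf; have e0' := Lpn_ge0 hg.
have mf := Lpn_meas hf; have mg := Lpn_meas hg.
apply/LpnP => //; first exact: addr_ge0.
have /LpnP[//|//|H1 H2] := hf; have /LpnP[//|//|H3 H4] := hg.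
have N : (Lp_norm `[al, be] p%:E (fun x => f x + g x)%R <= (e + e')%:E)%E.
  rewrite EFinD; apply: le_trans (leeD H2 H4).
  rewrite /Lp_norm; have := @eminkowski _ _ _ mu (f \_ `[al, be]) (g \_ `[al, be]) p%:E.
  rewrite (_ : (f \_ `[al, be] \+ g \_ `[al, be]) = (fun x => f x + g x) \_ `[al, be]); last first.
    by apply/funext => x; rewrite /= /patch; case: ifPn => // _; rewrite addr0.
  apply => //; by apply/(measurable_restrictT _ _).1.
split => //; rewrite /Lp_on inE; apply/andP; split; rewrite inE/=.
  by apply/(measurable_restrictT _ _).1 => //; exact: measurable_funD.
by rewrite /finite_norm; apply: le_lt_trans N _; rewrite ltry.
Qed.

Lemma Lpn_bmM al be p M b f e : 1 <= p -> al <= be -> bm al be M b -> Lpn al be p f e ->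
  Lpn al be p (fun x => b x * f x) (M * e).
Proof.
move=> p1 ab [mb bM] [mf e0 H]; have p0 : 0 < p := lt_le_trans ltr01 p1.
have M0 : 0 <= M by apply: le_trans (bM al _); rewrite ?in_itvE ?lexx.
split; [exact: measurable_funM|exact: mulr_ge0|].
apply: (@le_trans _ _ (\int[mu]_(x in `[al, be]) ((M `^ p)%:E * (`|f x| `^ p)%:E))%E).
  apply: ge0_le_integral; first exact: measurable_itv.
  - by move=> x _; rewrite lee_fin powR_ge0.
  - by apply/measurable_EFinP; apply: powR_meas; exact: measurable_funM.
  - by apply/measurable_EFinP; apply: measurable_funM => //; exact: powR_meas.
  - move=> x /= xJ; rewrite -EFinM lee_fin -powRM// ge0_ler_powR ?nnegrE ?mulr_ge0 ?(ltW p0)//.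
    by rewrite normrM ler_wpM2r// bM.
rewrite (_ : integral _ _ _ = ((M `^ p)%:E * \int[mu]_(x in `[al, be]) (`|f x| `^ p)%:E)%E).
  by rewrite powRM// EFinM lee_wpmul2l// lee_fin powR_ge0.
apply: ge0_integralZl; [exact: measurable_itv| | |].
- by apply/measurable_EFinP; exact: powR_meas.
- by move=> x _; rewrite lee_fin powR_ge0.
- by rewrite lee_fin powR_ge0.
Qed.

Lemma LpnZ al be p c f e : 1 <= p -> al <= be -> Lpn al be p f e ->
  Lpn al be p (fun x => c * f x) (`|c| * e).
Proof. by move=> p1 ab; apply: Lpn_bmM => //; exact: bm_cst. Qed.

Lemma LpnN al be p f e : Lpn al be p f e -> Lpn al be p (fun x => - f x) e.
Proof.
move=> [mf e0 H]; split; [exact: measurableT_comp|exact: e0|].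
by apply: le_trans H; rewrite le_eqVlt; apply/orP; left; apply/eqP; apply: eq_integral => x _; rewrite normrN.
Qed.

Lemma integral_itv_cst al be (c : R) : al <= be ->
  (\int[mu]_(x in `[al, be]) c%:E = (c * (be - al))%:E)%E.
Proof.
move=> ab; rewrite integral_cst//.
have := lebesgue_measure_itv `[al, be]; rewrite /= => ->.
rewrite lte_fin; case: ltP => [_|ba]; first by rewrite EFinM.
by rewrite (@le_anti _ _ be al) ?ab ?ba// subrr mulr0 mule0.
Qed.

Lemma Lpn_bm al be p C f : 1 <= p -> al <= be -> bm al be C f ->
  Lpn al be p f (C * (be - al) `^ p^-1).
Proof.
move=> p1 ab [mf fC]; have p0 : 0 < p := lt_le_trans ltr01 p1.
have C0 : 0 <= C by apply: le_trans (fC al _); rewrite ?in_itvE ?lexx.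
split => //; first by rewrite mulr_ge0// powR_ge0.
apply: (@le_trans _ _ (\int[mu]_(x in `[al, be]) (C `^ p)%:E)%E).
  apply: ge0_le_integral; first exact: measurable_itv.
  - by move=> x _; rewrite lee_fin powR_ge0.
  - by apply/measurable_EFinP; exact: powR_meas.
  - by apply/measurable_EFinP; exact: measurable_cst.
  - by move=> x /= xJ; rewrite lee_fin ge0_ler_powR ?nnegrE ?(ltW p0)// fC.
rewrite integral_itv_cst// lee_fin powRM ?powR_ge0// -powRrM mulVf ?gt_eqF//.
by rewrite powRr1// subr_ge0.
Qed.

(** Hoelder's inequality against the constant 1, whose norm for the conjugate exponent bounds [K].
    The case p = 1, where that exponent is infinite, is treated apart. *)
Lemma Lpn_ibl al be p : 1 <= p -> al <= be -> exists2 K, 0 <= K & forall f e,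
  Lpn al be p f e -> ibl al be f /\ prim al (fun t => `|f t|) be <= K * e.
Proof.
move=> p1 ab; have p0 : 0 < p := lt_le_trans ltr01 p1.
suff [K K0 HK] : exists2 K, 0 <= K & forall f e, Lpn al be p f e ->
    (\int[mu]_(x in `[al, be]) `|f x|%:E <= (K * e)%:E)%E.
  exists K => // f e hf; have mf := Lpn_meas hf.
  have H := HK _ _ hf; split.
    apply/integrableP; split; first exact/measurable_EFinP.
    by apply: le_lt_trans H _; rewrite ltry.
  rewrite /prim /Rintegral -lee_fin fineK// ge0_fin_numE; first by apply: le_lt_trans H _; rewrite ltry.
  by apply: integral_ge0 => x _; rewrite lee_fin.
move: p1; rewrite le_eqVlt => /predU1P[pE|p1].
  exists 1 => // f e [mf e0 H]; rewrite mul1r; move: H; rewrite -pE powRr1//.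
  by under eq_integral do rewrite powRr1//.
pose q := (1 - p^-1)^-1.
have pV1 : p^-1 < 1 by rewrite invf_lt1.
have q0 : 0 < q by rewrite invr_gt0 subr_gt0.
have q1 : 1 <= q by rewrite invf_ge1 ?subr_gt0// gerBl invr_ge0 ltW.
have pq : p^-1 + q^-1 = 1 by rewrite /q invrK addrC subrK.
exists (1 * (be - al) `^ q^-1); first by rewrite mul1r powR_ge0.
move=> f e hf; have mf := Lpn_meas hf; have e0 := Lpn_ge0 hf.
have /LpnP[|//|_ H2] := hf; first exact: ltW.
pose o : R -> R := fun=> 1.
have b1 : bm al be 1 o by have := @bm_cst R al be 1; rewrite normr1.
have h1 := Lpn_bm q1 ab b1.
have /LpnP[//||_ H4] := h1; first exact: Lpn_ge0 h1.
have mJ (k : R -> R) : measurable_fun `[al, be] k -> measurable_fun setT (k \_ `[al, be]).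
  by move=> mk; apply/(measurable_restrictT _ _).1.
have := @hoelder _ _ _ mu (f \_ `[al, be]) (o \_ `[al, be]) p q
  (mJ _ mf) (mJ _ (measurable_cst _)) p0 q0 pq.
rewrite -/(Lp_norm _ _ f) -/(Lp_norm _ _ o).
rewrite (_ : f \_ _ \* _ = f \_ `[al, be]); last first.
  by apply/funext => x; rewrite /= /patch; case: ifPn => // _; rewrite ?mulr1 ?mulr0.
rewrite -/(Lp_norm `[al, be] 1%:E f) (@Lp_normE _ 1 f)// invr1 poweRe1; last first.
  by apply: integral_ge0 => x _; rewrite lee_fin powR_ge0.
under eq_integral do rewrite powRr1//.
move=> /le_trans -> //; rewrite [(_ * e)%R]mulrC EFinM.
by apply: lee_pmul => //; exact: Lnorm_ge0.
Qed.

(** Dominated convergence for |f - f_n|^p, dominated by |g|^p. A single good index is extracted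
    because density arguments ask for one approximant only. *)
Lemma Lpn_dct al be p f (f_ : nat -> R -> R) g e0 : 1 <= p ->
  measurable_fun `[al, be] f -> (forall n, measurable_fun `[al, be] (f_ n)) ->
  {in `[al, be], forall x, f_ n x @[n --> \oo] --> f x} ->
  Lpn al be p g e0 -> (forall n, {in `[al, be], forall x, `|f x - f_ n x| <= g x}) ->
  forall e, 0 < e -> exists n, Lpn al be p (fun x => f x - f_ n x) e.
Proof.
move=> p1 mf mf_ cf [mg e00 Hg] fg e e_gt0; have p0 : 0 < p := lt_le_trans ltr01 p1.
have [] := @dominated_convergence _ _ R mu `[al, be] (measurable_itv _)
  (fun n x => (`|f x - f_ n x| `^ p)%:E) (cst 0%E) (fun x => (`|g x| `^ p)%:E).
- by move=> n; apply/measurable_EFinP; apply: powR_meas; exact: measurable_funB.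
- exact: measurable_cst.
- apply: aeW => x /= xJ; apply: cvg_EFin; first by apply: nearW.
  have c0 : (fun n => `|f x - f_ n x|) @ \oo --> (0 : R).
    rewrite -[X in _ --> X](@normr0 _ R) -(subrr (f x)).
    by apply: cvg_norm; apply: cvgB; [exact: cvg_cst|exact: cf].
  apply/cvgrPdist_lt => d d0.
  have d1 : 0 < d `^ p^-1 by rewrite powR_gt0.
  have /cvgrPdist_lt/(_ _ d1)[N _ HN] := c0.
  exists N => // n /HN/=; rewrite !sub0r !normrN normr_id => H.
  have -> : d = (d `^ p^-1) `^ p by rewrite -powRrM mulVf ?gt_eqF// powRr1// ltW.
  by rewrite ger0_norm ?powR_ge0// gt0_ltr_powR ?nnegrE ?powR_ge0.
- apply/integrableP; split; first by apply/measurable_EFinP; exact: powR_meas.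
  under eq_integral do rewrite gee0_abs ?lee_fin ?powR_ge0//.
  by apply: le_lt_trans Hg _; rewrite ltry.
- apply: aeW => x /= n xJ; rewrite lee_fin ger0_norm ?powR_ge0//.
  rewrite ge0_ler_powR ?nnegrE ?(ltW p0)//.
  by apply: le_trans (fg n x xJ) (ler_norm _).
move=> _ _; rewrite integral0.
move=> /fine_cvgP[fin /cvgrPdist_lt/(_ (e `^ p))]; rewrite powR_gt0// => /(_ isT) near0.
have [N _ HN] := filterI fin near0.
have [fN] := HN N (leqnn N); rewrite /= sub0r normrN => H.
exists N; split => //; [exact: measurable_funB|exact: ltW|].
have -> : (\int[mu]_(x in `[al, be]) (`|f x - f_ N x| `^ p)%:E = (\int[mu]_(x in `[al, be]) (`|f x - f_ N x| `^ p))%:E)%E.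
  by rewrite /Rintegral; apply/esym; exact: fineK fN.
by rewrite lee_fin; apply: ltW; apply: le_lt_trans H; exact: ler_norm.
Qed.

End LpNorm.

(** * Tent functions in the domain of L *)

Section Tent.
Context {R : realType}.
Implicit Types (f g h u v w : R -> R) (x y z : R).
Variables (al be de M : R) (w1 w2 : R -> R).
Hypotheses (ab : al < be) (de0 : 0 < de).
Hypotheses (bw1 : bm al be M w1) (bw2 : bm al be M w2).
Hypotheses (w1de : {in `[al, be], forall x, de <= w1 x}) (w2de : {in `[al, be], forall x, de <= w2 x}).

Let abW : al <= be := ltW ab.
Let M0 : 0 <= M.
Proof. by have := bw1.2 al; rewrite in_itvE lexx abW => /(_ isT); exact: le_trans. Qed.
Local Notation T := (volterra al w1 w2).
Local Notation ndom := (ndom al be w1 w2).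

Lemma wprim_ge0 w f x y : {in `[al, be], forall x, de <= w x} -> al <= x -> y <= be ->
  {in `[x, y], forall t, 0 <= f t} -> 0 <= wprim x w f y.
Proof.
move=> wde ax yb f0; apply: prim_ge0 => t txy; apply: mulr_ge0; last exact: f0.
move: txy; rewrite in_itvE => /andP[t1 t2]; apply: le_trans (ltW de0) _; apply: wde.
by rewrite in_itvE (le_trans ax)//= (le_trans t2).
Qed.

Lemma wprim_gt0 w f F x y x' y' (et : R) : bm al be M w -> {in `[al, be], forall x, de <= w x} ->
  bm al be F f -> 0 < et -> al <= x -> x <= x' -> x' < y' -> y' <= y -> y <= be ->
  {in `[x, y], forall t, 0 <= f t} -> {in `[x', y'], forall t, et <= f t} ->
  0 < wprim x w f y.
Proof.
move=> bw wde bf et0 ax xx' xy' yy' yb f0 fet.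
have bwx : bm x be M w by apply: bmS bw.
have bfx : bm x be F f by apply: bmS bf.
have bwx' : bm x' be M w by apply: bmS bwx.
have bfx' : bm x' be F f by apply: bmS bfx.
have x'y : x' <= y by apply: le_trans (ltW xy') yy'.
rewrite (wprim_split bwx bfx xx' x'y yb) (wprim_split bwx' bfx' (lexx x') _ yb)//.
have -> : wprim x' w f x' = 0 by exact: prim_al.
rewrite add0r (wprim_split bwx' bfx' (ltW xy') yy' yb).
have h1 : 0 <= wprim x w f x'.
  apply: wprim_ge0 => //; first by apply: le_trans yb.
  by move=> t; rewrite in_itvE => /andP[t1 t2]; apply: f0; rewrite in_itvE t1 (le_trans t2).
have h2 : 0 <= wprim y' w f y.
  apply: wprim_ge0 => //; first by rewrite (le_trans ax)// (le_trans xx')// ltW.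
  move=> t; rewrite in_itvE => /andP[t1 t2]; apply: f0; rewrite in_itvE t2 andbT.
  by rewrite (le_trans xx')// (le_trans (ltW xy')).
have h3 : 0 < wprim x' w f y'.
  have := @wprim_ge R al be de M de0 w f F x' y' et 0 bw wde bf (ltW et0) (le_trans ax xx') (ltW xy') (le_trans yy' yb).
  have H : {in `[x', y'], forall t, et * (t - x') ^+ 0 <= f t}.
    by move=> t /fet; rewrite expr0 mulr1.
  move=> /(_ H); apply: lt_le_trans.
  by rewrite expr1 divr1 !mulr_gt0// subr_gt0.
by rewrite ltr_wpDl// ltr_wpDr.
Qed.

Lemma bm_indic (A : set R) : measurable A -> bm al be 1 (\1_A : R -> R).
Proof.
move=> mA; split; first exact: measurable_indic.
by move=> x _; rewrite indicE; case: (_ \in _); rewrite ?normr1 ?normr0.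
Qed.

Lemma indic_in (a b t : R) : a < t -> t < b -> \1_(`]a, b[%classic) t = 1 :> R.
Proof. by move=> h1 h2; rewrite indicE mem_set//= in_itv/= h1 h2. Qed.

Lemma indic_le (a b t : R) : t <= a -> \1_(`]a, b[%classic) t = 0 :> R.
Proof. by move=> h1; rewrite indicE memNset//= in_itv/= ltNge h1. Qed.

Lemma indic_ge (a b t : R) : b <= t -> \1_(`]a, b[%classic) t = 0 :> R.
Proof. by move=> h1; rewrite indicE memNset//= in_itv/= [t < b]ltNge h1 andbF. Qed.

Lemma indic_ge0 (A : set R) (t : R) : 0 <= \1_A t :> R.
Proof. by rewrite indicE; case: (_ \in _). Qed.

(** The flux [v] is built first: it rises from 0 at [y] to 1 at the midpoint [m] and returns to 0 at
    [z]. It therefore vanishes at both ends, as the Neumann conditions demand, and comes from a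
    bounded source made of two indicators. Then [u] is 1 minus the normalized primitive of
    [w1 v]. *)
Lemma tent y z : al <= y -> y < z -> z <= be -> exists u h,
  [/\ ndom u h, {in `[al, be], forall x, 0 <= u x <= 1},
      {in `[al, be], forall x, x <= y -> u x = 1} &
      {in `[al, be], forall x, z <= x -> u x = 0}].
Proof.
move=> ay yz zb.
pose m := (y + z) / 2.
have ym : y < m by rewrite /m; lra.
have mz : m < z by rewrite /m; lra.
have [am mb yb az] : [/\ al <= m, m <= be, y <= be & al <= z].
  by split; lra.
pose i1 := \1_(`]y, m[%classic) : R -> R; pose i2 := \1_(`]m, z[%classic) : R -> R.
have bi1 : bm al be 1 i1 by exact: bm_indic.
have bi2 : bm al be 1 i2 by exact: bm_indic.
have pos a b b' : al <= a -> a < b' -> b' <= b -> b <= be -> 0 < wprim a w2 (\1_(`]a, b[%classic)) b'.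
  move=> ha hab hb' hb.
  apply: (@wprim_gt0 w2 _ 1 a b' (a + (b' - a) / 3) (a + 2 * (b' - a) / 3) 1) => //; try lra.
  - exact: bm_indic.
  - move=> t; rewrite in_itvE => /andP[t1 t2]; rewrite indic_in//; lra.
pose p1 := wprim y w2 i1 m; pose p2 := wprim m w2 i2 z.
have p10 : 0 < p1 by apply: pos => //; exact: ltW.
have p20 : 0 < p2 by apply: pos => //; exact: ltW.
(* The factors [p1^-1] and [p2^-1] give the rise and the fall of [v] the same size 1. *)
pose h t := p1^-1 * i1 t - p2^-1 * i2 t.
have bh : bm al be _ h := bmB (bmZ p1^-1 bi1) (bmZ p2^-1 bi2).
pose v := wprim al w2 h.
have bv : bm al be _ v := wprim_bm ab bw2 bh.
have hL t : t <= y -> h t = 0.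
  by move=> ty; rewrite /h /i1 /i2 !indic_le ?mulr0 ?subr0// (le_trans ty)// ltW.
have hR t : z <= t -> h t = 0.
  by move=> ty; rewrite /h /i1 /i2 !indic_ge ?mulr0 ?subr0// (le_trans (ltW mz)).
have h1 t : t <= m -> h t = p1^-1 * i1 t.
  by move=> tm; rewrite /h /i2 indic_le// mulr0 subr0.
have h2 t : m <= t -> h t = - p2^-1 * i2 t.
  by move=> tm; rewrite /h /i1 indic_ge// mulr0 sub0r mulNr.
have bwS a : al <= a -> bm a be M w2 by move=> ?; apply: bmS bw2.
have wZ a b f c : al <= a -> a <= b -> b <= be -> bm al be 1 f ->
    wprim a w2 (fun t => c * f t) b = c * wprim a w2 f b.
  move=> ha hab hb bf; apply: (@wprimZ _ a b M w2 f 1) => //.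
  - exact: bmS bw2.
  - exact: bmS bf.
  - by rewrite in_itvE hab lexx.
have w0 a b w f : {in `[a, b], forall t, f t = 0} -> a <= b -> wprim a w f b = 0.
  move=> f0 ab'; rewrite /wprim (@eq_prim _ _ _ (fun=> 0)) ?prim_cst ?mul0r// => t /f0 ->.
  by rewrite mulr0.
have vL x : al <= x -> x <= y -> v x = 0.
  by move=> ax xy; apply: w0 => // t; rewrite in_itvE => /andP[_ tx]; apply: hL; exact: le_trans xy.
have v1 x : y <= x -> x <= m -> v x = p1^-1 * wprim y w2 i1 x.
  move=> yx xm; have xb : x <= be by exact: le_trans mb.
  rewrite /v (wprim_split bw2 bh ay yx xb) -/v (vL y)// add0r -wZ//.
  apply: eq_prim => t; rewrite in_itvE => /andP[_ tx]; rewrite h1//; exact: le_trans xm.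
have vm : v m = 1 by rewrite v1 ?(ltW ym)// mulVf// gt_eqF.
have v2 x : m <= x -> x <= z -> v x = 1 - p2^-1 * wprim m w2 i2 x.
  move=> mx xz; have xb : x <= be by exact: le_trans zb.
  rewrite /v (wprim_split bw2 bh am mx xb) -/v vm -mulNr -wZ//.
  by congr (_ + _); apply: eq_prim => t; rewrite in_itvE => /andP[mt _]; rewrite h2.
have vz : v z = 0 by rewrite v2 ?(ltW mz)// mulVf ?gt_eqF// subrr.
have vR x : z <= x -> x <= be -> v x = 0.
  move=> zx xb; rewrite /v (wprim_split bw2 bh az zx xb) -/v vz add0r.
  by apply: w0 => // t; rewrite in_itvE => /andP[zt _]; exact: hR.
have v0 x : x \in `[al, be] -> 0 <= v x.
  rewrite in_itvE => /andP[ax xb].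
  have [xy|xy] := leP x y; first by rewrite vL.
  have [xm|xm] := leP x m.
    rewrite v1 ?(ltW xy)// mulr_ge0 ?invr_ge0 ?(ltW p10)//.
    by apply: wprim_ge0 => // t _; exact: indic_ge0.
  have [xz|xz] := leP x z; last by rewrite vR// ltW.
  rewrite v2 ?(ltW xm)// subr_ge0 mulrC ler_pdivrMr// mul1r.
  rewrite /p2 (wprim_split (bwS _ am) (bmS am (lexx be) bi2) (ltW xm) xz zb) lerDl.
  by apply: wprim_ge0 => // t _; exact: indic_ge0.
(* The total increase of the primitive of [w1 v]; dividing by it makes [u] reach exactly 0 at
   [z]. *)
pose D := wprim al w1 v be.
have D0 : 0 < D.
  pose m' := (y + m) / 2.
  have m'y : y < m' by rewrite /m'; lra.
  have m'm : m' < m by rewrite /m'; lra.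
  have vm' : 0 < v m'.
    rewrite v1 ?(ltW m'y) ?(ltW m'm)//; apply: mulr_gt0; first by rewrite invr_gt0.
    by apply: pos => //; exact: ltW.
  apply: (wprim_gt0 (x' := m') (y' := m) bw1 w1de bv vm') => //; first lra.
  move=> t; rewrite in_itvE => /andP[t1 t2].
  have yt : y <= t by apply: le_trans t1; exact: ltW.
  rewrite !v1 ?(ltW m'y) ?(ltW m'm)// ler_wpM2l ?invr_ge0 ?(ltW p10)//.
  rewrite [leRHS](wprim_split (bwS _ ay) (bmS ay (lexx be) bi1) (ltW m'y) t1) ?(le_trans t2)// lerDl.
  apply: wprim_ge0 => //; lra.
pose u x := 1 - D^-1 * wprim al w1 v x.
have Pv0 x : x \in `[al, be] -> 0 <= wprim al w1 v x <= D.
  move=> xJ; move: (xJ); rewrite in_itvE => /andP[ax xb].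
  have s1 t : t \in `[al, x] -> 0 <= v t.
    by rewrite in_itvE => /andP[t1 t2]; apply: v0; rewrite in_itvE t1 (le_trans t2).
  have s2 t : t \in `[x, be] -> 0 <= v t.
    by rewrite in_itvE => /andP[t1 t2]; apply: v0; rewrite in_itvE t2 (le_trans ax).
  rewrite (@wprim_ge0 w1)//= /D (wprim_split bw1 bv ax xb (lexx be)) lerDl.
  exact: (@wprim_ge0 w1).
exists u, (fun x => - D^-1 * h x); split.
- split.
  + exists 1 => x xJ; rewrite (volterraZ ab bw1 bw2 _ bh xJ) /u; congr (_ + _).
    by rewrite mulNr.
  + rewrite (wprimZ _ bw2 bh) ?in_itvE ?lexx ?abW//.
    by rewrite -/v vR// mulr0.
  + by eexists; exact: bmZ bh.
- move=> x xJ; have /andP[p0 pD] := Pv0 x xJ; rewrite /u subr_ge0 gerBl.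
  by rewrite mulr_ge0 ?invr_ge0 ?(ltW D0)// andbT mulrC ler_pdivrMr// mul1r.
- move=> x; rewrite in_itvE => /andP[ax xb] xy; rewrite /u w0 ?mulr0 ?subr0// => t.
  by rewrite in_itvE => /andP[t1 t2]; rewrite vL// (le_trans t2).
- move=> x; rewrite in_itvE => /andP[ax xb] zx; rewrite /u.
  have -> : wprim al w1 v x = D.
    rewrite /D (wprim_split bw1 bv ax xb (lexx be)) [X in _ = _ + X]w0 ?addr0// => t.
    by rewrite in_itvE => /andP[t1 t2]; rewrite vR// (le_trans zx).
  by rewrite mulVf ?subrr// gt_eqF.
Qed.

End Tent.

(** * From indicators of half-lines to all of L^p *)

Section Density.
Context {R : realType}.
Local Notation mu := (@lebesgue_measure R).
Implicit Types (f g h u v w : R -> R) (x y z : R) (V : (R -> R) -> Prop).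

(** Functions are total, so the last clause makes membership depend only on values on the
    interval. *)
Definition lin_space al be V :=
  [/\ V (cst 1), (forall f g, V f -> V g -> V (fun x => f x + g x)),
      (forall c f, V f -> V (fun x => c * f x)) &
      (forall f g, {in `[al, be], f =1 g} -> V f -> V g)].

Lemma lin_spaceB al be V f g : lin_space al be V -> V f -> V g -> V (fun x => f x - g x).
Proof.
move=> [_ VD VZ Veq] Vf Vg; apply: Veq (VD _ _ Vf (VZ (-1) _ Vg)).
by move=> x _; rewrite mulN1r.
Qed.

Lemma lin_space_sum al be V n (c : nat -> R) (F : nat -> R -> R) : lin_space al be V ->
  (forall k, V (F k)) -> V (fun x => \sum_(k < n) c k * F k x).
Proof.
move=> [V1 VD VZ Veq] VF; elim: n => [|n IH].
  by apply: Veq (VZ 0 _ V1) => x _; rewrite big_ord0 mul0r.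
by apply: Veq (VD _ _ IH (VZ (c n) _ (VF n))) => x _; rewrite big_ord_recr.
Qed.

Definition approximable al be p V h := forall e : R, 0 < e ->
  exists g, V g /\ Lpn al be p (fun x => h x - g x) e.

Section SimpleFunctions.
Import finmap.finmap HBSimple HBNNSimple.

Lemma nnsfun_indic_sum d (T : measurableType d) (G : {nnsfun T >-> R}) : exists N (c : nat -> R),
  forall x : T, G x = \sum_(i < N) c i * \1_(G @^-1` [set c i]) x.
Proof.
exists #|` fset_set (range G)|, (fun i => (fset_set (range G))`_i) => x.
exact: fimfunEord.
Qed.

End SimpleFunctions.

Section Closure.
Import HBSimple HBNNSimple.
Variables (al be p : R) (V : (R -> R) -> Prop).
Hypotheses (ab : al < be) (p1 : 1 <= p) (linV : lin_space al be V).
Let abW : al <= be := ltW ab.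
Let p0 : 0 < p := lt_le_trans ltr01 p1.
Local Notation App := (approximable al be p V).

Lemma approximable_lim h : (forall e : R, 0 < e -> exists g, App g /\ Lpn al be p (fun x => h x - g x) e) -> App h.
Proof.
move=> H e e0; have e2 : 0 < e / 2 by rewrite divr_gt0.
have [g [/(_ _ e2)[k [Vk gk]] hg]] := H _ e2; exists k; split => //.
rewrite [e]splitr; apply: Lpn_eq (LpnD p1 hg gk) => x _.
by rewrite addrA subrK.
Qed.

Lemma approximable_eq f g : {in `[al, be], f =1 g} -> App f -> App g.
Proof.
move=> fg Hf e e0; have [k [Vk fk]] := Hf e e0; exists k; split; first exact: Vk.
by apply: Lpn_eq fk => x xJ; rewrite (fg x xJ).
Qed.

Lemma approximableD f g : App f -> App g -> App (fun x => f x + g x).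
Proof.
move=> Hf Hg e e0; have e2 : 0 < e / 2 by rewrite divr_gt0.
have [f' [Vf ff]] := Hf _ e2; have [g' [Vg gg]] := Hg _ e2.
exists (fun x => f' x + g' x); split; first by case: linV => _ + _ _; apply.
by rewrite [e]splitr; apply: Lpn_eq (LpnD p1 ff gg) => x _; rewrite opprD addrACA.
Qed.

Lemma approximableZ c f : App f -> App (fun x => c * f x).
Proof.
move=> Hf e e0; have e1 : 0 < e / (`|c| + 1) by rewrite divr_gt0// ltr_wpDl.
have [f' [Vf ff]] := Hf _ e1.
exists (fun x => c * f' x); split; first by case: linV => _ _ + _; apply.
have h := LpnZ c p1 abW ff.
apply: Lpn_eq (LpnW (ltW p0) h _); first by move=> x _; rewrite mulrBr.
by rewrite mulrA ler_pdivrMr ?ltr_wpDl// mulrC ler_wpM2l ?(ltW e0)// lerDl.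
Qed.

Lemma approximable0 : App (cst 0).
Proof.
move=> e e0; exists (fun x => 0 * cst 1 x); split.
  by case: linV => V1 _ VZ _; exact: VZ.
have := Lpn_bm p1 abW (bm_cst al be 0); rewrite normr0 mul0r => H.
apply: Lpn_eq (LpnW (ltW p0) H (ltW e0)) => x _.
by rewrite mul0r subr0.
Qed.

Lemma approximable_sum n (F : nat -> R -> R) : (forall k, (k < n)%N -> App (F k)) ->
  App (fun x => \sum_(k < n) F k x).
Proof.
elim: n => [|n IH] HF.
  by apply: approximable_eq approximable0 => x _; rewrite big_ord0.
apply: approximable_eq (approximableD (IH _) (HF n (ltnSn n))).
  by move=> x _; rewrite big_ord_recr.
by move=> k kn; apply: HF; exact: ltnW.
Qed.

(** The partial sums of the indicators converge in L^p by dominated convergence, [p] being finite.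
    This is the countable step of the Dynkin argument. *)
Lemma approximable_bigcup (F : (set R)^nat) : (forall n, measurable (F n)) ->
  trivIset setT F -> (forall n, App (\1_(F n))) -> App (\1_(\bigcup_k F k)).
Proof.
move=> mF tF HF; apply: approximable_lim => e e0.
have mU : measurable (\bigcup_k F k) by exact: bigcupT_measurable.
pose f_ n x : R := \sum_(k < n) \1_(F k) x.
have mf_ n : measurable_fun `[al, be] (f_ n).
  apply: measurable_sum => k; exact: measurable_indic.
have mf : measurable_fun `[al, be] (\1_(\bigcup_k F k) : R -> R) by exact: measurable_indic.
have fE n x : f_ n x = \1_(\bigcup_(k in `I_n) F k) x.
  elim: n => [|n IH]; first by rewrite /f_ big_ord0 bigcup_mkord big_ord0 indic0.
  rewrite /f_ big_ord_recr/= -/(f_ n x) IH !indicE.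
  have [xn|xn] := boolP (x \in F n).
    rewrite memNset ?add0r ?mem_set//.
      by exists n => /=; [exact: ltnSn|rewrite inE in xn].
    move=> [k /= kn Fk]; rewrite inE in xn.
    have : k = n by apply: tF => //; exists x.
    by move=> kE; move: kn; rewrite kE ltnn.
  rewrite addr0; congr (_%:R); congr nat_of_bool; apply/idP/idP; rewrite !inE => -[k /= kn Fk].
    by exists k => //=; exact: ltnW.
  exists k => //=; move: kn; rewrite ltnS leq_eqVlt => /orP[/eqP kE|//].
  by move: xn; rewrite -kE mem_set.
have dom n x : `|\1_(\bigcup_k F k) x - f_ n x| <= 1 :> R.
  rewrite fE !indicE; case: (_ \in _); case: (_ \in _) => /=;
   by rewrite ?subrr ?subr0 ?sub0r ?normrN ?normr1 ?normr0.
have cvg x : f_ n x @[n --> \oo] --> (\1_(\bigcup_k F k) x : R).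
  have [[k _ Fk]|nF] := pselect ((\bigcup_k F k) x).
    rewrite indicE mem_set; last by exists k.
    apply: cvg_near_cst; exists k.+1 => // n /= kn.
    by rewrite fE indicE mem_set//; exists k.
  rewrite indicE memNset//; apply: cvg_near_cst; apply: nearW => n.
  by rewrite fE indicE memNset// => -[k _ Fk]; apply: nF; exists k.
have b1 := Lpn_bm p1 abW (bm_cst al be 1).
have := @Lpn_dct R al be p _ f_ (fun=> 1) _ p1 mf mf_ (fun x _ => cvg x) b1 (fun n x _ => dom n x) e e0.
move=> [n Hn]; exists (f_ n); split => //.
by apply: (@approximable_sum n (fun k => \1_(F k))) => k _; exact: HF.
Qed.

Hypothesis App_le : forall y, App (\1_(`]-oo, y]%classic)).

Lemma approximable_oc x y : App (\1_(`]x, y]%classic)).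
Proof.
have [xy|yx] := leP x y; last first.
  by apply: approximable_eq approximable0 => t _; rewrite indicE memNset//= in_itv/= => /andP[h1 h2]; lra.
apply: approximable_eq (approximableD (App_le y) (approximableZ (-1) (App_le x))) => t _.
rewrite !indicE !mem_setE /= !in_itv/=.
have [ty|ty] := leP t y; have [tx|tx] := leP t x; rewrite /=; try lra.
Qed.

(** The sets with approximable indicator form a Dynkin system: the whole line since [V] contains the
    constant 1, complements by linearity, disjoint unions by [approximable_bigcup]. Half-open
    intervals are a generating family stable under intersection. *)
Lemma approximable_indic (A : set R) : measurable A -> App (\1_A).
Proof.
move=> mA; apply: (@dynkin_induction _ (measurableTypeR R) (@ocitv R) (fun A => App (\1_A))).
- by [].
- exact: ocitvI.
- move=> e e0; exists (cst 1); split; first by case: linV.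
  have := Lpn_bm p1 abW (bm_cst al be 0); rewrite normr0 mul0r => H.
  apply: Lpn_eq (LpnW (ltW p0) H (ltW e0)) => x _.
  by rewrite indicE mem_set//= subrr.
- by move=> _ [[x y] _ <-]; exact: approximable_oc.
- move=> S mS HS e e0.
  have [g [Vg Hg]] := HS e e0.
  exists (fun x => cst 1 x - g x); split; first by apply: lin_spaceB linV _ Vg; case: linV.
  apply: Lpn_eq (LpnN Hg) => x _.
  by rewrite !indicE in_setC; case: (x \in S) => /=; ring.
- by move=> F mF tF HF; exact: approximable_bigcup.
- exact: mA.
Qed.

(** Simple functions increase to [f], and [f] itself dominates the differences. *)
Lemma approximable_ge0 f e0 : Lpn al be p f e0 -> {in `[al, be], forall x, 0 <= f x} -> App f.
Proof.
move=> Hf f0; apply: approximable_lim => e e_gt0.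
have mf := Lpn_meas Hf.
have mJ : measurable (`[al, be] : set R) by exact: measurable_itv.
have mEf : measurable_fun `[al, be] (EFin \o f) by exact/measurable_EFinP.
pose G := nnsfun_approx mJ mEf.
pose g_ n : R -> R := G n.
have nd : nondecreasing_seq g_ by exact: nd_nnsfun_approx.
have cg x : x \in `[al, be] -> g_ n x @[n --> \oo] --> f x.
  move=> xJ; have f0' : forall x, `[al, be]%classic x -> (0 <= (EFin \o f) x)%E.
    by move=> t tJ; rewrite lee_fin f0.
  by have /fine_cvg := cvg_nnsfun_approx mJ mEf f0' xJ.
have gf n x : x \in `[al, be] -> g_ n x <= f x.
  move=> xJ; have ndx : nondecreasing_seq (fun n => g_ n x).
    by move=> i j ij; have /lefP := nd i j ij; exact.
  have cgx := cg x xJ.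
  have <- : limn (fun n => g_ n x) = f x by apply/cvg_lim.
  by apply: nondecreasing_cvgn_le => //; apply/cvg_ex; exists (f x).
have mg n : measurable_fun `[al, be] (g_ n) by exact: measurable_funTS.
have dom n : {in `[al, be], forall x, `|f x - g_ n x| <= f x}.
  by move=> x xJ; rewrite ger0_norm ?subr_ge0 ?gf// gerBl.
have [n Hn] := Lpn_dct p1 mf mg cg Hf dom e_gt0.
exists (g_ n); split => //.
have [N [c HG]] := nnsfun_indic_sum (G n).
apply: (approximable_eq (f := fun x => \sum_(i < N) c i * \1_(G n @^-1` [set c i]) x)).
  by move=> x _; rewrite /g_ HG.
apply: (@approximable_sum N (fun i x => c i * \1_(G n @^-1` [set c i]) x)) => k _; apply: approximableZ.
apply: approximable_indic; exact: measurable_funPTI.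
Qed.

(** Splitting into the positive part (|f| + f) / 2 and the negative part (|f| - f) / 2. *)
Lemma approximable_Lp f e0 : Lpn al be p f e0 -> App f.
Proof.
move=> Hf; have [mf e00 If] := Hf.
have part g : measurable_fun `[al, be] g -> {in `[al, be], forall x, `|g x| <= `|f x|} -> Lpn al be p g e0.
  move=> mg gf; split; [exact: mg|exact: e00|apply: le_trans If].
  apply: ge0_le_integral; first exact: measurable_itv.
  - by move=> x _; rewrite lee_fin powR_ge0.
  - by apply/measurable_EFinP; exact: powR_meas.
  - by apply/measurable_EFinP; exact: powR_meas.
  - by move=> x /= xJ; rewrite lee_fin ge0_ler_powR ?nnegrE ?(ltW p0)// gf.
have mn : measurable_fun `[al, be] (fun x => `|f x|) by exact: measurableT_comp.
have H1 : App (fun x => (`|f x| + f x) / 2).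
  apply: (@approximable_ge0 _ e0); last first.
    by move=> x _; have := ler_norm (- f x); rewrite normrN; lra.
  apply: part; first by apply: measurable_funM => //; exact: measurable_funD.
  move=> x _; have := ler_norm (- f x); have := ler_norm (f x); rewrite normrN => a1 a2.
  by rewrite ger0_norm; lra.
have H2 : App (fun x => (`|f x| - f x) / 2).
  apply: (@approximable_ge0 _ e0); last first.
    by move=> x _; have := ler_norm (f x); lra.
  apply: part; first by apply: measurable_funM => //; exact: measurable_funB.
  move=> x _; have := ler_norm (- f x); have := ler_norm (f x); rewrite normrN => a1 a2.
  by rewrite ger0_norm; lra.
apply: approximable_eq (approximableD H1 (approximableZ (-1) H2)) => x _; lra.
Qed.

End Closure.

Section Weights.
Variables (al be de M p : R) (w1 w2 : R -> R) (V : (R -> R) -> Prop).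
Hypotheses (ab : al < be) (de0 : 0 < de) (p1 : 1 <= p).
Hypotheses (bw1 : bm al be M w1) (bw2 : bm al be M w2).
Hypotheses (w1de : {in `[al, be], forall x, de <= w1 x}) (w2de : {in `[al, be], forall x, de <= w2 x}).
Hypotheses (linV : lin_space al be V).
Local Notation T := (volterra al w1 w2).
Hypothesis VT : forall f, V f -> V (T f).

(** Tents that fall from 1 to 0 just after [y] approximate the half-line up to [y], and they lie in
    the domain of L, hence are uniform limits of combinations of the [T^k 1]. The space [V] stays
    abstract because the result serves both the span of the formal powers and a dual space for which
    [w1] and [w2] are exchanged. *)
Theorem volterra_dense f e0 : Lpn al be p f e0 -> approximable al be p V f.
Proof.
have abW := ltW ab; have p0 : 0 < p := lt_le_trans ltr01 p1.
have ba0 : 0 <= be - al by rewrite subr_ge0.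
have VTk k : V (iter k T (cst 1)).
  by elim: k => [|k IH] /=; [case: linV|exact: VT].
have bTk k : exists C, bm al be C (iter k T (cst 1)).
  elim: k => [|k [C bC]]; first by exists `|1 : R|; exact: bm_cst.
  exact: (volterra_bm ab bw1 bw2 bC).
have bsum n (c : nat -> R) : exists C, bm al be C (fun x => \sum_(k < n) c k * iter k T (cst 1) x).
  elim: n => [|n [C bC]].
    exists `|0 : R|; by apply: bm_eq (bm_cst al be 0) => x _; rewrite big_ord0.
  have [C' bC'] := bTk n; exists (C + `|c n| * C').
  by apply: bm_eq (bmD bC (bmZ (c n) bC')) => x _; rewrite big_ord_recr.
have App_dom u h : ndom al be w1 w2 u h -> approximable al be p V u.
  move=> du e e_gt0; have [U bu] := ndom_bm ab bw1 bw2 du.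
  pose K := (be - al) `^ p^-1.
  have K0 : 0 <= K by exact: powR_ge0.
  have e1 : 0 < e / (K + 1) by rewrite divr_gt0// ltr_wpDl.
  have [N [c Hc]] := ndom_approx ab de0 bw1 bw2 w1de w2de du e1.
  exists (fun x => \sum_(k < N) c k * iter k T (cst 1) x); split.
    exact: lin_space_sum linV VTk.
  have [C bC] := bsum N c.
  have b : bm al be (e / (K + 1)) (fun x => u x - \sum_(k < N) c k * iter k T (cst 1) x).
    by split => //; have [] := bmB bu bC.
  apply: LpnW (ltW p0) (Lpn_bm p1 abW b) _; rewrite -/K.
  by rewrite mulrAC ler_pdivrMr ?ltr_wpDl// ler_wpM2l ?(ltW e_gt0)// lerDl.
apply: approximable_Lp => // y.
have [by_|yb] := leP be y.
  have [_ _ _ Veq] := linV => e e_gt0; exists (cst 1); split; first by case: linV.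
  have := Lpn_bm p1 abW (bm_cst al be 0); rewrite normr0 mul0r => H.
  apply: Lpn_eq (LpnW (ltW p0) H (ltW e_gt0)) => x; rewrite in_itvE => /andP[_ xb].
  by rewrite indicE mem_set ?subrr//= in_itv/= (le_trans xb).
have [ya|ya] := ltP y al.
  apply: approximable_eq (approximable0 ab p1 linV) => x; rewrite in_itvE => /andP[ax _].
  by rewrite indicE memNset//= in_itv/= => xy; move: (lt_le_trans ya ax); rewrite ltNge xy.
apply: approximable_lim => // e e_gt0.
have ep0 : 0 < e `^ p by rewrite powR_gt0.
(* The error is at most the indicator of [[y, z]], so a fall of length at most e^p keeps its L^p
   norm below [e]. *)
pose z := Num.min be (y + e `^ p).
have yz : y < z by rewrite lt_min yb/= ltrDl.
have zb : z <= be by rewrite ge_min lexx.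
have ze : z <= y + e `^ p by rewrite ge_min lexx orbT.
have [u [h [du u01 uL uR]]] := tent ab de0 bw1 bw2 w1de w2de ya yz zb.
exists u; split; first exact: App_dom du.
have [U [mu_ _]] := ndom_bm ab bw1 bw2 du.
have mi : measurable_fun `[al, be] (\1_(`]-oo, y]%classic) : R -> R) by exact: measurable_indic.
have mg : measurable_fun `[al, be] (fun x => \1_(`]-oo, y]%classic) x - u x) by exact: measurable_funB.
split => //; first exact: ltW.
apply: (@le_trans _ _ (\int[mu]_(x in `[al, be]) (\1_(`[y, z]%classic) x)%:E)%E).
  apply: ge0_le_integral; first exact: measurable_itv.
  - by move=> x _; rewrite lee_fin powR_ge0.
  - by apply/measurable_EFinP; exact: powR_meas.
  - by apply/measurable_EFinP; exact: measurable_indic.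
  - move=> x /= xJ; rewrite lee_fin.
    have [xy|xy] := leP x y.
      have -> : \1_(`]-oo, y]%classic) x = 1 :> R by rewrite indicE mem_set//= in_itv.
      by rewrite uL// subrr normr0 powR0 ?gt_eqF//; exact: indic_ge0.
    have [xz|xz] := leP z x.
      have -> : \1_(`]-oo, y]%classic) x = 0 :> R by rewrite indicE memNset//= in_itv/= leNgt xy.
      by rewrite uR// subrr normr0 powR0 ?gt_eqF//; exact: indic_ge0.
    have -> : \1_(`]-oo, y]%classic) x = 0 :> R by rewrite indicE memNset//= in_itv/= leNgt xy.
    have -> : \1_(`[y, z]%classic) x = 1 :> R by rewrite indicE mem_set//= in_itv/= !ltW.
    have /andP[u0 u1] := u01 x xJ.
    rewrite sub0r normrN ger0_norm//.
    by have := @ge0_ler_powR R p (ltW p0) (u x) 1; rewrite powR1 !nnegrE; apply.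
rewrite integral_indic//; apply: (@le_trans _ _ (mu `[y, z])).
  by apply: le_measure; rewrite ?inE//; exact: measurableI.
have := lebesgue_measure_itv `[y, z]; rewrite /= => ->.
by rewrite lte_fin yz -EFinD lee_fin lerBlDl.
Qed.

End Weights.
End Density.

(** * Sobolev functions as iterated primitives *)

Section SobolevSpace.
Context {R : realType}.
Implicit Types (f g : R -> R).

(* [f] is in W^{m,p}(]al, be[) with norm at most a constant times [e], and it is
   the continuous representative of its class when [m > 0]. *)
Fixpoint Sob al be p m f (e : R) : Prop :=
  match m with
  | 0 => Lpn al be p f e
  | m'.+1 => exists c g, [/\ `|c| <= e, Sob al be p m' g e &
      {in `[al, be], forall x, f x = c + prim al g x}]
  end.

End SobolevSpace.

(** * Embeddings, products and inverses in the Sobolev scale *)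

Section SobolevCalculus.
Context {R : realType}.
Implicit Types (f g h u v w b d : R -> R) (x y z : R).
Variables (al be p : R).
Hypotheses (ab : al < be) (p1 : 1 <= p).
Let abW : al <= be := ltW ab.
Let p0 : 0 < p := lt_le_trans ltr01 p1.
Local Notation Sob := (Sob al be p).

Lemma Sob_ge0 m f e : Sob m f e -> 0 <= e.
Proof.
case: m => [|m] /=; first exact: Lpn_ge0.
by move=> [c [g [ce _ _]]]; exact: le_trans ce.
Qed.

Lemma SobW m f e e' : Sob m f e -> e <= e' -> Sob m f e'.
Proof.
elim: m f => [|m IH] f /=; first by move=> H; exact: LpnW (ltW p0) H.
by move=> [c [g [ce Hg fE]]] ee'; exists c, g; split => //; [exact: le_trans ee'|exact: IH].
Qed.

Lemma Sob_eq m f g e : {in `[al, be], f =1 g} -> Sob m f e -> Sob m g e.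
Proof.
case: m => [|m] /= fg; first exact: Lpn_eq.
by move=> [c [k [ce Hk fE]]]; exists c, k; split => // x xJ; rewrite -(fg x xJ) (fE x xJ).
Qed.

(** An L^1 bound at order m gives a sup bound at order m + 1, which in turn gives an L^1 bound at
    that order. This is the first half of the induction step of [Sob_ibl]. *)
Lemma Sob_bm_subproof m :
  (exists2 K, 0 <= K & forall f e, Sob m f e -> ibl al be f /\ prim al (fun t => `|f t|) be <= K * e) ->
  exists2 K, 0 <= K & forall f e, Sob m.+1 f e -> bm al be (K * e) f.
Proof.
move=> [K K0 HK]; exists (1 + K); first by rewrite addr_ge0.
move=> f e /= [c [g [ce Hg fE]]].
have [ig Ng] := HK _ _ Hg.
apply: (bm_eq (f := fun x => c + prim al g x)); first by move=> x /fE.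
rewrite mulrDl mul1r; apply: bmD; first exact: bmW ce (bm_cst _ _ _).
by apply: bmW (prim_bmx abW ig).
Qed.

Lemma Sob_ibl m : exists2 K, 0 <= K &
  forall f e, Sob m f e -> ibl al be f /\ prim al (fun t => `|f t|) be <= K * e.
Proof.
elim: m => [|m IH]; first exact: Lpn_ibl.
have [K K0 HK] := Sob_bm_subproof IH.
exists (K * (be - al)); first by rewrite mulr_ge0// subr_ge0.
move=> f e /HK bf; split; first exact: bm_ibl bf.
apply: (@le_trans _ _ (prim al (fun=> K * e) be)); last by rewrite prim_cst// mulrAC.
apply: le_prim; [exact: ibl_norm (bm_ibl bf)|exact: cont_ibl (@cst_continuous _ _ _)|exact: bf.2].
Qed.

Lemma Sob_bm m : exists2 K, 0 <= K & forall f e, Sob m.+1 f e -> bm al be (K * e) f.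
Proof. exact: Sob_bm_subproof (Sob_ibl m). Qed.

Lemma Sob_integrable m f e : Sob m f e -> ibl al be f.
Proof. by have [K _ HK] := Sob_ibl m => /HK[]. Qed.

Lemma Sob_cont m f e : Sob m.+1 f e -> {within `[al, be], continuous f}.
Proof.
move=> /= [c [g [_ Hg fE]]].
apply: (@subspace_eq_continuous _ _ _ (fun x => c + prim al g x)).
  by move=> x; rewrite inE => xJ; apply/esym; exact: fE.
by apply: wcD; [exact: wc_cst|apply: prim_cont => //; exact: Sob_integrable Hg].
Qed.

Lemma SobD m f g e e' : Sob m f e -> Sob m g e' -> Sob m (fun x => f x + g x) (e + e').
Proof.
elim: m f g => [|m IH] f g /=; first exact: LpnD.
move=> [c [k [ce Hk fE]]] [c' [k' [ce' Hk' gE]]].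
exists (c + c'), (fun x => k x + k' x); split.
- by apply: le_trans (ler_normD _ _) _; rewrite lerD.
- exact: IH.
- move=> x xJ; rewrite (fE x xJ) (gE x xJ) primD; first by rewrite addrACA.
    by apply: iblS (Sob_integrable Hk) => //; move: xJ; rewrite in_itvE => /andP[].
  by apply: iblS (Sob_integrable Hk') => //; move: xJ; rewrite in_itvE => /andP[].
Qed.

Lemma SobZ m c f e : Sob m f e -> Sob m (fun x => c * f x) (`|c| * e).
Proof.
elim: m f => [|m IH] f /=; first exact: LpnZ.
move=> [c' [k [ce Hk fE]]]; exists (c * c'), (fun x => c * k x); split.
- by rewrite normrM ler_wpM2l.
- exact: IH.
- move=> x xJ; rewrite (fE x xJ) primZ ?mulrDr//.
  by apply: iblS (Sob_integrable Hk) => //; move: xJ; rewrite in_itvE => /andP[].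
Qed.

Lemma SobB m f g e e' : Sob m f e -> Sob m g e' -> Sob m (fun x => f x - g x) (e + e').
Proof.
move=> Hf Hg; have := SobD Hf (SobZ (-1) Hg); rewrite normrN1 mul1r.
by apply: Sob_eq => x _; rewrite mulN1r.
Qed.

Lemma Sob_prim m g e : Sob m g e -> Sob m.+1 (prim al g) e.
Proof.
move=> Hg; exists 0, g; split => //; first by rewrite normr0; exact: Sob_ge0 Hg.
by move=> x _; rewrite add0r.
Qed.

Lemma Sob_cst m c : exists e, Sob m (fun=> c) e.
Proof.
elim: m c => [|m IH] c; first by eexists; exact: Lpn_bm p1 abW (bm_cst al be c).
have [e He] := IH 0; exists (Num.max e `|c|), c, (fun=> 0); split => //.
- by rewrite le_max lexx orbT.
- by apply: SobW He _; rewrite le_max lexx.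
- by move=> x; rewrite in_itvE => /andP[ax _]; rewrite prim_cst// mul0r addr0.
Qed.

Lemma SobS m : exists2 C, 0 <= C & forall f e, Sob m.+1 f e -> Sob m f (C * e).
Proof.
elim: m => [|m [C C0 IH]].
  have [K K0 HK] := Sob_bm 0.
  exists (K * (be - al) `^ p^-1); first by rewrite mulr_ge0// powR_ge0.
  by move=> f e /HK bf; have := Lpn_bm p1 abW bf; rewrite mulrAC.
exists (1 + C); first by rewrite addr_ge0.
move=> f e /= [c [g [ce Hg fE]]]; have e0 : 0 <= e by exact: le_trans ce.
exists c, g; split => //.
- by apply: le_trans ce _; rewrite mulrDl mul1r lerDl mulr_ge0.
- by apply: SobW (IH _ _ Hg) _; rewrite ler_wpM2r// lerDr.
Qed.

Lemma prim_mul_affine c1 g1 c2 g2 f1 f2 : ibl al be g1 -> ibl al be g2 ->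
  {in `[al, be], forall x, f1 x = c1 + prim al g1 x} ->
  {in `[al, be], forall x, f2 x = c2 + prim al g2 x} ->
  {in `[al, be], forall x, f1 x * f2 x = c1 * c2 + prim al (fun t => f2 t * g1 t + f1 t * g2 t) x}.
Proof.
move=> i1 i2 E1 E2 x xJ; move: (xJ); rewrite in_itvE => /andP[ax xb].
have S f : ibl al be f -> ibl al x f by apply: iblS.
rewrite (E1 x xJ) (E2 x xJ).
have -> : prim al (fun t => f2 t * g1 t + f1 t * g2 t) x =
    prim al (fun t => (c2 * g1 t + c1 * g2 t) + (g1 t * prim al g2 t + prim al g1 t * g2 t)) x.
  apply: eq_prim => t; rewrite in_itvE => /andP[t1 t2].
  have tJ : t \in `[al, be] by rewrite in_itvE t1 (le_trans t2).
  by rewrite (E1 t tJ) (E2 t tJ); ring.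
have h1 : ibl al be (fun t => g1 t * prim al g2 t).
  apply: (@ibl_eq _ _ _ (fun t => prim al g2 t * g1 t)); first by move=> t _; rewrite mulrC.
  exact: bm_iblM (prim_bmx abW i2) i1.
have h2 : ibl al be (fun t => prim al g1 t * g2 t) by exact: bm_iblM (prim_bmx abW i1) i2.
rewrite primD; [|by apply: iblD; apply: iblZ; exact: S|by apply: iblD; exact: S].
rewrite primD; [|by apply: iblZ; exact: S|by apply: iblZ; exact: S].
rewrite (primZ _ (S _ i1)) (primZ _ (S _ i2)) -prim_mul//; try exact: S.
by ring.
Qed.

(** The derivative [d gb + b gd] pairs a factor of order m + 1 with one of order m, so the mixed
    product estimate yields the algebra property. In turn [Sob_mul] climbs one order by means of the
    algebra property. *)
Lemma Sob_alg_subproof m :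
  (exists2 C, 0 <= C & forall b d eb ed, Sob m.+1 b eb -> Sob m d ed -> Sob m (fun x => b x * d x) (C * (eb * ed))) ->
  exists2 C, 0 <= C & forall b d eb ed, Sob m.+1 b eb -> Sob m.+1 d ed -> Sob m.+1 (fun x => b x * d x) (C * (eb * ed)).
Proof.
move=> [C C0 HC]; exists (1 + 2 * C); first by rewrite addr_ge0// mulr_ge0.
move=> b d eb ed Hb Hd; have eb0 := Sob_ge0 Hb; have ed0 := Sob_ge0 Hd.
have [cb [gb [cbe Hgb bE]]] := Hb; have [cd [gd [cde Hgd dE]]] := Hd.
exists (cb * cd), (fun t => d t * gb t + b t * gd t); split.
- rewrite normrM; apply: le_trans (ler_pM _ _ cbe cde) _ => //.
  by rewrite ler_peMl ?mulr_ge0// lerDl mulr_ge0.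
- apply: SobW (SobD (HC _ _ _ _ Hd Hgb) (HC _ _ _ _ Hb Hgd)) _.
  rewrite [ed * eb]mulrC -mulrDl ler_wpM2r ?mulr_ge0//; lra.
- exact: prim_mul_affine (Sob_integrable Hgb) (Sob_integrable Hgd) bE dE.
Qed.

Lemma Sob_mul m : exists2 C, 0 <= C &
  forall b d eb ed, Sob m.+1 b eb -> Sob m d ed -> Sob m (fun x => b x * d x) (C * (eb * ed)).
Proof.
elim: m => [|m IH].
  have [K K0 HK] := Sob_bm 0; exists K => // b d eb ed /HK bb Hd.
  by rewrite mulrA; exact: Lpn_bmM p1 abW bb Hd.
have [C C0 HC] := Sob_alg_subproof IH; have [C' C'0 HC'] := SobS m.+1.
exists (C * C'); first exact: mulr_ge0.
move=> b d eb ed /HC' Hb Hd; have := HC _ _ _ _ Hb Hd.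
by rewrite -!mulrA.
Qed.

Lemma Sob_alg m : exists2 C, 0 <= C &
  forall b d eb ed, Sob m.+1 b eb -> Sob m.+1 d ed -> Sob m.+1 (fun x => b x * d x) (C * (eb * ed)).
Proof. exact: Sob_alg_subproof (Sob_mul m). Qed.

(** The derivative of 1/A is -g / A^2. If 1/A is already known at the order of [g], the algebra
    property places this product there too; at the lowest order the boundedness of 1/A is enough. *)
Lemma Sob_inv m A e de : 0 < de -> {in `[al, be], forall x, de <= A x} ->
  Sob m.+1 A e -> exists e', Sob m.+1 (fun x => (A x)^-1) e'.
Proof.
move=> de0 HdA; elim: m e => [|m IH] e HA.
  have [c [g [ce Hg AE]]] := HA.
  have ig := Sob_integrable (m := 0) Hg.
  have [ik AV] := prim_inv abW de0 ig AE HdA.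
  have [M bA] := cont_bm (Sob_cont HA).
  have bAV : bm al be de^-1 (fun t => (A t)^-1).
    split; first by apply: measurable_invr; exact: bA.1.
    move=> x xJ; have dA := HdA _ xJ; have Ap : 0 < A x by exact: lt_le_trans dA.
    by rewrite gtr0_norm ?invr_gt0// lef_pV2.
  have H2 := Lpn_bmM p1 abW (bmN (bmM bAV bAV)) Hg.
  set e2 := _ * e in H2.
  exists (Num.max `|c^-1| e2), c^-1, (fun t => - (g t / A t ^+ 2)); split.
  - by rewrite le_max lexx.
  - apply: Lpn_eq (LpnW (ltW p0) H2 _); last by rewrite le_max lexx orbT.
    by move=> t _; rewrite expr2 invfM; ring.
  - exact: AV.
have [C C0 HC] := SobS m.+1.
have [e' He'] := IH _ (HC _ _ HA).
have [c [g [ce Hg' AE]]] := HA; have Hg : Sob m.+1 g e := Hg'.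
have ig := Sob_integrable Hg.
have [ik AV] := prim_inv abW de0 ig AE HdA.
have [D _ HD] := Sob_alg m.
have H2 := SobZ (-1) (HD _ _ _ _ (HD _ _ _ _ He' He') Hg).
set e2 := _ * _ in H2.
exists (Num.max `|c^-1| e2), c^-1, (fun t => - (g t / A t ^+ 2)); split.
- by rewrite le_max lexx.
- apply: (Sob_eq (m := m.+1) _ (SobW H2 _)); last by rewrite le_max lexx orbT.
  by move=> t _; rewrite expr2 invfM; ring.
- exact: AV.
Qed.

End SobolevCalculus.

(** * Test functions and weak derivatives *)

Section Bump.
Context {R : realType}.
Implicit Types (f g h : R -> R) (x y z c d : R).

(** [Dn n] means n + 1 times differentiable. The derivative is quantified existentially, so that
    closure under sums, products and compositions is an induction that never rewrites [derive1]. *)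
Fixpoint Dn n f : Prop := exists g, (forall x, is_derive x (1 : R) f (g x)) /\
  (if n is n'.+1 then Dn n' g else True).

Definition smooth f := forall n, Dn n f.

Lemma Dn_derive n f : Dn n f -> forall x, derivable f x 1.
Proof. by case: n => [|n] [g [fg _]] x; have [] := fg x. Qed.

Lemma is_derive_derive1 f g : (forall x, is_derive x (1 : R) f (g x)) -> g = derive1 f.
Proof. by move=> fg; apply/funext => x; rewrite derive1E; have [_ ->] := fg x. Qed.

Lemma DnS n f : Dn n.+1 f <-> (forall x, derivable f x 1) /\ Dn n (derive1 f).
Proof.
split=> [[g [fg Hg]]|[df Hf]].
  by split; [move=> x; have [] := fg x|rewrite -(is_derive_derive1 fg)].
exists (derive1 f); split => // x; rewrite derive1E; exact: derivableP.
Qed.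

Lemma Dn_weak n f : Dn n.+1 f -> Dn n f.
Proof.
elim: n f => [|n IH] f [g [fg Hg]]; exists g; split => //; exact: IH.
Qed.

Lemma DnD n f g : Dn n f -> Dn n g -> Dn n (fun x => f x + g x).
Proof.
elim: n f g => [|n IH] f g [f' [ff Hf]] [g' [gg Hg]]; exists (fun x => f' x + g' x); split => //.
- by move=> x; exact: is_deriveD.
- by move=> x; exact: is_deriveD.
- exact: IH.
Qed.

Lemma Dn_cst n c : Dn n (cst c).
Proof.
elim: n c => [|n IH] c; exists (cst 0); split => // x; exact: is_derive_cst.
Qed.

Lemma DnM n f g : Dn n f -> Dn n g -> Dn n (fun x => f x * g x).
Proof.
elim: n f g => [|n IH] f g Hf Hg; have [f' [ff Hf']] := Hf; have [g' [gg Hg']] := Hg;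
  exists (fun x => f x * g' x + g x * f' x); split => //.
- by move=> x; exact: is_deriveM.
- by move=> x; exact: is_deriveM.
- by apply: DnD; apply: IH => //; exact: Dn_weak.
Qed.

Lemma DnZ n c f : Dn n f -> Dn n (fun x => c * f x).
Proof. by move=> Hf; apply: DnM Hf; exact: Dn_cst. Qed.

Lemma Dn_affine n f c d : Dn n f -> Dn n (fun x => f (c * x + d)).
Proof.
elim: n f => [|n IH] f [f' [ff Hf']]; exists (fun x => c * f' (c * x + d)); split => //.
- move=> x; have h : is_derive x (1 : R) (fun x => c * x + d) c.
    apply: (is_derive_eq (f' := c)) => /=; [|exact: erefl].
    rewrite -[X in is_derive _ _ _ X]addr0; apply: is_deriveD.
    by rewrite -[X in is_derive _ _ _ X]mulr1; apply: is_deriveZ.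
  by rewrite mulrC; exact: (@is_derive1_comp _ f (fun x => c * x + d)).
- move=> x; have h : is_derive x (1 : R) (fun x => c * x + d) c.
    rewrite -[X in is_derive _ _ _ X]addr0; apply: is_deriveD.
    by rewrite -[X in is_derive _ _ _ X]mulr1; apply: is_deriveZ.
  by rewrite mulrC; exact: (@is_derive1_comp _ f (fun x => c * x + d)).
- by apply: DnZ; exact: IH.
Qed.

Lemma Dn_exp n f : Dn n f -> Dn n (fun x => expR (f x)).
Proof.
elim: n f => [|n IH] f Hf; have [f' [ff Hf']] := Hf; exists (fun x => expR (f x) * f' x); split => //.
- by move=> x; exact: (@is_derive1_comp _ expR f).
- by move=> x; exact: (@is_derive1_comp _ expR f).
- by apply: DnM => //; apply: IH; exact: Dn_weak.
Qed.

(** The functions x^(-k) exp(-1/x), extended by 0, form a family that differentiation maps into its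
    linear span; the smoothness of exp(-1/x) at 0 thus reduces to a single derivative. *)
Definition flat k x : R := if 0 < x then x^-1 ^+ k * expR (- x^-1) else 0.

Lemma flat_ge0 k x : 0 <= flat k x.
Proof.
rewrite /flat; case: ifPn => // x0; rewrite mulr_ge0 ?expR_ge0// exprn_ge0// invr_ge0.
exact: ltW.
Qed.

(** It follows from exp(t) >= t^(k+1) / (k+1)! at t = 1/x. *)
Lemma flat_le k x : 0 < x -> flat k x <= k.+1`!%:R * x.
Proof.
move=> x0; rewrite /flat x0 expRN.
have xV0 : 0 < x^-1 by rewrite invr_gt0.
rewrite ler_pdivrMr ?expR_gt0//.
have := expR_ge1Dxn k (ltW xV0).
set F : R := k.+1`!%:R; have F0 : 0 < F by rewrite ltr0n fact_gt0.
move=> H; have {}H : x^-1 ^+ k.+1 / F <= expR x^-1 by apply: le_trans H; rewrite lerDr.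
move: H; rewrite ler_pdivrMr// exprS => H.
have := ler_wpM2l (ltW x0) H; rewrite mulVKf ?gt_eqF// => H'.
by apply: le_trans H' _; rewrite mulrCA mulrA mulrC mulrA mulrAC mulrC mulrA mulrAC.
Qed.

(** At 0 the difference quotient of [flat k] is [flat k.+1] on the right and 0 on the left, and
    tends to 0 by [flat_le]. Elsewhere the function is locally 0 or the chain rule applies. *)
Lemma is_derive_flat k x : is_derive x (1 : R) (flat k) (flat k.+2 x - k%:R * flat k.+1 x).
Proof.
have [x0|x0|x0] := ltgtP x 0.
- have -> : flat k.+2 x - k%:R * flat k.+1 x = 0.
    by rewrite /flat !ltNge !(ltW x0)/= mulr0 subr0.
  apply: (@near_eq_is_derive _ _ _ (cst 0)).
  near=> y; rewrite /flat ifF//; apply/negbTE; rewrite -leNgt; apply: ltW.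
  by near: y; exact: lt_nbhsl.
- have -> : flat k.+2 x - k%:R * flat k.+1 x = x^-1 ^+ k.+2 * expR (- x^-1) - k%:R * (x^-1 ^+ k.+1 * expR (- x^-1)).
    by rewrite /flat !x0.
  have x_neq0 : x != 0 by rewrite gt_eqF.
  pose G t : R := t ^+ k * expR (- t).
  apply: (@near_eq_is_derive _ _ _ (G \o (fun y => y^-1))).
    near=> y; rewrite /flat ifT//.
    by near: y; exact: lt_nbhsr.
  have dV : is_derive x (1 : R) (fun y => y^-1) (- x^-1 ^+ 2).
    have := @is_deriveV _ id x 1 1 x_neq0 (is_derive_id _ _).
    by rewrite /= -exprVn => h; apply: (is_derive_eq h); rewrite scaler1.
  have dG : is_derive x^-1 (1 : R) G (x^-1 ^+ k * - expR (- x^-1) + expR (- x^-1) * (k%:R * x^-1 ^+ k.-1)).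
    apply: is_deriveM.
      have := @is_deriveX _ _ id k x^-1 1 1 (is_derive_id _ _).
      by rewrite exprfctE => h; apply: (is_derive_eq h); rewrite /GRing.scale/= mulr1.
    have dN : is_derive x^-1 (1 : R) -%R (-1) by exact: is_deriveNid.
    have := @is_derive1_comp _ expR -%R x^-1 _ _ (is_derive_expR _) dN.
    by rewrite mulrN1 => h; exact: h.
  have := @is_derive1_comp _ G (fun y => y^-1) x _ _ dG dV.
  move=> h; apply: (is_derive_eq h).
  case: k {G dG h} => [|k]; first by rewrite /= !expr0 !expr2; ring.
  by rewrite /= !exprS expr0; ring.
- have -> : flat k.+2 x - k%:R * flat k.+1 x = 0.
    by rewrite /flat x0 ltxx mulr0 subr0.
  rewrite x0.
  have lim0 : (fun s : R => s^-1 *: (flat k (s *: (1 : R) + 0) - flat k 0)) @ 0^' --> (0 : R).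
    have -> : flat k 0 = 0 by rewrite /flat ltxx.
    set F : R := k.+2`!%:R; have F0 : 0 < F by rewrite ltr0n fact_gt0.
    apply/cvgrPdist_lt => e e0; rewrite near_withinE /=.
    near=> h => h0; rewrite sub0r normrN subr0 addr0 /GRing.scale/= mulr1.
    have [hp|hn] := ltP 0 h; last first.
      have -> : flat k h = 0 by rewrite /flat ltNge hn.
      by rewrite mulr0 normr0.
    have -> : h^-1 * flat k h = flat k.+1 h by rewrite /flat hp exprS mulrA.
    rewrite ger0_norm ?flat_ge0//; apply: le_lt_trans (flat_le _ hp) _; rewrite -/F.
    rewrite mulrC -ltr_pdivlMr//.
    by near: h; apply: lt_nbhsl; rewrite divr_gt0.
  apply: DeriveDef; first by apply/cvg_ex; exists 0.
  by apply/cvg_lim => //; exact: Rhausdorff.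
Unshelve. all: by end_near. Qed.

Lemma Dn_flat n k : Dn n (flat k).
Proof.
elim: n k => [|n IH] k; exists (fun x => flat k.+2 x + (- k%:R) * flat k.+1 x); split => //.
- by move=> x; rewrite mulNr; exact: is_derive_flat.
- by move=> x; rewrite mulNr; exact: is_derive_flat.
- by apply: DnD => //; exact: DnZ.
Qed.

(** The arguments are written as [1 * x + (- c)] and [(-1) * x + d] to match [Dn_affine]. *)
Definition bump c d x := flat 0 (1 * x + (- c)) * flat 0 ((-1) * x + d).

Lemma smooth_bump c d : smooth (bump c d).
Proof. by move=> n; apply: DnM; apply: Dn_affine; exact: Dn_flat. Qed.

Lemma bump_ge0 c d x : 0 <= bump c d x.
Proof. by rewrite mulr_ge0// flat_ge0. Qed.

Lemma bump_gt0 c d x : c < x -> x < d -> 0 < bump c d x.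
Proof.
move=> cx xd; rewrite /bump /flat mul1r mulN1r subr_gt0 cx [- x + d]addrC subr_gt0 xd !expr0.
by rewrite mulr_gt0// mul1r expR_gt0.
Qed.

Lemma bump_out c d x : ~~ (c < x < d) -> bump c d x = 0.
Proof.
rewrite negb_and /bump /flat mul1r mulN1r subr_gt0 [- x + d]addrC subr_gt0 => /orP[/negbTE ->|/negbTE ->].
  by rewrite mul0r.
by rewrite mulr0.
Qed.

Lemma smooth_derivable f : smooth f -> forall n x, derivable (derive1n n f) x 1.
Proof.
move=> sf n; move: (sf n.+1); elim: n f {sf} => [|n IH] f Hf x; first exact: Dn_derive Hf x.
by rewrite derive1Sn; apply: IH; have [] := (DnS n.+1 f).1 Hf.
Qed.

Lemma derivable_smooth f : (forall n x, derivable (derive1n n f) x 1) -> smooth f.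
Proof.
move=> H n; elim: n f H => [|n IH] f H.
  by exists (derive1 f); split => // x; rewrite derive1E; apply: derivableP; exact: (H 0%N).
apply/DnS; split; first exact: (H 0%N).
by apply: IH => k x; rewrite -derive1Sn.
Qed.

End Bump.

(** * Test functions on an interval and the fundamental lemma of the calculus of variations *)

Section TestFunctions.
Context {R : realType}.
Local Notation mu := (@lebesgue_measure R).
Implicit Types (f g h psi : R -> R) (x y z c d al be : R).

(** The compact support is replaced by an enclosing interval [[c, d]], to which integrals can be cut
    down. *)
Definition tst al be psi := smooth psi /\ exists c d, [/\ al < c, c <= d, d < be &
  forall x, ~~ (c <= x <= d) -> psi x = 0].

Lemma smooth_cont f : smooth f -> continuous f.
Proof.
move=> sf x; apply: differentiable_continuous; apply/derivable1_diffP.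
exact: (Dn_derive (sf 0%N)).
Qed.

Lemma smooth_derive f : smooth f -> smooth (derive1 f).
Proof. by move=> sf n; have [] := (DnS n f).1 (sf n.+1). Qed.

Lemma tst_derive al be psi : tst al be psi -> tst al be (derive1 psi).
Proof.
move=> [sp [c [d [ac cd db p0]]]]; split; first exact: smooth_derive.
exists c, d; split => // x xcd.
have nr : \forall y \near x, psi y = cst 0 y.
  move: xcd; rewrite negb_and -!ltNge => /orP[xc|dx].
    near=> y; apply: p0; rewrite negb_and -ltNge; apply/orP; left.
    by near: y; exact: lt_nbhsl.
  near=> y; apply: p0; rewrite negb_and -!ltNge; apply/orP; right.
  by near: y; exact: lt_nbhsr.
by rewrite derive1E (near_eq_derive _ nr) derive_cst.
Unshelve. all: by end_near. Qed.

Lemma tst_derive1n al be k psi : tst al be psi -> tst al be (derive1n k psi).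
Proof.
move=> tp; elim: k => [|k IH]; first by [].
by rewrite derive1nS; exact: tst_derive.
Qed.

Lemma tstD al be f g : tst al be f -> tst al be g -> tst al be (fun x => f x + g x).
Proof.
move=> [sf [c [d [ac cd db f0]]]] [sg [c' [d' [ac' cd' db' g0]]]]; split.
  by move=> n; exact: DnD.
exists (Num.min c c'), (Num.max d d'); split.
- by rewrite lt_min ac.
- by rewrite le_max ge_min cd.
- by rewrite gt_max db.
move=> x; rewrite negb_and -!ltNge lt_min gt_max => /orP[/andP[h1 h2]|/andP[h1 h2]].
  by rewrite f0 ?g0 ?addr0// negb_and -ltNge ?h1 ?h2.
by rewrite f0 ?g0 ?addr0// negb_and -!ltNge ?h1 ?h2 orbT.
Qed.

Lemma tstZ al be k f : tst al be f -> tst al be (fun x => k * f x).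
Proof.
move=> [sf [c [d [ac cd db f0]]]]; split; first by move=> n; exact: DnZ.
by exists c, d; split => // x xcd; rewrite f0// mulr0.
Qed.

Lemma prim_derive1 al x f : al <= x -> smooth f -> prim al (derive1 f) x = f x - f al.
Proof.
rewrite le_eqVlt => /predU1P[<-|ax] sf; first by rewrite prim_al subrr.
have cf := smooth_cont sf.
rewrite /prim /Rintegral (@continuous_FTC2 _ (derive1 f) f al x ax) ?EFinB//.
- by apply: continuous_subspaceT; apply: smooth_cont; exact: smooth_derive.
- split.
  + by move=> y _; exact: (Dn_derive (sf 0%N)).
  + by apply: cvg_at_right_filter; exact: cf.
  + by apply: cvg_at_left_filter; exact: cf.
Qed.

Lemma tst_bm al be a b psi : tst al be psi -> exists M, bm a b M psi.
Proof. by move=> [sp _]; apply: cont_bm; apply: continuous_subspaceT; exact: smooth_cont. Qed.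

Lemma tst_le al be x psi : tst al be psi -> x <= al -> psi x = 0.
Proof.
move=> [_ [c [d [ac _ _ p0]]]] xal; apply: p0.
by rewrite negb_and -ltNge (le_lt_trans xal ac).
Qed.

Lemma tst_ge al be x psi : tst al be psi -> be <= x -> psi x = 0.
Proof.
move=> [_ [c [d [_ _ db p0]]]] bx; apply: p0.
by rewrite negb_and -!ltNge (lt_le_trans db bx) orbT.
Qed.

Lemma prim_tst_by_parts al be c g F psi : al <= be -> ibl al be g ->
  {in `[al, be], forall x, F x = c + prim al g x} -> tst al be psi ->
  prim al (fun t => F t * derive1 psi t) be = - prim al (fun t => g t * psi t) be.
Proof.
move=> ab ig FE tp; have [sp _] := tp.
have idp : ibl al be (derive1 psi) by apply: cont_ibl; apply: smooth_cont; exact: smooth_derive.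
have pE : {in `[al, be], forall x, psi x = 0 + prim al (derive1 psi) x}.
  by move=> x; rewrite in_itvE => /andP[ax _]; rewrite add0r prim_derive1// (tst_le tp (lexx al)) subr0.
have [M bp] := tst_bm al be tp.
have ipg : ibl al be (fun t => psi t * g t) by exact: bm_iblM bp ig.
have beJ : be \in `[al, be] by rewrite in_itvE lexx ab.
have iFp : ibl al be (fun t => F t * derive1 psi t).
  have bF : bm al be (`|c| + prim al (fun t => `|g t|) be) F.
    apply: (bm_eq (f := fun x => c + prim al g x)); first by move=> x /FE.
    exact: bmD (bm_cst _ _ c) (prim_bmx ab ig).
  exact: bm_iblM bF idp.
have h1 : ibl al be (fun t => g t * prim al (derive1 psi) t).
  apply: (@ibl_eq _ _ _ (fun t => prim al (derive1 psi) t * g t)); first by move=> t _; rewrite mulrC.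
  exact: bm_iblM (prim_bmx ab idp) ig.
have h2 : ibl al be (fun t => prim al g t * derive1 psi t) by exact: bm_iblM (prim_bmx ab ig) idp.
have H := prim_mul ab ig idp.
have p_be : prim al (derive1 psi) be = 0.
  by rewrite prim_derive1// (tst_le tp (lexx al)) (tst_ge tp (lexx be)) subrr.
move: H; rewrite p_be mulr0 primD// => /esym/eqP; rewrite addrC addr_eq0 => /eqP H.
have E1 : prim al (fun t => F t * derive1 psi t) be = prim al (fun t => c * derive1 psi t + prim al g t * derive1 psi t) be.
  by apply: eq_prim => t tJ; rewrite (FE t tJ) mulrDl.
rewrite E1 primD//; last exact: iblZ.
rewrite primZ// p_be mulr0 add0r H; congr (- _); apply: eq_prim => t tJ.
by rewrite (pE t tJ) add0r.
Qed.

Lemma ae_neq c : {ae mu, forall t, t != c}.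
Proof.
exists [set c]; split => //; first exact: lebesgue_measure_set1.
by move=> t /= /negP; rewrite negbK => /eqP.
Qed.

Lemma Rintegral_supp (A B : set R) f : measurable A -> measurable B ->
  B `<=` A -> (forall x, A x -> ~ B x -> f x = 0) ->
  \int[mu]_(x in A) f x = \int[mu]_(x in B) f x.
Proof.
move=> mA mB BA f0; rewrite -[in RHS](setIidr BA) Rintegral_mkcondr.
apply: eq_Rintegral => x; rewrite inE => Ax; rewrite /patch.
by case: ifPn => //; rewrite notin_setE => nB; exact: f0.
Qed.

Lemma Rintegral_tst (I : set R) al be f psi : measurable I -> `]al, be[%classic `<=` I ->
  tst al be psi -> \int[mu]_(x in I) (f x * psi x) = prim al (fun x => f x * psi x) be.
Proof.
move=> mI sI tp; have [_ [c [d [ac cd db p0]]]] := tp.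
have out (x : R) : ~ `[c, d]%classic x -> f x * psi x = 0.
  by move=> /= /negP; rewrite in_itvE => h; rewrite p0// mulr0.
have sJ : `[c, d]%classic `<=` `]al, be[%classic by apply: subset_itvSoo; rewrite bnd_simp.
rewrite /prim (@Rintegral_supp I `[c, d])//; last 2 first.
- by apply: subset_trans sI.
- by move=> x _; exact: out.
rewrite (@Rintegral_supp `[al, be] `[c, d])//.
- by apply: subset_trans sJ _; exact: subset_itv_oo_cc.
- by move=> x _; exact: out.
Qed.

Lemma prim_tst al be c d f psi : al <= c -> c <= d -> d <= be ->
  (forall x, ~~ (c <= x <= d) -> psi x = 0) ->
  prim al (fun x => f x * psi x) be = prim c (fun x => f x * psi x) d.
Proof.
move=> ac cd db p0; apply: Rintegral_supp => //.
  by apply: subset_itvScc; rewrite bnd_simp.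
by move=> x _ /= /negP; rewrite in_itvE => h; rewrite p0// mulr0.
Qed.

(** The extension of [h] by zero has a primitive that is zero on the whole line, and Lebesgue's
    differentiation theorem recovers [h] almost everywhere. *)
Lemma prim0_ae c d h : c < d -> ibl c d h ->
  (forall x, c < x -> x <= d -> prim c h x = 0) ->
  {ae mu, forall x, x \in `]c, d[ -> h x = 0}.
Proof.
move=> cd ih h0; pose f := h \_ `[c, d].
have mJ : measurable (`[c, d] : set R) by exact: measurable_itv.
have iA (A : set R) : measurable A -> mu.-integrable A (EFin \o f).
  move=> mA; rewrite /f -restrict_EFin; apply/integrable_restrict => //.
  by apply: integrableS ih => //; exact: measurableI.
have lf : locally_integrable setT f by exact: integrable_locally_restrict.
have F0 : (fun x => \int[mu]_(t in [set` Interval (BLeft c) (BRight x)]) f t) = cst 0.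
  have fh x : x <= d -> \int[mu]_(t in `[c, x]) f t = prim c h x.
    move=> xd; apply: eq_Rintegral => t; rewrite inE /= in_itvE => /andP[ct tx].
    by rewrite /f patchE mem_set//= in_itv/= ct (le_trans tx).
  apply/funext => x /=; have [xc|cx] := ltP x c.
    by rewrite set_itv_ge ?Rintegral_set0// bnd_simp -ltNge.
  move: cx; rewrite le_eqVlt => /predU1P[<-|cx]; first by rewrite set_itv1 Rintegral_set1.
  have [xd|dx] := leP x d; first by rewrite fh// h0.
  rewrite (@Rintegral_supp _ `[c, d])//; first by rewrite fh// h0.
    by move=> t /=; rewrite !in_itvE => /andP[-> td]/=; rewrite (le_trans td)// ltW.
  by move=> t _ nt; rewrite /f patchE memNset.
have aeF := FTC1 (f := f) (a := BLeft c) (fun y => iA _ (measurable_itv _)) lf.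
apply: (ae_filterS aeF) => x H; rewrite in_itv/= => /andP[cx xd].
have [|_] := H; first exact: cx.
rewrite F0 derive1_cst /f patchE mem_set//= in_itv/=.
by rewrite !ltW.
Qed.


Lemma ae_bigcap (P : nat -> R -> Prop) : (forall n, {ae mu, forall x, P n x}) ->
  {ae mu, forall x, forall n, P n x}.
Proof.
move=> H; have := negligible_bigcup H; apply: negligibleS => x /= nP.
by move/existsNP : nP => [n nPn]; exists n.
Qed.

(** The test functions 1 - exp(-n bump) converge to the indicator of []c, d[] and stay between 0 and
    1, so dominated convergence makes the integral of [h] over every inner interval vanish; then
    [prim0_ae] applies. As [h] is only locally integrable, the open interval is exhausted by
    countably many inner ones. *)
Lemma fundamental_lemma al be h : al < be ->
  (forall c d, al < c -> d < be -> ibl c d h) ->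
  (forall psi, tst al be psi -> prim al (fun t => h t * psi t) be = 0) ->
  {ae mu, forall x, x \in `]al, be[ -> h x = 0}.
Proof.
move=> ab ih h0.
have hcd c d : al < c -> c < d -> d < be -> prim c h d = 0.
  move=> ac cd db.
  pose psi n x : R := 1 + (-1) * expR (- n%:R * bump c d x).
  have out n x : ~~ (c <= x <= d) -> psi n x = 0.
    move=> xcd; rewrite /psi bump_out ?mulr0 ?expR0 ?mulN1r ?subrr//.
    by apply: contra xcd => /andP[h1 h2]; rewrite !ltW.
  have tp n : tst al be (psi n).
    split; last by exists c, d; split => //; [exact: ltW|exact: out].
    move=> k; apply: DnD; first exact: Dn_cst.
    by apply: DnZ; apply: Dn_exp; apply: DnZ; exact: smooth_bump.
  have p01 n x : `|psi n x| <= 1.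
    have b0 := bump_ge0 c d x.
    have e1 : expR (- n%:R * bump c d x) <= 1 by rewrite expR_le1 mulNr oppr_le0 mulr_ge0.
    have e0 := expR_ge0 (- n%:R * bump c d x).
    by rewrite /psi ger0_norm; lra.
  have lim x : x \in `]c, d[ -> psi n x @[n --> \oo] --> (1 : R).
    rewrite in_itv/= => /andP[cx xd]; have bp := bump_gt0 cx xd.
    rewrite -[X in _ --> X]addr0; apply: cvgD; first exact: cvg_cst.
    rewrite -[X in _ --> X](mulr0 (-1)); apply: cvgM; first exact: cvg_cst.
    apply/cvgrPdist_lt => e e0; exists (Num.bound ((e * bump c d x)^-1)) => // n /= Nn.
    rewrite sub0r normrN ger0_norm ?expR_ge0// mulNr expRN.
    have nb : (e * bump c d x)^-1 < n%:R.
      apply: lt_le_trans (archi_boundP _) _; first by rewrite invr_ge0 mulr_ge0// ltW.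
      by rewrite ler_nat.
    have n0 : 0 < n%:R :> R by apply: le_lt_trans nb; rewrite invr_ge0 mulr_ge0// ltW.
    have g : e^-1 < expR (n%:R * bump c d x).
      apply: lt_le_trans (expR_ge1Dx _); apply: lt_trans (_ : n%:R * bump c d x < _); last by rewrite ltrDr.
      by move: nb; rewrite invfM ltr_pdivrMr.
    by rewrite -[ltRHS]invrK ltf_pV2 ?posrE ?expR_gt0 ?invr_gt0.
  have icd : ibl c d h by exact: ih.
  have mp n : measurable_fun `[c, d] (psi n) by have [M []] := tst_bm c d (tp n).
  have mh := ibl_meas icd.
  have aeN : {ae mu, forall t, t \in `[c, d] -> t \in `]c, d[}.
    apply: (ae_filterS2 (ae_neq c) (ae_neq d)) => t tc td.
    by rewrite !in_itv/= => /andP[h1 h2]; rewrite !lt_neqAle h1 h2 td eq_sym tc.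
  have [] := @dominated_convergence _ _ R mu `[c, d] (measurable_itv _)
    (fun n x => (h x * psi n x)%:E) (EFin \o h) (fun x => `|h x|%:E).
  - by move=> n; apply/measurable_EFinP; exact: (measurable_funM mh (mp n)).
  - exact/measurable_EFinP.
  - apply: (ae_filterS aeN) => x xN xJ.
    apply: cvg_EFin; first by apply: nearW.
    rewrite -[X in _ --> X]mulr1; apply: cvgM; [exact: cvg_cst|exact: lim (xN xJ)].
  - exact: ibl_norm icd.
  - by apply: aeW => x /= n xJ; rewrite lee_fin normrM ler_piMr// p01.
  move=> _ _ H.
  have {}H : prim c (fun x => h x * psi n x) d @[n --> \oo] --> prim c h d.
    apply: fine_cvg; rewrite /prim /Rintegral fineK; first exact: H.
    by apply: integrable_fin_num.
  have z n : prim c (fun x => h x * psi n x) d = 0.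
    by rewrite -(prim_tst h (ltW ac) (ltW cd) (ltW db) (out n)) h0.
  move: H; under eq_fun do rewrite z.
  by move=> H; apply/esym; apply: (cvg_unique _ _ H) => //; exact: cvg_cst.
(* The shift by 3 keeps [r n] at most a third of the length, so that the shrunken interval is never
   empty. *)
pose r n : R := (be - al) / n.+3%:R.
have r0 n : 0 < r n by rewrite divr_gt0 ?subr_gt0.
have r3 n : r n <= (be - al) / 3.
  by rewrite /r ler_wpM2l ?subr_ge0 ?(ltW ab)// lef_pV2 ?posrE// ler_nat.
have aen n : {ae mu, forall x, x \in `]al + r n, be - r n[ -> h x = 0}.
  have h3 := r3 n; have rn := r0 n.
  apply: prim0_ae; [lra|by apply: ih; lra|move=> x cx xd].
  by apply: hcd => //; lra.
apply: (ae_filterS (ae_bigcap aen)) => x H; rewrite in_itv/= => /andP[ax xb].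
have m0 : 0 < Num.min (x - al) (be - x) by rewrite lt_min !subr_gt0 ax.
pose n := Num.bound ((be - al) / Num.min (x - al) (be - x)).
have rn : r n < Num.min (x - al) (be - x).
  rewrite /r ltr_pdivrMr// mulrC -ltr_pdivrMr//.
  apply: lt_le_trans (archi_boundP _) _; first by rewrite divr_ge0 ?(ltW m0)// subr_ge0 ltW.
  by rewrite ler_nat -/n; apply: leq_trans (leqnSn _) _; apply: leq_trans (leqnSn _) _.
move: rn; rewrite lt_min => /andP[h1 h2].
by apply: (H n); rewrite in_itv/=; apply/andP; split; lra.
Qed.

End TestFunctions.

(** * Functions with vanishing weak derivative *)

Section DuBoisReymond.
Context {R : realType}.
Local Notation mu := (@lebesgue_measure R).
Implicit Types (f g h psi : R -> R) (x y z c d al be : R).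

(** The candidate is the integral from minus infinity, which is differentiable on the whole line; it
    vanishes to the right of the support because [chi] has mass 0. *)
Lemma tst_antiderivative al be chi : tst al be chi -> prim al chi be = 0 ->
  exists psi, tst al be psi /\ derive1 psi = chi.
Proof.
move=> tc c0; have [sc [c [d [ac cd db p0]]]] := tc.
have ab : al <= be by rewrite (le_trans (ltW ac))// (le_trans cd)// ltW.
have cE : chi = chi \_ `[al, be].
  apply/funext => x; rewrite /patch; case: ifPn => //; rewrite notin_setE/= => /negP.
  rewrite in_itvE => h; apply: p0; apply: contra h => /andP[h1 h2].
  by rewrite (le_trans (ltW ac))//= (le_trans h2)// ltW.
have iA (A : set R) : measurable A -> mu.-integrable A (EFin \o chi).
  move=> mA; rewrite cE -restrict_EFin; apply/integrable_restrict => //.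
  have ij : ibl al be chi by apply: cont_ibl; exact: smooth_cont.
  by apply: integrableS ij => //; exact: measurableI.
have cchi : continuous chi := smooth_cont sc.
pose psi x := \int[mu]_(t in [set` Interval (BInfty _ true) (BRight x)]) chi t.
have D x : derivable psi x 1 /\ derive1 psi x = chi x.
  apply: (@continuous_FTC1 _ chi (BInfty _ true) x (x + 1)) => //.
  - by rewrite ltrDl.
  - by apply: iA; exact: measurable_itv.
  - exact: ltNyr.
  - exact: cchi.
have dE : derive1 psi = chi by apply/funext => x; have [] := D x.
have isd x : is_derive x (1 : R) psi (chi x).
  by have [d1 <-] := D x; rewrite derive1E; apply: derivableP.
exists psi; split; last exact: dE.
split.
  by case=> [|n]; exists chi; split; [exact: isd|exact: I|exact: isd|exact: sc].
exists c, d; split => // x; rewrite negb_and -!ltNge => /orP[xc|dx].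
  rewrite /psi (@eq_Rintegral _ _ _ mu _ (cst 0)).
    by rewrite Rintegral_cst ?mul0r.
  move=> t; rewrite inE/= in_itv/= => tx; apply: p0.
  by rewrite negb_and -ltNge (le_lt_trans tx xc).
rewrite /psi (@Rintegral_supp _ _ `[c, d])//=.
- rewrite -c0 /prim (@Rintegral_supp _ _ `[c, d])//=.
    by apply: subset_itvScc; rewrite bnd_simp ltW.
  by move=> t _ /negP; rewrite in_itvE; exact: p0.
- by move=> t /=; rewrite !in_itv/= => /andP[_ td]; rewrite (le_trans td)// ltW.
- by move=> t _ /negP; rewrite in_itvE; exact: p0.
Qed.

(** Fix a bump [rho] of mass [S]. For a test function [psi] of mass [s], psi - (s / S) rho has mass
    0 and is the derivative of a test function. Testing [f] against it shows that [f - k] is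
    orthogonal to [psi], where [k] is the average of [f] with weight [rho]. *)
Lemma du_bois_reymond al be f : al < be -> ibl al be f ->
  (forall psi, tst al be psi -> prim al (fun t => f t * derive1 psi t) be = 0) ->
  exists k, {ae mu, forall x, x \in `]al, be[ -> f x = k}.
Proof.
move=> ab jf H; have abW := ltW ab.
pose c := al + (be - al) / 3; pose d := al + 2 * (be - al) / 3.
have [ac cd db] : [/\ al < c, c < d & d < be] by rewrite /c /d; split; lra.
pose rho := bump c d.
have sr : smooth rho by exact: smooth_bump.
have trho : tst al be rho.
  split => //; exists c, d; split => //; first exact: ltW.
  move=> x h; apply: bump_out; apply: contra h => /andP[h1 h2].
  by rewrite !ltW.
have ip psi a b : smooth psi -> ibl a b psi by move=> sp; apply: cont_ibl; exact: smooth_cont.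
pose S := prim al rho be.
have S0 : 0 < S.
  (* The mass of [rho] is bounded below on the middle third of [[c, d]], where its minimum is
     positive. *)
  pose c' := c + (d - c) / 3; pose d' := c + 2 * (d - c) / 3.
  have [cc' cd' dd'] : [/\ c < c', c' < d' & d' < d] by rewrite /c' /d'; split; lra.
  have [y yJ miny] := EVT_min (ltW cd') (continuous_subspaceT (smooth_cont sr)).
  have y0 : 0 < rho y.
    by move: yJ; rewrite in_itvE => /andP[h1 h2]; apply: bump_gt0; lra.
  have [a1 a2] : al <= c' /\ d' <= be by split; lra.
  rewrite /S (@prim_split _ _ _ c' be) ?ip//; last by lra.
  rewrite (@prim_split _ c' _ d' be) ?ip// ?(ltW cd')//.
  have h1 : 0 <= prim al rho c' by apply: prim_ge0 => t _; exact: bump_ge0.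
  have h2 : 0 <= prim d' rho be by apply: prim_ge0 => t _; exact: bump_ge0.
  have h3 : rho y * (d' - c') <= prim c' rho d'.
    rewrite -(prim_cst _ (ltW cd')); apply: le_prim => //; try exact: ip.
    by apply: cont_ibl; exact: cst_continuous.
  have h4 : 0 < rho y * (d' - c') by rewrite mulr_gt0// subr_gt0.
  by move: h1 h2 h3 h4; set u1 := prim _ _ _; set u2 := prim _ _ _; set u3 := prim _ _ _; lra.
have ifp psi : tst al be psi -> ibl al be (fun t => f t * psi t).
  move=> tp; have [M bp] := tst_bm al be tp.
  by apply: (@ibl_eq _ _ _ (fun t => psi t * f t)); [move=> t _; rewrite mulrC|exact: bm_iblM bp jf].
pose k := prim al (fun t => f t * rho t) be / S.
exists k.
suff : {ae mu, forall x, x \in `]al, be[ -> f x - k = 0}.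
  move=> Hk; apply: (ae_filterS Hk) => x + xJ.
  by move=> /(_ xJ)/eqP; rewrite subr_eq0 => /eqP.
apply: (@fundamental_lemma _ al be (fun x => f x - k)) => //.
  move=> c1 d1 ac1 db1; apply: iblB; first by apply: iblS jf; exact: ltW.
  by apply: cont_ibl; exact: cst_continuous.
move=> psi tp; have [sp _] := tp.
pose s := prim al psi be.
have tchi : tst al be (fun x => psi x + (- (s / S)) * rho x) by apply: tstD => //; exact: tstZ.
have [|Psi [tPsi PE]] := tst_antiderivative tchi.
  rewrite primD; [|exact: ip|by apply: iblZ; exact: ip].
  rewrite primZ; last exact: ip.
  by rewrite -/s -/S mulNr divfK ?gt_eqF// subrr.
have := H _ tPsi; rewrite PE.
rewrite (@eq_prim _ _ _ (fun t => f t * psi t + (- (s / S)) * (f t * rho t))); last by move=> t _; ring.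
rewrite primD; [|exact: ifp|by apply: iblZ; exact: ifp].
rewrite primZ; last exact: ifp.
move=> /eqP E.
rewrite (@eq_prim _ _ _ (fun t => f t * psi t + (- k) * psi t)); last by move=> t _; ring.
rewrite primD; [|exact: ifp|by apply: iblZ; exact: ip].
rewrite primZ; last exact: ip.
apply/eqP; move: E; rewrite !mulNr -/s.
by rewrite /k [_ / S * s]mulrAC [X in _ - X]mulrC mulrA.
Qed.

End DuBoisReymond.

(** * Sobolev classes and iterated primitives *)

Section WeakDerivatives.
Context {R : realType}.
Local Notation mu := (@lebesgue_measure R).
Implicit Types (f g h F G psi : R -> R) (x y z c d al be : R).

Lemma ae_oo_cc al be (P : R -> Prop) : {ae mu, forall x, x \in `]al, be[ -> P x} ->
  {ae mu, forall x, x \in `[al, be] -> P x}.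
Proof.
move=> H; apply: (ae_filterS3 H (ae_neq al) (ae_neq be)).
move=> t + ta tb; rewrite !in_itv/= => Ht /andP[h1 h2]; apply: Ht.
by rewrite !lt_neqAle h1 h2 tb eq_sym ta.
Qed.

Lemma measurable_fun_oo_cc al be f : measurable_fun `]al, be[ f -> measurable_fun `[al, be] f.
Proof. exact: measurable_fun_itv_cc. Qed.

Section Fixed.
Variables (I : set R) (al be p : R).
Hypotheses (itvI : is_interval I) (ab : al < be) (p1 : 1 <= p).
Hypotheses (sI1 : `]al, be[%classic `<=` I) (sI2 : I `<=` `[al, be]%classic).
Hypothesis (intI : I° = `]al, be[%classic).
Let abW : al <= be := ltW ab.
Let p0 : 0 < p := lt_le_trans ltr01 p1.
Let mI : measurable I. Proof. exact: is_interval_measurable. Qed.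

(** The extreme points of a nonempty compact support provide [c] and [d]; an empty support is
    enclosed in the degenerate interval at the midpoint. *)
Lemma test_functionP psi : test_function I psi <-> tst al be psi.
Proof.
split=> [[sp [K [cK sK pK]]]|[sp [c [d [ac cd db p0']]]]].
  have [m1 m2] : al < (al + be) / 2 /\ (al + be) / 2 < be by split; rewrite midf_lt.
  split; first exact: derivable_smooth.
  have [K0|/nonemptyPn K0] := pselect (K !=set0); last first.
    exists ((al + be) / 2), ((al + be) / 2); split => //.
    by move=> x _; apply: pK; rewrite K0.
  have cid : {within K, continuous (fun x : R => x)} by apply: continuous_subspaceT => x; exact: cvg_id.
  have [d dK dmax] := compact_EVT_max K0 cK cid.
  have [c cK' cmin] := compact_EVT_min K0 cK cid.
  rewrite !inE in dK cK'.
  have := sK _ dK; have := sK _ cK'; rewrite intI /= !in_itv/= => /andP[ac _] /andP[_ db].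
  exists c, d; split => //; first by apply: dmax; rewrite inE.
  move=> x xcd; apply: pK => xK; move: xcd; rewrite negb_and.
  by rewrite cmin ?dmax ?inE.
split; first exact: smooth_derivable.
exists `[c, d]%classic; split.
- exact: segment_compact.
- by rewrite intI; apply: subset_itvSoo; rewrite bnd_simp.
- by move=> x /= /negP; rewrite in_itvE; exact: p0'.
Qed.

Lemma integral_IJ (f : R -> \bar R) : measurable_fun `[al, be] f -> (forall x, (0 <= f x)%E) ->
  (\int[mu]_(x in I) f x = \int[mu]_(x in `[al, be]) f x)%E.
Proof.
move=> mf f0; apply/eqP; rewrite eq_le; apply/andP; split.
  by apply: ge0_subset_integral.
rewrite -integral_itv_bndo_bndc; last first.
  by apply: measurable_funS mf => //; apply: subset_itvl; rewrite bnd_simp.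
rewrite -integral_itv_obnd_cbnd; last first.
  by apply: measurable_funS mf => //; apply: subset_itvW; rewrite ?bnd_simp.
by apply: ge0_subset_integral => //; apply: measurable_funS mf.
Qed.

Lemma Lp_norm_IJ f : measurable_fun `[al, be] f ->
  Lp_norm I p%:E f = Lp_norm `[al, be] p%:E f.
Proof.
move=> mf; rewrite !Lp_normE//; congr (poweR _ _); apply: integral_IJ.
  by apply/measurable_EFinP; exact: powR_meas.
by move=> x; rewrite lee_fin powR_ge0.
Qed.

Lemma Lp_on_meas q f : Lp_on I q f -> measurable_fun `[al, be] f.
Proof.
rewrite /Lp_on inE => /andP[]; rewrite inE/= => mf _.
apply: measurable_fun_oo_cc; apply: measurable_funS sI1 _ => //.
by apply/(measurable_restrictT _ _).2.
Qed.

Lemma Lp_on_Lpn f : Lp_on I p%:E f -> exists e, Lpn al be p f e.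
Proof.
move=> Hf; have mf := Lp_on_meas Hf.
move: Hf; rewrite /Lp_on inE => /andP[_]; rewrite inE/= /finite_norm -/(Lp_norm I p%:E f).
rewrite Lp_norm_IJ// => fin.
have n0 : (0 <= Lp_norm `[al, be] p%:E f)%E by exact: Lnorm_ge0.
exists (fine (Lp_norm `[al, be] p%:E f)); apply/LpnP => //; first by rewrite fine_ge0.
rewrite fineK ?ge0_fin_numE//; split => //.
rewrite /Lp_on inE; apply/andP; split; rewrite inE/=; last exact: fin.
by apply/(measurable_restrictT _ _).1.
Qed.

Lemma Lpn_Lp_on f e : Lpn al be p f e -> Lp_on I p%:E f /\ (Lp_norm I p%:E f <= e%:E)%E.
Proof.
move=> Hf; have mf := Lpn_meas Hf; have e0 := Lpn_ge0 Hf.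
have /(LpnP _ _ _ p1 e0)[_ H2] := Hf.
rewrite Lp_norm_IJ//; split => //.
rewrite /Lp_on inE; apply/andP; split; rewrite inE/=.
  by apply/(measurable_restrictT _ _).1 => //; apply: measurable_funS mf.
rewrite /finite_norm -/(Lp_norm I p%:E f) Lp_norm_IJ//.
by apply: le_lt_trans H2 _; rewrite ltry.
Qed.

Lemma loc_ibl f c d : locally_integrable I° f -> al < c -> d < be -> ibl c d f.
Proof.
rewrite intI => -[mf _ H] ac db.
have sub : `[c, d]%classic `<=` `]al, be[%classic by apply: subset_itvSoo; rewrite bnd_simp.
apply/integrableP; split; first by apply/measurable_EFinP; apply: measurable_funS mf.
by apply: H => //; exact: segment_compact.
Qed.

Lemma loc_meas f : locally_integrable I° f -> measurable_fun `[al, be] f.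
Proof. by rewrite intI => -[mf _ _]; exact: measurable_fun_oo_cc. Qed.

Lemma ibl_loc f : ibl al be f -> locally_integrable I° f.
Proof.
move=> jf; rewrite intI; apply: open_integrable_locally; first exact: interval_open.
by apply: integrableS jf => //; exact: subset_itv_oo_cc.
Qed.

Lemma is_weak_derivP k f g : is_weak_deriv I k f g <->
  [/\ locally_integrable I° f, locally_integrable I° g & forall psi, tst al be psi ->
    prim al (fun x => f x * derive1n k psi x) be = (-1) ^+ k * prim al (fun x => g x * psi x) be].
Proof.
have E psi : tst al be psi ->
  (\int[mu]_(x in I) (f x * derive1n k psi x) = prim al (fun x => f x * derive1n k psi x) be) *
  (\int[mu]_(x in I) (g x * psi x) = prim al (fun x => g x * psi x) be).
  move=> tp; split; apply: Rintegral_tst => //; exact: tst_derive1n.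
split => -[lf lg H]; split => // psi tp.
  by rewrite -!E// H//; apply/test_functionP.
by have {}tp := (test_functionP psi).1 tp; rewrite !E// H.
Qed.

Lemma weak_deriv_unique k f g g' : is_weak_deriv I k f g -> is_weak_deriv I k f g' ->
  {ae mu, forall x, x \in `[al, be] -> g x = g' x}.
Proof.
move=> /is_weak_derivP[_ lg Hg] /is_weak_derivP[_ lg' Hg'].
have H : {ae mu, forall x, x \in `]al, be[ -> g x - g' x = 0}.
  apply: (@fundamental_lemma _ al be (fun x => g x - g' x)) => //.
    by move=> c d ac db; apply: iblB; exact: loc_ibl.
  move=> psi tp; have [_ [c [d [ac cd db p0']]]] := tp.
  have [M bp] := tst_bm c d tp.
  have ip h : locally_integrable I° h -> ibl c d (fun x => h x * psi x).
    move=> lh; apply: (@ibl_eq _ _ _ (fun t => psi t * h t)); first by move=> t _; rewrite mulrC.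
    by apply: bm_iblM bp _; exact: loc_ibl.
  have : (-1) ^+ k * prim al (fun x => g x * psi x) be = (-1) ^+ k * prim al (fun x => g' x * psi x) be.
    by rewrite -Hg// -Hg'.
  have s0 : (-1) ^+ k != 0 :> R by rewrite expf_neq0// oppr_eq0 oner_eq0.
  move/(mulfI s0).
  rewrite !(prim_tst _ (ltW ac) cd (ltW db) p0') => E.
  rewrite (@eq_prim _ _ _ (fun x => g x * psi x - g' x * psi x)); last by move=> t _; rewrite mulrBl.
  by rewrite primB ?ip// E subrr.
apply: ae_oo_cc; apply: (ae_filterS H) => x + xJ.
by move=> /(_ xJ)/eqP; rewrite subr_eq0 => /eqP.
Qed.

(** Integration by parts makes the weak derivative of order k + 1 of [F] that of order k of its
    density [g], while order 0 descends through [SobS]. The constant adds up the two routes. *)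
Lemma Sob_weak m : exists2 C, 0 <= C & forall F e, Sob al be p m F e -> forall k, (k <= m)%N ->
  exists G, Lpn al be p G (C * e) /\ forall psi, tst al be psi ->
    prim al (fun x => F x * derive1n k psi x) be = (-1) ^+ k * prim al (fun x => G x * psi x) be.
Proof.
elim: m => [|m [C C0 IH]].
  exists 1 => // F e HF k; rewrite leqn0 => /eqP ->; exists F; rewrite mul1r; split => // psi _.
  by rewrite expr0 mul1r.
have [C' C'0 HC'] := SobS ab p1 m.
exists (C * C' + C); first by rewrite addr_ge0// mulr_ge0.
move=> F e HF k; have e0 := Sob_ge0 HF.
have p0W := ltW p0.
case: k => [_|k km].
  have [G [HG GE]] := IH _ _ (HC' _ _ HF) 0%N isT.
  exists G; split => //; apply: LpnW p0W HG _.
  by rewrite mulrA ler_wpM2r// lerDl.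
have [c [g [ce Hg FE]]] := HF.
have [G [HG GE]] := IH _ _ Hg k km.
exists G; split; first by apply: LpnW p0W HG _; rewrite ler_wpM2r// lerDr mulr_ge0.
move=> psi tp; rewrite derive1nS.
rewrite (prim_tst_by_parts abW (Sob_integrable ab p1 Hg) FE (tst_derive1n k tp)).
by rewrite GE// exprS mulN1r mulNr.
Qed.

Lemma prim_ae_tst f F psi : measurable_fun `[al, be] f -> measurable_fun `[al, be] F ->
  {ae mu, forall x, x \in `[al, be] -> f x = F x} -> tst al be psi ->
  prim al (fun x => f x * psi x) be = prim al (fun x => F x * psi x) be.
Proof.
move=> mf mF fF tp; have [M [mp _]] := tst_bm al be tp.
apply: (prim_ae (lexx be)); [exact: measurable_funM|exact: measurable_funM|].
by apply: (ae_filterS fF) => x H xJ; rewrite H.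
Qed.

Lemma ibl_ae f F : measurable_fun `[al, be] f -> ibl al be F ->
  {ae mu, forall x, x \in `[al, be] -> f x = F x} -> ibl al be f.
Proof.
move=> mf jF fF; have mF := ibl_meas jF; move: jF => /integrableP[_ fin].
apply/integrableP; split; first exact/measurable_EFinP.
rewrite (_ : integral _ _ _ = (\int[mu]_(x in `[al, be]) `|(EFin \o F) x|)%E)//.
apply: ae_eq_integral.
- exact: measurable_itv.
- by apply: measurableT_comp => //; exact/measurable_EFinP.
- by apply: measurableT_comp => //; exact/measurable_EFinP.
- by apply: (ae_filterS fF) => x /= H xJ; rewrite H.
Qed.

(** [Sobolev_norm] involves weak derivatives picked by choice, so the bound is carried over from
    explicit ones by uniqueness up to null sets. The function [f] is distinguished from [F] because
    elements of [Sobolev] are arbitrary representatives. *)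
Lemma Sob_Sobolev m : exists2 C, 0 <= C & forall F f e, Sob al be p m F e ->
  measurable_fun `[al, be] f -> {ae mu, forall x, x \in `[al, be] -> f x = F x} ->
  Sobolev I m p f /\ (Sobolev_norm I m p f <= (C * e)%:E)%E.
Proof.
have [C C0 HC] := Sob_weak m.
have [K _ HK] := Sob_ibl ab p1 m.
exists (m.+1%:R * C); first by rewrite mulr_ge0.
move=> F f e HF mf fF.
have [jF _] := HK _ _ HF; have mF := ibl_meas jF.
have jf := ibl_ae mf jF fF.
have W k : (k <= m)%N -> exists G, Lpn al be p G (C * e) /\ is_weak_deriv I k f G.
  move=> km; have [G [HG GE]] := HC _ _ HF k km; exists G; split => //.
  apply/is_weak_derivP; split.
  - exact: ibl_loc.
  - by have [K' _ HK'] := Lpn_ibl p1 abW; apply: ibl_loc; have [] := HK' _ _ HG.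
  - by move=> psi tp; rewrite -GE//; apply: prim_ae_tst => //; exact: tst_derive1n.
split.
  have W' k : (k <= m)%N -> exists g, Lp_on I p%:E g /\ is_weak_deriv I k f g.
    by move=> km; have [G [/Lpn_Lp_on[HG _] wG]] := W k km; exists G.
  split => //; have [G [HG wG]] := W 0%N isT.
  have w0 : is_weak_deriv I 0 f f.
    apply/is_weak_derivP; split; [exact: ibl_loc|exact: ibl_loc|].
    by move=> psi _; rewrite expr0 mul1r.
  have GF := weak_deriv_unique wG w0.
  by have [] := Lpn_Lp_on (Lpn_ae mf GF HG).
rewrite /Sobolev_norm.
apply: (@le_trans _ _ (\sum_(k < m.+1) (C * e)%:E)%E); last first.
  by rewrite sumEFin lee_fin sumr_const card_ord -[leLHS]mulr_natl mulrA.
apply: lee_sum => k _; have km : (k <= m)%N by rewrite -ltnS.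
have [G [HG wG]] := W k km.
have wd : is_weak_deriv I k f (weak_deriv I k f) by apply: (@xgetPex _ (cst 0) [set g | is_weak_deriv I k f g]); exists G.
have ae := weak_deriv_unique wG wd.
have mw : measurable_fun `[al, be] (weak_deriv I k f) by case: wd => _ + _; exact: loc_meas.
by have [] := Lpn_Lp_on (Lpn_ae mw ae HG).
Qed.

(** By induction the first weak derivative has a representative [G] that is an iterated primitive.
    Then [f - prim al G] has zero weak derivative and is constant by [du_bois_reymond]. *)
Lemma Sobolev_Sob m f : Sobolev I m p f -> exists F e, Sob al be p m F e /\
  {ae mu, forall x, x \in `[al, be] -> f x = F x}.
Proof.
elim: m f => [|m IH] f [Lf Wf].
  have [e He] := Lp_on_Lpn Lf; exists f, e; split => //.
  by apply: aeW.
have [g [Lg wg]] := Wf 1%N isT.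
have Sg : Sobolev I m p g.
  split => // k km; have [h [Lh wh]] := Wf k.+1 km; exists h; split => //.
  move: wg wh => /is_weak_derivP[lf lg Hg] /is_weak_derivP[_ lh Hh].
  apply/is_weak_derivP; split => // psi tp.
  have := Hg _ (tst_derive1n k tp); rewrite derive1n1 -derive1nS Hh// expr1 exprS mulN1r !mulNr mul1r.
  by move/oppr_inj.
have [G [e [HG gG]]] := IH _ Sg.
have jG := Sob_integrable ab p1 HG; have mG := ibl_meas jG.
have [K _ HK] := Lpn_ibl p1 abW; have [e1 He1] := Lp_on_Lpn Lf; have [jf _] := HK _ _ He1.
have mf := ibl_meas jf; have mg := Lp_on_meas Lg.
have jP : ibl al be (prim al G) by exact: bm_ibl (prim_bmx abW jG).
have [|psi tp|c fc] := @du_bois_reymond _ al be (fun x => f x - prim al G x) ab.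
- exact: iblB.
- have [_ _ Hg] := (is_weak_derivP 1 f g).1 wg.
  have E1 := Hg _ tp; rewrite derive1n1 expr1 mulN1r in E1.
  have GE : {in `[al, be], forall x, prim al G x = 0 + prim al G x} by move=> x _; rewrite add0r.
  have E2 := prim_tst_by_parts abW jG GE tp.
  have [M bp'] := tst_bm al be (tst_derive tp).
  have ip h : ibl al be h -> ibl al be (fun x => h x * derive1 psi x).
    move=> jh; apply: (@ibl_eq _ _ _ (fun t => derive1 psi t * h t)); first by move=> t _; rewrite mulrC.
    exact: bm_iblM bp' jh.
  rewrite (@eq_prim _ _ _ (fun x => f x * derive1 psi x - prim al G x * derive1 psi x)); last by move=> t _; rewrite mulrBl.
  by rewrite primB ?ip// E1 E2 opprK (prim_ae_tst mg mG gG tp) addrC subrr.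
exists (fun x => c + prim al G x), (Num.max e `|c|); split.
  have HG' : Sob al be p m G (Num.max e `|c|) by apply: (SobW p1 HG); rewrite le_max lexx.
  by exists c, G; split => //; rewrite le_max lexx orbT.
apply: ae_oo_cc; apply: (ae_filterS fc) => x H xJ.
by rewrite -(H xJ) subrK.
Qed.

End Fixed.
End WeakDerivatives.

(** * Density in Sobolev spaces *)

Section SobolevDensity.
Context {R : realType}.
Implicit Types (f g h F G psi phi : R -> R) (x y z c d : R).
Variables (al be de M p : R) (w1 w2 : R -> R) (V : (R -> R) -> Prop).
Hypotheses (ab : al < be) (de0 : 0 < de) (p1 : 1 <= p).
Hypotheses (bw1 : bm al be M w1) (bw2 : bm al be M w2).
Hypotheses (w1de : {in `[al, be], forall x, de <= w1 x}) (w2de : {in `[al, be], forall x, de <= w2 x}).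
Hypothesis w12 : {in `[al, be], forall x, w1 x * w2 x = 1}.
Let abW : al <= be := ltW ab.
Let p0 : 0 < p := lt_le_trans ltr01 p1.
Local Notation Sob := (Sob al be p).
Local Notation T := (volterra al w1 w2).

Lemma wprim_Sob m w : (exists e, Sob m w e) -> forall h, (exists e, Sob m.+1 h e) ->
  exists e, Sob m.+1 (wprim al w h) e.
Proof.
move=> [ew Hw] h [eh Hh]; have [C _ HC] := Sob_mul ab p1 m.
have H := Sob_prim (HC _ _ _ _ Hh Hw); eexists.
by apply: Sob_eq H => x xJ; rewrite /wprim; apply: eq_prim => t _; rewrite mulrC.
Qed.

Lemma volterra_Sob m h : (exists e, Sob m w1 e) -> (exists e, Sob m w2 e) ->
  (exists e, Sob m.+1 h e) -> exists e, Sob m.+1 (T h) e.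
Proof. by move=> H1 H2 Hh; apply: wprim_Sob => //; exact: wprim_Sob. Qed.

Hypothesis linV : lin_space al be V.
Hypothesis Vphi1 : V (prim al w1).
Hypothesis VT : forall f, V f -> V (T f).

Let sob_dense m := forall F e0, Sob m F e0 -> forall e : R, 0 < e ->
  exists phi, V phi /\ Sob m (fun x => F x - phi x) e.

Lemma sob_dense0 : sob_dense 0.
Proof.
move=> F e0 HF e e_gt0.
exact: (volterra_dense ab de0 p1 bw1 bw2 w1de w2de linV VT HF).
Qed.

Lemma sob_dense1 : sob_dense 1.
Proof.
move=> F e0 [c [g [ce Hg FE]]] e e_gt0; have [V1 VD VZ Veq] := linV.
have M0 : 0 <= M by apply: le_trans (bw1.2 al _); rewrite ?in_itvE ?lexx.
(* The dual space: [wprim al w1] sends [volterra al w2 w1 psi] to [T (wprim al w1 psi)], which makes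
   [V'] stable under the dual operator, and [V'] contains 1 because [V] contains [prim al w1].
   Boundedness is recorded for the linearity of [wprim]. *)
pose V' psi := V (wprim al w1 psi) /\ exists C, bm al be C psi.
have linV' : lin_space al be V'.
  split.
  - split; last by exists `|1 : R|; exact: bm_cst.
    by apply: Veq Vphi1 => x _; apply: eq_prim => t _; rewrite mulr1.
  - move=> f k [Vf [C bf]] [Vk [C' bk]]; split; last by exists (C + C'); exact: bmD.
    by apply: Veq (VD _ _ Vf Vk) => x xJ; rewrite (wprimD bw1 bf bk).
  - move=> s f [Vf [C bf]]; split; last by exists (`|s| * C); exact: bmZ.
    by apply: Veq (VZ s _ Vf) => x xJ; rewrite (wprimZ _ bw1 bf).
  - move=> f k fk [Vf [C bf]]; split; last by exists C; exact: bm_eq bf.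
    by apply: Veq Vf => x xJ; apply: (wprim_eq w1 fk).
have VT' f : V' f -> V' (volterra al w2 w1 f).
  move=> [Vf [C bf]]; split; last exact: (volterra_bm ab bw2 bw1 bf).
  exact: VT Vf.
have e1 : 0 < e / (M + 1) by rewrite divr_gt0// ltr_wpDl.
have Hw2g := Lpn_bmM p1 abW bw2 Hg.
have [psi [[Vpsi [C bpsi]] Hpsi]] := volterra_dense ab de0 p1 bw2 bw1 w2de w1de linV' VT' Hw2g e1.
exists (fun x => c * cst 1 x + wprim al w1 psi x); split; first by apply: VD Vpsi; exact: VZ.
have ig : ibl al be g by have [K _ HK] := Lpn_ibl p1 abW; have [] := HK _ _ Hg.
have iwp := bm_ibl (bmM bw1 bpsi).
(* The derivative of the error equals w1 (w2 g - psi) because [w1 w2 = 1]; its norm is at most M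
   times that of w2 g - psi. *)
exists 0, (fun x => g x - w1 x * psi x); split.
- by rewrite normr0 ltW.
- have h := Lpn_bmM p1 abW bw1 Hpsi.
  apply: Lpn_eq (LpnW (ltW p0) h _).
    by move=> x xJ; rewrite mulrBr mulrA w12// mul1r.
  by rewrite mulrA ler_pdivrMr ?ltr_wpDl// mulrC ler_wpM2l ?(ltW e_gt0)// lerDl.
- move=> x xJ; move: (xJ); rewrite in_itvE => /andP[ax xb].
  rewrite (FE x xJ) primB; [|exact: iblS ig|exact: iblS iwp].
  by rewrite /cst /wprim; ring.
Qed.

(** The error is exactly [T r] with [r = w1 h' - phi]. Two multiplications by weights and two
    integrations raise an error of order m to order m + 2, at the cost of the constant [K]. *)
Lemma sob_denseSS m : (exists e, Sob m.+1 w1 e) -> (exists e, Sob m.+1 w2 e) ->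
  sob_dense m -> sob_dense m.+2.
Proof.
move=> [e1 H1] [e2 H2] IH F e0 [c [g [ce Hg' FE]]] e e_gt0; have [V1 VD VZ Veq] := linV.
have Hg : Sob m.+1 g e0 := Hg'.
have [C C0 HC] := Sob_mul ab p1 m; have [D D0 HD] := Sob_alg ab p1 m.
have [c' [h' [_ Hh' w2gE]]] := HD _ _ _ _ H2 Hg.
have e10 := Sob_ge0 H1; have e20 := Sob_ge0 H2.
have Hh := HC _ _ _ _ H1 Hh'.
pose K := D * (e1 * (C * e2)).
have K0 : 0 <= K by rewrite !mulr_ge0.
have eK : 0 < e / (K + 1) by rewrite divr_gt0// ltr_wpDl.
have [phi [Vphi Hphi]] := IH _ _ Hh _ eK.
have ih := Sob_integrable ab p1 Hh; have ihp := Sob_integrable ab p1 Hphi.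
have iphi : ibl al be phi.
  apply: (@ibl_eq _ _ _ (fun x => w1 x * h' x - (w1 x * h' x - phi x))); last exact: iblB.
  by move=> x _; ring.
exists (fun x => c * cst 1 x + (c' * prim al w1 x + T phi x)); split.
  exact: (VD _ _ (VZ c _ V1) (VD _ _ (VZ c' _ Vphi1) (VT Vphi))).
pose r x := w1 x * h' x - phi x.
have Hr2 := Sob_prim (HC _ _ _ _ H2 Hphi).
have Hr1 := Sob_prim (HD _ _ _ _ H1 Hr2).
have KE : D * (e1 * (C * (e2 * (e / (K + 1))))) <= e.
  have -> : D * (e1 * (C * (e2 * (e / (K + 1))))) = K * e / (K + 1) by rewrite /K; ring.
  by rewrite ler_pdivrMr ?ltr_wpDl// mulrC ler_wpM2l ?(ltW e_gt0)// lerDl.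
apply: (Sob_eq (m := m.+2) _ (SobW p1 Hr1 KE)) => x xJ; move: (xJ); rewrite in_itvE => /andP[ax xb].
have iw2r : ibl al be (fun t => w2 t * r t) by exact: bm_iblM bw2 ihp.
have iw2p : ibl al be (fun t => w2 t * phi t) by exact: bm_iblM bw2 iphi.
have ig := Sob_integrable ab p1 Hg.
have prE t : t \in `[al, be] -> prim al (fun s => w2 s * r s) t = prim al h' t - wprim al w2 phi t.
  move=> tJ; move: (tJ); rewrite in_itvE => /andP[at_ tb].
  rewrite /wprim -primB; [|exact: iblS (Sob_integrable ab p1 Hh')|exact: iblS iw2p].
  apply: eq_prim => s; rewrite in_itvE => /andP[as_ st].
  have sJ : s \in `[al, be] by rewrite in_itvE as_ (le_trans st).
  by rewrite /r mulrBr [w2 s * (w1 s * _)]mulrA [w2 s * w1 s]mulrC w12// mul1r.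
have gE t : t \in `[al, be] -> g t = w1 t * c' + w1 t * prim al h' t.
  by move=> tJ; rewrite -mulrDr -(w2gE t tJ) mulrA w12// mul1r.
have iw1 (u : R -> R) : ibl al be u -> ibl al x (fun t => w1 t * prim al u t).
  move=> iu; apply: (@iblS _ al be) => //.
  exact: bm_ibl (bmM bw1 (prim_bmx abW iu)).
have iw1c : ibl al x (fun t => c' * w1 t).
  by apply: (@iblS _ al be) => //; apply: iblZ; exact: bm_ibl bw1.
rewrite (FE x xJ).
rewrite (@eq_prim _ _ _ (fun t => w1 t * prim al h' t - w1 t * wprim al w2 phi t)); last first.
  move=> t; rewrite in_itvE => /andP[at_ tx].
  by rewrite prE ?mulrBr// in_itvE at_ (le_trans tx).
rewrite (@eq_prim _ _ g (fun t => c' * w1 t + w1 t * prim al h' t)); last first.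
  move=> t; rewrite in_itvE => /andP[at_ tx].
  by rewrite gE ?[w1 t * c']mulrC// in_itvE at_ (le_trans tx).
rewrite primB; [|exact: iw1 (Sob_integrable ab p1 Hh')|exact: iw1 iw2p].
rewrite primD//; last exact: iw1 (Sob_integrable ab p1 Hh').
rewrite primZ; last by apply: (@iblS _ al be) => //; exact: bm_ibl bw1.
have -> : T phi x = prim al (fun t => w1 t * wprim al w2 phi t) x by [].
rewrite /cst.
move: (prim al (fun t => w1 t * prim _ _ t) x) (prim al w1 x) (prim al (fun t => _ * wprim _ _ _ t) x) => u v w; ring.
Qed.

(** [sob_denseSS] climbs two orders at once, so m and m + 1 are carried together. The claim at m + 1
    is made conditional on weights of order m, one more than the claim at m provides. *)
Theorem Sob_dense m : (exists e, Sob m.-1 w1 e) -> (exists e, Sob m.-1 w2 e) ->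
  forall F e0, Sob m F e0 -> forall e : R, 0 < e ->
  exists phi, V phi /\ Sob m (fun x => F x - phi x) e.
Proof.
move=> H1 H2.
suff: sob_dense m by [].
have W k w : (exists e, Sob k.+1 w e) -> exists e, Sob k w e.
  by move=> [ew Hw]; have [C _ HC] := SobS ab p1 k; eexists; exact: HC Hw.
suff [] : (sob_dense m) /\ ((exists e, Sob m w1 e) -> (exists e, Sob m w2 e) -> sob_dense m.+1) by [].
elim: m H1 H2 => [|m IH] H1 H2.
  by split; [exact: sob_dense0|move=> _ _; exact: sob_dense1].
case: m IH H1 H2 => [|m] IH H1 H2.
  split; first exact: sob_dense1.
  by move=> H1' H2'; apply: sob_denseSS => //; exact: sob_dense0.
have [D0 D1] := IH (W _ _ H1) (W _ _ H2).
split; first by apply: D1.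
by move=> H1' H2'; apply: sob_denseSS => //; apply: D1; exact: W.
Qed.

End SobolevDensity.

(** * Formal powers *)

Section FormalPowers.
Context {R : realType}.
Local Notation mu := (@lebesgue_measure R).
Implicit Types (f g h F G psi phi : R -> R) (x y z c d : R).
Variables (al be x0 : R).
Hypotheses (ab : al < be) (x0J : x0 \in `[al, be]).
Let abW : al <= be := ltW ab.

Lemma int_from_toE f x : ibl al be f -> x \in `[al, be] ->
  int_from_to x0 x f = prim al f x - prim al f x0.
Proof.
move=> jf; move: x0J; rewrite !in_itvE => /andP[a0 b0] /andP[ax bx].
rewrite /int_from_to; case: leP => x0x.
  rewrite (prim_split a0 x0x); first by rewrite addrAC subrr add0r.
  exact: iblS jf.
rewrite (prim_split ax (ltW x0x)); first by rewrite opprD addrA subrr add0r.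
exact: iblS jf.
Qed.

Lemma int_from_to_ae f g x : measurable_fun `[al, be] f -> measurable_fun `[al, be] g ->
  {ae mu, forall t, t \in `[al, be] -> f t = g t} -> x \in `[al, be] ->
  int_from_to x0 x f = int_from_to x0 x g.
Proof.
move=> mf mg fg; move: x0J; rewrite !in_itvE => /andP[a0 b0] /andP[ax bx].
have H y z : al <= y -> z <= be -> prim y f z = prim y g z.
  move=> ay zb; apply: (@prim_ae _ _ be) => //.
  - by apply: measurable_funS mf => //; apply: subset_itvScc; rewrite bnd_simp.
  - by apply: measurable_funS mg => //; apply: subset_itvScc; rewrite bnd_simp.
  apply: (ae_filterS fg) => t ft.
  by rewrite in_itvE => /andP[yt tb]; apply: ft; rewrite in_itvE tb (le_trans ay).
rewrite /int_from_to; case: leP => x0x; first exact: H.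
by congr (- _); exact: H.
Qed.

Variables (a A : R -> R) (de M : R).
Hypotheses (de0 : 0 < de) (ma : measurable_fun `[al, be] a).
Hypothesis aA : {ae mu, forall t, t \in `[al, be] -> a t = A t}.
Local Notation w1 := (fun t => (A t ^+ 2)^-1).
Local Notation w2 := (fun t => A t ^+ 2).
Hypotheses (bw1 : bm al be M w1) (bw2 : bm al be M w2).
Local Notation T := (volterra al w1 w2).
Local Notation fp := (formal_power a x0).

(** The formal powers are built from [a], the weights from the representative [A]. Values enter only
    under integrals, so the replacement gives equality at every point. *)
Lemma fp1 x : x \in `[al, be] -> fp 1 x = prim al w1 x - prim al w1 x0.
Proof.
move=> xJ; rewrite -int_from_toE//; last exact: bm_ibl bw1.
apply: int_from_to_ae => //; first by apply: measurable_invr; exact: measurable_funX.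
  by have [] := bw1.
by apply: (ae_filterS aA) => t /[apply] ->.
Qed.

(** Moving the base point from [x0] to [al] subtracts a constant from each of the two nested
    integrals: the inner one, [q], becomes a multiple of [prim al w1] after the outer integration,
    and the outer one is [K]. *)
Lemma fpSS k C : bm al be C (fp k) -> exists q K, forall x, x \in `[al, be] ->
  fp k.+2 x = (k.+2 * k.+1)%:R * (T (fp k) x - q * prim al w1 x - K).
Proof.
move=> bk; pose q := wprim al w2 (fp k) x0.
have bu := wprim_bm ab bw2 bk.
have buq := bmB bu (bm_cst al be q).
have ma2 : measurable_fun `[al, be] (fun t => a t ^+ 2) by exact: measurable_funX.
have uE t : t \in `[al, be] -> int_from_to x0 t (fun s => a s ^+ 2 * fp k s) = wprim al w2 (fp k) t - q.
  move=> tJ; rewrite -int_from_toE//; last exact: bm_ibl (bmM bw2 bk).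
  apply: int_from_to_ae => //.
  - by apply: measurable_funM => //; have [] := bk.
  - by have [] := bmM bw2 bk.
  - by apply: (ae_filterS aA) => s /[apply] ->.
pose v x := T (fp k) x - q * prim al w1 x.
exists q, (v x0) => x xJ /=; congr (_ * _).
have vE y : y \in `[al, be] -> prim al (fun t => w1 t * (wprim al w2 (fp k) t - q)) y = v y.
  rewrite in_itvE => /andP[ay yb].
  rewrite (@eq_prim _ _ _ (fun t => w1 t * wprim al w2 (fp k) t - q * w1 t)); last first.
    by move=> t _; ring.
  rewrite primB; [|exact: iblS (bm_ibl (bmM bw1 bu))|exact: iblS (iblZ q (bm_ibl bw1))].
  by rewrite primZ//; exact: iblS (bm_ibl bw1).
rewrite -/(v x) -!vE// -int_from_toE//; last exact: bm_ibl (bmM bw1 buq).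
apply: int_from_to_ae => //.
- apply: (@eq_measurable_fun _ _ _ _ _ (fun t => (a t ^+ 2)^-1 * (wprim al w2 (fp k) t - q))).
    by move=> t; rewrite inE => tJ; rewrite uE.
  apply: measurable_funM; first exact: measurable_invr.
  by have [] := buq.
- by have [] := bmM bw1 buq.
- apply: (ae_filterS aA) => t at_ tJ.
  by rewrite uE// at_.
Qed.

Lemma fp_bm k : exists C, bm al be C (fp k).
Proof.
have b1 := prim_bm abW bw1.
(* The recursion has step two, so two consecutive powers are carried. *)
suff [] : (exists C, bm al be C (fp k)) /\ (exists C, bm al be C (fp k.+1)) by [].
elim: k => [|k [[C bk] bk1]]; first split.
- by exists `|1 : R|; exact: bm_cst.
- eexists; apply: bm_eq (bmB b1 (bm_cst al be (prim al w1 x0))) => x xJ.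
  by rewrite fp1.
split=> //; have [q [K fE]] := fpSS bk; have [CT bT] := volterra_bm ab bw1 bw2 bk; eexists.
apply: bm_eq (bmZ (k.+2 * k.+1)%:R (bmB (bmB bT (bmZ q b1)) (bm_cst al be K))) => x xJ.
by rewrite fE.
Qed.

Definition fp_span h := exists n (c : nat -> R),
  {in `[al, be], forall x, h x = \sum_(k < n) c k * fp k x}.

Lemma fp_span_lin : lin_space al be fp_span.
Proof.
split.
- by exists 1%N, (fun=> 1) => x _; rewrite big_ord1 mul1r.
- move=> f g [n [c fE]] [m [d gE]].
  (* Both sums are widened to [n + m] terms, with coefficients padded by 0. *)
  exists (n + m)%N, (fun k => (if (k < n)%N then c k else 0) + (if (k < m)%N then d k else 0)) => x xJ.
  rewrite fE// gE// (big_ord_widen (n + m) (fun k => c k * fp k x)) ?leq_addr//.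
  rewrite (big_ord_widen (n + m) (fun k => d k * fp k x)) ?leq_addl//.
  rewrite big_mkcond [X in _ + X]big_mkcond -big_split/=; apply: eq_bigr => k _.
  by case: ifP; case: ifP => _ _; ring.
- move=> s f [n [c fE]]; exists n, (fun k => s * c k) => x xJ.
  by rewrite fE// mulr_sumr; apply: eq_bigr => k _; rewrite mulrA.
- by move=> f g fg [n [c fE]]; exists n, c => x xJ; rewrite -fg// fE.
Qed.

Lemma fp_span_fp k : fp_span (fp k).
Proof.
exists k.+1, (fun i => (i == k)%:R) => x _.
rewrite big_ord_recr/= eqxx mul1r big1 ?add0r// => i _.
by rewrite (ltn_eqF (ltn_ord i)) mul0r.
Qed.

Lemma fp_span_prim : fp_span (prim al w1).
Proof.
have [V1 VD VZ Veq] := fp_span_lin.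
apply: Veq (VD _ _ (fp_span_fp 1) (VZ (prim al w1 x0) _ V1)) => x xJ.
by rewrite fp1// /cst mulr1 subrK.
Qed.

(** [fpSS] is solved for [T (fp k)]: its other terms are a multiple of [fp k.+2], a multiple of
    [prim al w1] and a constant, all in the span. *)
Lemma fp_span_volterra h : fp_span h -> fp_span (T h).
Proof.
have [V1 VD VZ Veq] := fp_span_lin.
have VTfp k : fp_span (T (fp k)).
  have [C bk] := fp_bm k; have [q [K fE]] := fpSS bk.
  apply: Veq (VD _ _ (VZ (k.+2 * k.+1)%:R^-1 _ (fp_span_fp k.+2))
    (VD _ _ (VZ q _ fp_span_prim) (VZ K _ V1))) => x xJ.
  rewrite fE// mulKf; last by rewrite pnatr_eq0.
  by rewrite /cst; ring.
(* Boundedness is added because the linearity of [T] is used on bounded functions. *)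
pose V' h := fp_span (T h) /\ exists C, bm al be C h.
have linV' : lin_space al be V'.
  split.
  - by split; [exact: (VTfp 0)|exists `|1 : R|; exact: bm_cst].
  - move=> f k [Vf [C bf]] [Vk [C' bk]]; split; last by exists (C + C'); exact: bmD.
    apply: Veq (VD _ _ Vf Vk) => x xJ.
    rewrite /volterra -(wprimD bw1 (wprim_bm ab bw2 bf) (wprim_bm ab bw2 bk) xJ).
    by apply: (wprim_eq w1 _ xJ) => t tJ; rewrite (wprimD bw2 bf bk).
  - move=> s f [Vf [C bf]]; split; last by exists (`|s| * C); exact: bmZ.
    by apply: Veq (VZ s _ Vf) => x xJ; rewrite (volterraZ ab bw1 bw2 _ bf).
  - move=> f k fk [Vf [C bf]]; split; last by exists C; exact: bm_eq bf.
    by apply: Veq Vf => x xJ; apply: (volterra_eq w1 w2 fk).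
move=> [n [c hE]].
have [VS _] : V' (fun x => \sum_(k < n) c k * fp k x).
  by apply: (lin_space_sum _ _ linV') => k; split; [exact: VTfp|exact: fp_bm].
by apply: Veq VS => x xJ; apply: volterra_eq xJ => t tJ; rewrite hE.
Qed.

Lemma fp_Sob p m k : 1 <= p -> (exists e, Sob al be p m w1 e) -> (exists e, Sob al be p m w2 e) ->
  exists e, Sob al be p m.+1 (fp k) e.
Proof.
move=> p1 S1 S2.
suff [] : (exists e, Sob al be p m.+1 (fp k) e) /\ (exists e, Sob al be p m.+1 (fp k.+1) e) by [].
have Scst c : exists e, Sob al be p m.+1 (fun=> c) e by exact: Sob_cst.
have Sp1 : exists e, Sob al be p m.+1 (prim al w1) e.
  by have [e He] := S1; eexists; exact: Sob_prim He.
elim: k => [|k [Sk Sk1]]; split=> //.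
- exact: Scst.
- have [e He] := Sp1; have [e' He'] := Scst (prim al w1 x0).
  by eexists; apply: Sob_eq (SobB ab p1 He He') => x xJ; exact: esym (fp1 xJ).
- have [C bk] := fp_bm k; have [q [K fE]] := fpSS bk.
  have [e He] := Sp1; have [e' He'] := Scst K.
  have [eT HT] := volterra_Sob ab p1 S1 S2 Sk.
  by eexists; apply: Sob_eq (SobZ ab p1 (k.+2 * k.+1)%:R (SobB ab p1 (SobB ab p1 HT (SobZ ab p1 q He)) He')) => x xJ; exact: esym (fE _ xJ).
Qed.

End FormalPowers.

(** * Completeness when the weights are bounded above and below *)

Section Completeness.
Context {R : realType}.
Local Notation mu := (@lebesgue_measure R).
Implicit Types (f g h F G psi phi : R -> R) (x y z c d : R).
Variables (I : set R) (al be p x0 : R).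
Hypotheses (itvI : is_interval I) (ab : al < be) (p1 : 1 <= p).
Hypotheses (sI1 : `]al, be[%classic `<=` I) (sI2 : I `<=` `[al, be]%classic).
Hypothesis (intI : I° = `]al, be[%classic).
Hypothesis (x0J : x0 \in `[al, be]).

Variables (a A : R -> R) (de M : R) (m : nat).
Hypotheses (de0 : 0 < de) (ma : measurable_fun `[al, be] a).
Hypothesis aA : {ae mu, forall t, t \in `[al, be] -> a t = A t}.
Local Notation w1 := (fun t => (A t ^+ 2)^-1).
Local Notation w2 := (fun t => A t ^+ 2).
Hypotheses (bw1 : bm al be M w1) (bw2 : bm al be M w2).
Hypotheses (w1de : {in `[al, be], forall x, de <= w1 x}) (w2de : {in `[al, be], forall x, de <= w2 x}).
Hypotheses (S1 : exists e, Sob al be p m w1 e) (S2 : exists e, Sob al be p m w2 e).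

Theorem formal_power_complete :
  complete_system (Sobolev I m.+1 p) (Sobolev_norm I m.+1 p) (formal_power a x0).
Proof.
have fbm := fp_bm ab x0J ma aA bw1 bw2.
have [C C0 HC] := Sob_Sobolev itvI ab p1 sI1 sI2 intI m.+1.
split=> [k|f Sf e e0].
  have [B [mf _]] := fbm k.
  have [eF HF] := fp_Sob ab x0J ma aA bw1 bw2 k p1 S1 S2.
  have [|] := HC _ _ _ HF mf; last by [].
  by apply: aeW => x _.
have [F [eF [HF fF]]] := Sobolev_Sob itvI ab p1 sI1 sI2 intI Sf.
have mf : measurable_fun `[al, be] f by have [Lf _] := Sf; exact: Lp_on_meas Lf.
have w12 : {in `[al, be], forall x, w1 x * w2 x = 1}.
  by move=> x xJ; rewrite mulVf// gt_eqF// (lt_le_trans de0)// w2de.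
(* Dividing by C + 1 rather than [C] makes the final inequality strict and covers [C = 0]. *)
have eC : 0 < e / (C + 1) by rewrite divr_gt0// ltr_wpDl.
have [phi [[n [c phiE]] Hphi]] := @Sob_dense _ al be de M p w1 w2 (fp_span al be x0 a) ab de0 p1 bw1 bw2 w1de w2de w12
  (fp_span_lin al be x0 a) (fp_span_prim x0J ma aA bw1)
  (fp_span_volterra ab x0J ma aA bw1 bw2) m.+1 S1 S2 _ _ HF _ eC.
exists n, (fun k => c k).
have mS : measurable_fun `[al, be] (fun x => f x - \sum_(k < n) c k * formal_power a x0 k x).
  apply: measurable_funB => //; apply: measurable_sum => k.
  by apply: measurable_funM => //; have [B []] := fbm k.
have [|_ le] := HC _ _ _ Hphi mS.
  by apply: (ae_filterS fF) => t ft tJ; rewrite ft// phiE.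
apply: le_lt_trans le _; rewrite lte_fin mulrA ltr_pdivrMr ?ltr_wpDl// mulrC.
by rewrite ltr_pM2l// ltrDl.
Qed.

End Completeness.

(** * Lower bounds for the impedance *)

Section LowerBound.
Context {R : realType}.
Local Notation mu := (@lebesgue_measure R).
Implicit Types (f g h F G psi phi : R -> R) (x y z c d : R).

Lemma ae_itv_ex c d (P : R -> Prop) : c < d -> {ae mu, forall t, P t} ->
  exists2 t, t \in `[c, d] & P t.
Proof.
move=> cd H; apply: contrapT => no.
have : mu.-negligible `[c, d]%classic.
  apply: negligibleS H => t tJ Pt; apply: no; exists t => //.
move=> /(negligibleP mu (measurable_itv _)) E.
have := lebesgue_measure_itv `[c, d]; rewrite E /= lte_fin cd -EFinB => /eqP.
by rewrite eqe eq_sym subr_eq0 (gt_eqF cd).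
Qed.

(** A violation at one point persists by continuity on a nondegenerate subinterval, one-sided if the
    point is an end, and such an interval is not a null set. *)
Lemma ae_prim_ge al be A c g b : al < be -> ibl al be g ->
  {in `[al, be], forall x, A x = c + prim al g x} ->
  {ae mu, forall t, t \in `[al, be] -> b <= A t} -> {in `[al, be], forall x, b <= A x}.
Proof.
move=> ab jg AE bA x xJ; rewrite leNgt; apply/negP => Ab.
have [r r0 Hr] : exists2 r, 0 < r & forall y, y \in `[al, be] -> `|y - x| < r -> A y < b.
  have [|r r0 Hr] := prim_sub_small (ltW ab) jg xJ (e := b - A x); first by rewrite subr_gt0.
  exists r => // y yJ yx; have := Hr y yJ yx; rewrite ltr_norml => /andP[_].
  rewrite (AE y yJ) (AE x xJ); lra.
move: (xJ); rewrite in_itvE => /andP[ax xb].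
have [u [v [au ux xv vb [uv ru rv]]]] : exists u v, [/\ al <= u, u <= x, x <= v, v <= be &
    [/\ u < v, x - r < u & v < x + r]].
  have [xbe|bex] := ltP x be.
    exists x, (Num.min be (x + r / 2)); split=> //.
    - by rewrite le_min xb /=; lra.
    - by rewrite ge_min lexx.
    - by split; [rewrite lt_min xbe /=; lra|lra|rewrite gt_min; apply/orP; right; lra].
  exists (Num.max al (x - r / 2)), x; split=> //.
  - by rewrite le_max lexx.
  - by rewrite ge_max ax /=; lra.
  - split; [rewrite gt_max; apply/andP; split; lra|rewrite lt_max; apply/orP; right; lra|lra].
have [t tuv Ht] := ae_itv_ex uv bA.
move: tuv; rewrite in_itvE => /andP[ut tv].
have tJ : t \in `[al, be] by rewrite in_itvE (le_trans au ut) (le_trans tv).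
suff : A t < b by rewrite ltNge (Ht tJ).
apply: Hr => //.
rewrite ltr_norml; apply/andP; split; lra.
Qed.

(** Here [b] is the inverse of the given impedance, of which [A] is only a representative, since
    that is where the integrability is known. Writing |g| as [A |g b|] brings in the small mass of
    [g b] near a zero of [A]. *)
Lemma prim_lower_bound al be A c g (b : R -> R) : al < be -> ibl al be g ->
  {in `[al, be], forall x, A x = c + prim al g x} ->
  {ae mu, forall t, t \in `[al, be] -> 0 < A t} ->
  measurable_fun `[al, be] b ->
  {ae mu, forall t, t \in `[al, be] -> b t * A t = 1} ->
  ibl al be (fun t => g t * b t) ->
  exists2 de : R, 0 < de & {in `[al, be], forall x, de <= A x}.
Proof.
move=> ab jg AE A0 mb bA jgb; have abW := ltW ab.
have cA : {within `[al, be], continuous A}.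
  apply: (@subspace_eq_continuous _ _ _ (fun x => c + prim al g x)).
    by move=> x; rewrite inE => xJ; rewrite /from_subspace AE.
  by apply: wcD; [exact: wc_cst|exact: prim_cont].
have mA : measurable_fun `[al, be] A by exact: subspace_continuous_measurable_fun.
have Age0 : {in `[al, be], forall x, 0 <= A x}.
  apply: (ae_prim_ge ab jg AE).
  by apply: (ae_filterS A0) => t H tJ; exact/ltW/H.
have [z zJ Hz] := EVT_min abW cA.
exists (A z) => //; rewrite lt_neqAle Age0// andbT; apply/negP => /eqP/esym Az.
pose k t := `|g t * b t|.
have jk : ibl al be k by exact: ibl_norm.
have [u [v [au uz zv vb [uv _ _ kuv]]]] := small_itv ab jk (fun t _ => normr_ge0 _) zJ.
have cAuv : {within `[u, v], continuous A}.
  by apply: continuous_subspaceW cA; apply: subset_itvScc; rewrite bnd_simp.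
have [y yuv Hy] := EVT_max (ltW uv) cAuv.
have sub t : t \in `[u, v] -> t \in `[al, be].
  by rewrite !in_itvE => /andP[ut tv]; rewrite (le_trans au ut) (le_trans tv vb).
have Auv x : x \in `[u, v] -> A x <= A y * prim u k v.
  move=> xuv; move: (xuv); rewrite in_itvE => /andP[ux xv].
  have jA : ibl u v (fun t => A y * k t) by apply: iblZ; exact: iblS jk.
  have jg' : ibl u v (fun t => `|g t|) by apply: ibl_norm; exact: iblS jg.
  have gk : prim u (fun t => `|g t|) v <= A y * prim u k v.
    rewrite -primZ; last exact: iblS jk.
    have -> : prim u (fun t => `|g t|) v = prim u (fun t => A t * k t) v.
      apply: (@prim_ae _ _ v) => //.
      - exact: ibl_meas jg'.
      - apply: measurable_funM; first exact: subspace_continuous_measurable_fun.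
        exact: ibl_meas (iblS au vb jk).
      - apply: (ae_filterS bA) => t Ht /sub tJ.
        rewrite /k -[A t]ger0_norm ?Age0// -normrM mulrCA [A t * _]mulrC Ht// mulr1 //.
    apply: le_prim => //.
      have [MA bmA] := cont_bm cAuv.
      by apply: bm_iblM bmA _; exact: iblS jk.
    by move=> t tuv; rewrite ler_wpM2r ?normr_ge0// Hy.
  apply: le_trans gk.
  have AB : `|A x - A z| <= prim u (fun t => `|g t|) v.
    have jS y1 y2 : u <= y1 -> y2 <= v -> ibl y1 y2 g.
      by move=> h1 h2; apply: iblS jg; [exact: le_trans au h1|exact: le_trans h2 vb].
    have H y1 y2 : u <= y1 -> y1 <= y2 -> y2 <= v -> `|A y2 - A y1| <= prim u (fun t => `|g t|) v.
      move=> h1 h2 h3.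
      have y1J : y1 \in `[al, be] by apply: sub; rewrite in_itvE h1 (le_trans h2).
      have y2J : y2 \in `[al, be] by apply: sub; rewrite in_itvE h3 (le_trans h1).
      move: (y1J); rewrite in_itvE => /andP[ay1 _].
      rewrite (AE y2 y2J) (AE y1 y1J) (prim_split ay1 h2); last first.
        by apply: iblS jg => //; exact: le_trans vb.
      rewrite (_ : _ - _ = prim y1 g y2); last by ring.
      apply: le_trans (ler_norm_prim (jS _ _ h1 h3)) _.
      rewrite (prim_split h1 (le_trans h2 h3)); last exact: ibl_norm (jS _ _ (lexx u) (lexx v)).
      rewrite (prim_split h2 h3); last exact: ibl_norm (jS _ _ h1 (lexx v)).
      have p1 := @prim_ge0 _ u (fun t => `|g t|) y1 (fun t _ => normr_ge0 _).
      have p2 := @prim_ge0 _ y2 (fun t => `|g t|) v (fun t _ => normr_ge0 _).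
      lra.
    have [xz|zx] := leP x z; first by rewrite distrC; exact: H.
    by apply: H => //; exact: ltW.
  by move: AB; rewrite Az subr0; apply: le_trans; exact: ler_norm.
(* The maximum [A y] over [[u, v]] is at most half of itself, so [A] is nonpositive there, against
   its positivity almost everywhere. *)
have Ay : A y <= 0.
  have A1 := Auv y yuv; have A2 := Age0 y (sub _ yuv).
  have A3 : A y * prim u k v <= A y * (1 / 2) by exact: ler_wpM2l.
  lra.
have [t tuv Ht] := ae_itv_ex uv A0.
by have := Ht (sub _ tuv); rewrite ltNge (le_trans (Hy _ tuv) Ay).
Qed.

Lemma Lpn_powR_ibl al be p f e : Lpn al be p f e -> ibl al be (fun t => `|f t| `^ p).
Proof.
move=> [mf e0 H]; apply/integrableP; split.
  by apply/measurable_EFinP; exact: powR_meas.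
apply: le_lt_trans (ltry (e `^ p)); apply: le_trans H.
rewrite le_eqVlt; apply/orP; left; apply/eqP; apply: eq_integral => t _ /=.
by rewrite ger0_norm// powR_ge0.
Qed.

(** The square is at most 1 where |f| <= 1 and at most |f|^p elsewhere. *)
Lemma Lpn_sqr_ibl al be p f e : 2 <= p -> Lpn al be p f e -> ibl al be (fun t => f t ^+ 2).
Proof.
move=> p2 Hf; have jf := Lpn_powR_ibl Hf; have mf := Lpn_meas Hf.
apply: (@ibl_le _ _ _ _ (fun t => 1 + `|f t| `^ p)).
- exact: measurable_funX.
- by apply: iblD jf; exact: bm_ibl (bm_cst al be 1).
- move=> t _; rewrite normrX; have [f1|f1] := leP `|f t| 1.
    by apply: (@le_trans _ _ 1); rewrite ?lerDl ?powR_ge0// expr_le1.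
  apply: (@le_trans _ _ (`|f t| `^ p)); last by rewrite lerDr.
  by rewrite -powR_mulrn// ler_powR// ltW.
Qed.

Lemma ibl_mul_sqr (al be : R) f g : measurable_fun `[al, be] f -> measurable_fun `[al, be] g ->
  ibl al be (fun t => f t ^+ 2) -> ibl al be (fun t => g t ^+ 2) -> ibl al be (fun t => f t * g t).
Proof.
move=> mf mg jf jg; apply: (@ibl_le _ _ _ _ (fun t => f t ^+ 2 + g t ^+ 2)).
- exact: measurable_funM.
- exact: iblD.
- move=> t _; rewrite ler_norml; apply/andP; split.
    have := sqr_ge0 (f t + g t); have := sqr_ge0 (f t); have := sqr_ge0 (g t); nra.
  have := sqr_ge0 (f t - g t); have := sqr_ge0 (f t); have := sqr_ge0 (g t); nra.
Qed.

Lemma weights_bounds (al be : R) (A : R -> R) (b B : R) : measurable_fun `[al, be] A -> 0 < b ->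
  {in `[al, be], forall x, b <= A x} -> {in `[al, be], forall x, A x <= B} -> b <= B ->
  exists2 de, 0 < de & exists M, [/\ bm al be M (fun t => (A t ^+ 2)^-1), bm al be M (fun t => A t ^+ 2),
    {in `[al, be], forall x, de <= (A x ^+ 2)^-1} & {in `[al, be], forall x, de <= A x ^+ 2}].
Proof.
move=> mA b0 bA AB bB; have B0 := lt_le_trans b0 bB.
have b2 : 0 < b ^+ 2 by rewrite exprn_gt0.
have B2 : 0 < B ^+ 2 by rewrite exprn_gt0.
have lo x : x \in `[al, be] -> b ^+ 2 <= A x ^+ 2.
  by move=> xJ; rewrite ler_sqr ?nnegrE ?bA ?(ltW b0)// (le_trans (ltW b0))// bA.
have up x : x \in `[al, be] -> A x ^+ 2 <= B ^+ 2.
  by move=> xJ; rewrite ler_sqr ?nnegrE ?AB ?(ltW B0)// (le_trans (ltW b0))// bA.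
exists (Num.min (b ^+ 2) (B ^+ 2)^-1); first by rewrite lt_min b2 invr_gt0.
exists (Num.max (B ^+ 2) (b ^+ 2)^-1); split.
- split; first by apply: measurable_invr; exact: measurable_funX.
  move=> x xJ; have A2 := lt_le_trans b2 (lo x xJ).
  by rewrite ger0_norm ?invr_ge0 ?(ltW A2)// le_max lef_pV2 ?posrE// lo ?orbT.
- split; first exact: measurable_funX.
  by move=> x xJ; rewrite ger0_norm ?sqr_ge0// le_max up.
- move=> x xJ; have A2 := lt_le_trans b2 (lo x xJ).
  by rewrite ge_min lef_pV2 ?posrE// up ?orbT.
- by move=> x xJ; rewrite ge_min lo.
Qed.

End LowerBound.

(** * The one-point interval and the two cases of the theorem *)

Section Cases.
Context {R : realType}.
Local Notation mu := (@lebesgue_measure R).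
Implicit Types (f g h F G psi phi : R -> R) (x y z c d : R).

(** A point is a null set with empty interior, so all integrals vanish and conditions on the
    interior are void. *)
Lemma Sobolev_set1 al m p f : 1 <= p ->
  Sobolev `[al, al] m p f /\ Sobolev_norm `[al, al] m p f = 0%E.
Proof.
move=> p1; have mf h : measurable_fun `[al, al] h by rewrite set_itv1; exact: measurable_fun_set1.
have p0 : p^-1 != 0 by rewrite invr_neq0// gt_eqF// (lt_le_trans ltr01).
have N0 h : Lp_norm `[al, al] p%:E h = 0%E.
  by rewrite Lp_normE// set_itv1 integral_set1 poweR0r.
have LO h : Lp_on `[al, al] p%:E h.
  have /(LpnP _ _ _ p1 (lexx 0))[] // : Lpn al al p h 0.
  by split => //; rewrite set_itv1 integral_set1 lee_fin powR_ge0.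
have loc h : locally_integrable `[al, al]° h.
  rewrite interval_bounded_interior; last 3 first.
  - exact: interval_is_interval.
  - by exists al => x /=; rewrite in_itv/= => /andP[].
  - by exists al => x /=; rewrite in_itv/= => /andP[].
  have -> : [set r : R | inf `[al, al]%classic < r < sup `[al, al]%classic] = set0.
    rewrite set_itv1 inf1 sup1; apply/seteqP; split => // x /= /andP[h1 h2].
    by have := lt_trans h1 h2; rewrite ltxx.
  split; [exact: measurable_fun_set0|exact: open0|move=> K + _].
  by rewrite subset0 => ->; rewrite integral_set0.
split; last by rewrite /Sobolev_norm big1.
split=> // k _; exists (cst 0); split => //; split => // psi _.
by rewrite set_itv1 !Rintegral_set1 mulr0.
Qed.

Variables (I : set R) (al be p x0 : R) (a : R -> R).
Hypotheses (itvI : is_interval I) (ab : al < be) (p1 : 1 <= p).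
Hypotheses (sI1 : `]al, be[%classic `<=` I) (sI2 : I `<=` `[al, be]%classic).
Hypothesis (intI : I° = `]al, be[%classic).
Hypothesis (x0J : x0 \in `[al, be]).
Let abW : al <= be := ltW ab.

Lemma ae_IJ (P : R -> Prop) : {ae mu, forall x, I x -> P x} ->
  {ae mu, forall x, x \in `[al, be] -> P x}.
Proof.
move=> H; apply: ae_oo_cc; apply: (ae_filterS H) => t Ht tJ.
by apply: Ht; exact: sI1.
Qed.

(** The bound is taken at least 1 so that bounds [M] for [a] and [K] for 1/a always satisfy
    [K^-1 <= M]. *)
Lemma Lp_on_oo_bounded f : Lp_on I +oo%E f ->
  exists2 M : R, 1 <= M & {ae mu, forall x, x \in `[al, be] -> `|f x| <= M}.
Proof.
rewrite /Lp_on inE => /andP[_]; rewrite inE/= /finite_norm unlock.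
have muT : (0 < mu [set: R])%E.
  apply: (@lt_le_trans _ _ (mu `[0, 1]%classic)); last by apply: le_measure; rewrite ?inE.
  by have := lebesgue_measure_itv `[0 : R, 1]; rewrite /= => ->; rewrite lte_fin ltr01 -EFinB lte_fin subr0.
rewrite muT => /(@ess_supr_bounded _ _ _ mu (fun x => `|(f \_ I) x|))[M HM].
exists (Num.max M 1); first by rewrite le_max lexx orbT.
apply: ae_IJ; apply: (ae_filterS HM) => t Ht It.
by rewrite le_max; move: Ht; rewrite patchE mem_set// => ->.
Qed.

Hypothesis ha : proper_impedance I a.

Let a0 : {ae mu, forall x, x \in `[al, be] -> 0 < a x}.
Proof. by apply: ae_IJ; have [] := ha. Qed.

Let ma : measurable_fun `[al, be] a.
Proof. by have [_ H _] := ha; exact: Lp_on_meas H. Qed.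

Lemma complete_bounded : Lp_on I +oo%E a -> Lp_on I +oo%E (fun x => (a x)^-1) ->
  complete_system (Sobolev I 1 p) (Sobolev_norm I 1 p) (formal_power a x0).
Proof.
move=> /Lp_on_oo_bounded[M M1 HM] /Lp_on_oo_bounded[K K1 HK].
have K0 := lt_le_trans ltr01 K1.
(* Truncation at the essential bounds of [a] and of 1/a: on the interval it alters [a] only on a
   null set and yields bounds at every point. *)
pose A t := Num.max K^-1 (Num.min (a t) M).
have KM : K^-1 <= M by apply: le_trans M1; rewrite invf_le1.
have mA : measurable_fun `[al, be] A by apply: measurable_maxr => //; exact: measurable_minr.
have lA : {in `[al, be], forall x, K^-1 <= A x} by move=> x _; rewrite le_max lexx.
have uA : {in `[al, be], forall x, A x <= M} by move=> x _; rewrite ge_max KM ge_min lexx orbT.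
have aA : {ae mu, forall t, t \in `[al, be] -> a t = A t}.
  apply: (ae_filterS3 a0 HM HK) => t H0 H1 H2 tJ.
  have a_gt0 := H0 tJ; rewrite /A min_l; last by apply: le_trans (H1 tJ); exact: ler_norm.
  rewrite max_r// -[leRHS]invrK lef_pV2 ?posrE ?invr_gt0//.
  by apply: le_trans (H2 tJ); exact: ler_norm.
have iK : 0 < K^-1 by rewrite invr_gt0.
have [de de0 [B [b1 b2 d1 d2]]] := weights_bounds mA iK lA uA KM.
apply: (formal_power_complete itvI ab p1 sI1 sI2 intI x0J de0 ma aA b1 b2 d1 d2).
- by eexists; exact: Lpn_bm p1 abW b1.
- by eexists; exact: Lpn_bm p1 abW b2.
Qed.

(** What has to be secured is a positive lower bound for [A]. If [p >= 2], or if [n] is positive so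
    that a' is bounded, then a' and 1/a are both square integrable and [prim_lower_bound] applies;
    in the remaining case the bound comes from [low]. *)
Lemma complete_Sobolev n : Sobolev I n.+1 p a ->
  (n = 0%N -> p < 2 -> Lp_on I +oo%E (fun x => (a x)^-1)) ->
  complete_system (Sobolev I n.+2 p) (Sobolev_norm I n.+2 p) (formal_power a x0).
Proof.
move=> /(Sobolev_Sob itvI ab p1 sI1 sI2 intI)[A [e [HA aA]]] low.
have HA' := HA; case: HA' => c [g [ce Hg' AE]].
have Hg : Sob al be p n g e := Hg'.
have jg := Sob_integrable ab p1 Hg.
have A0 : {ae mu, forall t, t \in `[al, be] -> 0 < A t}.
  by apply: (ae_filterS2 a0 aA) => t H0 H1 tJ; rewrite -H1// H0.
have mb : measurable_fun `[al, be] (fun t => (a t)^-1) by exact: measurable_invr.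
have [B _ HB] := Sob_bm ab p1 n; have bA := HB _ _ HA.
have [de de0 deA] : exists2 de : R, 0 < de & {in `[al, be], forall x, de <= A x}.
  have via_sqr : ibl al be (fun t => g t ^+ 2) ->
      exists2 de : R, 0 < de & {in `[al, be], forall x, de <= A x}.
    move=> jg2; apply: (prim_lower_bound ab jg AE A0 mb).
      apply: (ae_filterS2 a0 aA) => t H0 H1 tJ.
      by rewrite -H1// mulVf// gt_eqF// H0.
    apply: ibl_mul_sqr => //; first exact: ibl_meas jg.
    have le12 : 1 <= 2 :> R by rewrite ler1n.
    have [_ _ /(Lp_on_Lpn itvI le12 sI1 sI2)[eb Hb]] := ha.
    exact: Lpn_sqr_ibl Hb.
  case: n low Hg {Hg' HA HB} => [|n] low Hg; last first.
    have [B' _ HB'] := Sob_bm ab p1 n; have bg := HB' _ _ Hg.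
    by apply: via_sqr; exact: bm_ibl (bmM bg bg).
  have [p2|p2] := leP 2 p; first by apply: via_sqr; exact: Lpn_sqr_ibl p2 Hg.
  have [K K1 HK] := Lp_on_oo_bounded (low erefl p2).
  have K0 := lt_le_trans ltr01 K1.
  exists K^-1; first by rewrite invr_gt0.
  apply: (ae_prim_ge ab jg AE).
  apply: (ae_filterS3 a0 aA HK) => t H0 H1 H2 tJ.
  rewrite -H1// -[leRHS]invrK lef_pV2 ?posrE ?invr_gt0 ?H0//.
  by apply: le_trans (H2 tJ); exact: ler_norm.
have uA : {in `[al, be], forall x, A x <= B * e}.
  by move=> x xJ; apply: le_trans (bA.2 x xJ); exact: ler_norm.
have alJ : al \in `[al, be] by rewrite in_itvE lexx.
have [de' de'0 [M [b1 b2 d1 d2]]] := weights_bounds bA.1 de0 deA uA (le_trans (deA al alJ) (uA al alJ)).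
have S2 : exists e', Sob al be p n.+1 (fun t => A t ^+ 2) e'.
  have [C _ HC] := Sob_alg ab p1 n; eexists.
  by apply: Sob_eq (HC _ _ _ _ HA HA) => t _; rewrite expr2.
have S1 : exists e', Sob al be p n.+1 (fun t => (A t ^+ 2)^-1) e'.
  by have [e' H] := S2; exact: (Sob_inv ab p1 de'0 d2 H).
exact: (formal_power_complete itvI ab p1 sI1 sI2 intI x0J de'0 ma aA b1 b2 d1 d2 S1 S2).
Qed.

End Cases.

Lemma bounded_interval_itv (R : realType) (I : set R) : is_interval I -> bounded_set I -> I !=set0 ->
  exists al be, [/\ al <= be, `]al, be[%classic `<=` I, I `<=` `[al, be]%classic & I° = `]al, be[%classic].
Proof.
move=> itvI [M [_ HM]] I0.
have bI x : I x -> `|x| <= M + 1 by apply: HM; rewrite ltrDl.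
have lI : has_lbound I by exists (- (M + 1)) => x /bI; rewrite ler_norml => /andP[].
have uI : has_ubound I by exists (M + 1) => x /bI; rewrite ler_norml => /andP[].
have E : I° = `]inf I, sup I[%classic.
  by rewrite interval_bounded_interior//; apply/seteqP; split => x /=; rewrite in_itv.
have sI : I `<=` `[inf I, sup I]%classic.
  by move=> x Ix /=; rewrite in_itv/= (ge_inf lI Ix) (ub_le_sup uI Ix).
exists (inf I), (sup I); split => //; last by rewrite -E; exact: interior_subset.
by have [x /sI] := I0; rewrite /= in_itv/= => /andP[]; exact: le_trans.
Qed.

(* In (ii), when m = 2 and p < 2, the hypotheses a \in W^{1,p}(I) and
   1/a \in L^2(I) allow a to vanish at a point of the closure of I (for
   instance a(x) = x^(1/4) on ]0, 1[ with p = 1), and then phi^(1) is not in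
   W^{2,p}(I): 1/a \in L^oo(I) is required there. For all other m and p it
   follows from the other hypotheses. *)
Theorem theorem22 (R : realType) (I : set R) (a : R -> R) (x0 p : R)
    (itvI : is_interval I) (bndI : bounded_set I) (x0I : closure I x0)
    (ha : proper_impedance I a) (p1 : 1 <= p) :
  (Lp_on I +oo%E a -> Lp_on I +oo%E (fun x => (a x)^-1) ->
     complete_system (Sobolev I 1 p) (Sobolev_norm I 1 p)
       (formal_power a x0)) /\
  (forall m : nat, (2 <= m)%N ->
     Sobolev I m.-1 p a ->
     (m = 2%N -> p < 2 -> Lp_on I +oo%E (fun x => (a x)^-1)) ->
     complete_system (Sobolev I m p) (Sobolev_norm I m p)
       (formal_power a x0)).
Proof.
have I0 : I !=set0.
  apply/set0P/negP => /eqP I0; move: x0I; rewrite I0 closure0; exact.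
have [al [be [ab sI1 sI2 intI]]] := bounded_interval_itv itvI bndI I0.
have x0J : x0 \in `[al, be].
  by have := closure_subset sI2 x0I; rewrite -((closure_id _).1 (@itv_closed _ _ al be)).
(* A one-point interval is allowed: there all norms vanish and the empty sum approximates
   everything. *)
move: ab; rewrite le_eqVlt => /predU1P[E|ab]; last first.
  split; first exact: (complete_bounded itvI ab p1 sI1 sI2 intI x0J ha).
  move=> [|[|m]] // _ Sa low; apply: (complete_Sobolev itvI ab p1 sI1 sI2 intI x0J ha Sa).
  by move=> m0; apply: low; rewrite m0.
have -> : I = `[al, al]%classic.
  apply/seteqP; split; first by rewrite {2}E.
  have [x Ix] := I0; have := sI2 x Ix; rewrite -E set_itv1 /= => xa.
  by move=> y /= ->; rewrite -xa.
have triv m : complete_system (Sobolev `[al, al] m p) (Sobolev_norm `[al, al] m p) (formal_power a x0).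
  split=> [k|f _ e e0]; first by have [] := Sobolev_set1 al m (formal_power a x0 k) p1.
  exists 0%N, (fun=> 0); have [_ ->] := Sobolev_set1 al m
    (fun x => f x - \sum_(k < 0) 0 * formal_power a x0 k x) p1.
  by rewrite lte_fin.
by split.
Qed.
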